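(* Let $(\mathsf{V}_n)_{n\ge 0}$, with $\mathsf{V}_0=\mathsf{H}^2(\mathbb{T})$, be a decreasing sequence of invariant subspaces of $\mathsf{H}^2(\mathbb{T})$, and let $\mathsf{V}_\infty=\bigcap_{n\ge 0}\mathsf{V}_n$. For $n\in\{0,1,2,\dots\}\cup\{\infty\}$ let $\mathcal{P}_n$ be the projection operator associated with $\mathsf{V}_n$ (as defined in the context), and for $n\ge0$ let $\mathcal{Q}_n=\mathcal{P}_n-\mathcal{P}_{n+1}$. Then, for all $p\in(1,+\infty)$ and all $f\in\mathsf{H}^p(\mathbb{T})$, the series $$\sum_{n\ge 0}\mathcal{Q}_nf$$ converges to $f-\mathcal{P}_\infty f$ in $L^p(\mathbb{T})$.
   Context: $\mathbb{T}$ is the unit circle with normalized measure $\mathrm{d}\theta/2\pi$. For $p\ge1$, $\mathsf{H}^p(\mathbb{T})$ is the Hardy space of analytic functions on the unit disk with $\sup_{0<r<1}\int_0^{2\pi}|f(re^{i\theta})|^p\frac{\mathrm{d}\theta}{2\pi}<\infty$, identified through boundary values with the functions in $L^p(\mathbb{T})$ whose Fourier coefficients of negative order vanish. An inner function is a bounded analytic function on the unit disk whose boundary values have modulus $1$ almost everywhere. An invariant subspace of $\mathsf{H}^2(\mathbb{T})$ is a closed linear subspace stable under multiplication by $z=e^{i\theta}$; if nonzero it has the form $u\,\mathsf{H}^2(\mathbb{T})$ with $u$ inner (unique up to a unimodular constant). The orthogonal projection $H$ of $L^2(\mathbb{T})$ onto $\mathsf{H}^2(\mathbb{T})$ extends to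 a bounded operator from $L^p(\mathbb{T})$ to $\mathsf{H}^p(\mathbb{T})$ for $1<p<\infty$. For $u$ inner, the operator associated with $u$ (or with the subspace $u\,\mathsf{H}^2(\mathbb{T})$) is $H_u: f\mapsto u\,H(u^{-1}f)$; on $L^2$ it is the orthogonal projection onto $u\,\mathsf{H}^2(\mathbb{T})$, and it is bounded from $L^p(\mathbb{T})$ to $\mathsf{H}^p(\mathbb{T})$ for every $p\in(1,\infty)$. For an invariant subspace $\mathsf{V}=u\,\mathsf{H}^2(\mathbb{T})$ the associated projection operator is $H_u$; for $\mathsf{V}=\{0\}$ it is the zero operator. *)

(* Defs.v *)
From mathcomp Require Import all_boot all_order all_algebra.
From mathcomp Require Import all_classical all_reals all_analysis.
From mathcomp Require Import complex.

(* Functions on the unit circle are written in the angle: f : R -> R[i] stands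
   for e^{i t} |-> f t.  They are taken modulo the probability measure [circle]
   below, which does not charge the complement of [0, 2 pi], so that only the
   restriction of f to [0, 2 pi] matters.  As for Lnorm in the library,
   elements of L^p are honest functions; almost-everywhere equality is made
   explicit where it is needed. *)

Set Implicit Arguments.
Unset Strict Implicit.
Unset Printing Implicit Defensive.
Import Order.TTheory GRing.Theory Num.Theory.
Import numFieldNormedType.Exports.

Local Open Scope classical_set_scope.
Local Open Scope complex_scope.
Local Open Scope ring_scope.

Section Circle.
Context {R : realType}.

Lemma two_pi_gt0 : (0 : R) < 2 * pi.
Proof. by rewrite mulr_gt0 ?pi_gt0. Qed.

(* normalized arc length d t / (2 pi) *)
Definition circle : probability (measurableTypeR R) R :=
  uniform_prob two_pi_gt0.

Definition expi (t : R) : R[i] := cos t +i* sin t.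

Implicit Types (p : \bar R) (f g u : R -> R[i]) (V : set (R -> R[i])).

Definition circle_ae_eq f g : Prop := {ae circle, forall t : R, f t = g t}.

Definition circle_norm p f : \bar R :=
  Lnorm circle p (fun t : R => (Normc.normc (f t))%:E).

Definition circle_Lp p : set (R -> R[i]) := [set f |
  [/\ measurable_fun [set: measurableTypeR R] (fun t : R => complex.Re (f t)),
      measurable_fun [set: measurableTypeR R] (fun t : R => complex.Im (f t)) &
      (circle_norm p f < +oo)%E]].

Definition circle_int f : R[i] :=
  Rintegral circle setT (fun t : R => complex.Re (f t)) +i*
  Rintegral circle setT (fun t : R => complex.Im (f t)).

Definition fourier_coef f (n : int) : R[i] :=
  circle_int (fun t => f t * expi t ^ (- n)).

Definition inner_prod f g : R[i] := circle_int (fun t => f t * (g t)^*).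

(* Hardy spaces, as spaces of boundary functions *)
Definition Hardy p : set (R -> R[i]) := [set f |
  circle_Lp p f /\ forall n : int, n < 0 -> fourier_coef f n = 0].

Definition inner_fun u : Prop :=
  Hardy +oo u /\ {ae circle, forall t : R, Normc.normc (u t) = 1}.

(* Closedness under L^2 limits makes V stable under almost-everywhere equality
   (within L^2). *)
Record invariant_subspace V : Prop := InvariantSubspace {
  invariant_subH2 : V `<=` Hardy 2%:E;
  invariant_zero : V (fun=> 0);
  invariant_lin : forall (a : R[i]) f g,
    V f -> V g -> V (fun t => a * f t + g t);
  invariant_closed : forall (F : nat -> R -> R[i]) f,
    (forall n, V (F n)) -> circle_Lp 2%:E f ->
    circle_norm 2%:E (fun t => F n t - f t) @[n --> \oo] --> 0%E -> V f;
  invariant_mulz : forall f, V f -> V (fun t => expi t * f t) }.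

(* the subspaces {0} and u H^2, as subspaces of L^2 *)
Definition zero_subspace : set (R -> R[i]) :=
  [set f | circle_Lp 2%:E f /\ circle_ae_eq f (fun=> 0)].

Definition mul_H2 u : set (R -> R[i]) := [set f | circle_Lp 2%:E f /\
  exists2 h, Hardy 2%:E h & circle_ae_eq f (fun t => u t * h t)].

Definition is_orthogonal_projection V f g : Prop :=
  V g /\ forall h, V h -> inner_prod (fun t => f t - g t) h = 0.

(* T is a bounded linear operator from L^p to H^p that coincides on
   L^2 `&` L^p with the orthogonal projection of L^2 onto H^2. *)
Record is_Riesz_projection p (T : (R -> R[i]) -> (R -> R[i])) : Prop :=
  IsRieszProjection {
    Riesz_range : forall f, circle_Lp p f -> Hardy p (T f);
    Riesz_lin : forall (a : R[i]) f g, circle_Lp p f -> circle_Lp p g ->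
      circle_ae_eq (T (fun t => a * f t + g t)) (fun t => a * T f t + T g t);
    Riesz_bounded : exists C : R, forall f, circle_Lp p f ->
      (circle_norm p (T f) <= C%:E * circle_norm p f)%E;
    Riesz_ext : forall f, circle_Lp 2%:E f -> circle_Lp p f ->
      is_orthogonal_projection (Hardy 2%:E) f (T f) }.

(* Such a T exists for 1 < p < +oo (M. Riesz) and, L^2 `&` L^p being dense in
   L^p, is determined up to almost-everywhere equality. *)
Definition Riesz_projection p : (R -> R[i]) -> (R -> R[i]) :=
  xget (fun _ _ => 0) [set T | is_Riesz_projection p T].

Definition inner_operator p u f : R -> R[i] :=
  fun t => u t * Riesz_projection p (fun s => (u s)^-1 * f s) t.

(* A nonzero invariant subspace is mul_H2 u for an inner u (Beurling), unique
   up to a unimodular constant, on which inner_operator does not depend. *)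
Definition subspace_inner V : R -> R[i] :=
  xget (fun=> 1) [set u | inner_fun u /\ V = mul_H2 u].

Definition subspace_projection p V f : R -> R[i] :=
  if `[< V = zero_subspace >] then fun=> 0
  else inner_operator p (subspace_inner V) f.

End Circle.

(* Main.v *)
Require Import Defs.
From mathcomp Require Import all_boot all_order all_algebra.
From mathcomp Require Import all_classical all_reals all_analysis.
From mathcomp Require Import complex.
From mathcomp Require Import measurable_realfun ring lra.

(* All the P_n are bounded on L^p by the norm of the Riesz projection, because
   multiplication by an inner function is isometric.  The partial sums
   telescope to P_0 f - P_N f, and P_0 f = f on H^p, so the claim is that
   P_N f -> P_oo f in L^p; by uniform boundedness and truncation it suffices to
   treat bounded f.  There P_N f and P_oo f are the orthogonal projections on
   V_N and V_oo, which converge in L^2 since the squared norms of P_N f decrease;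
   L^p convergence follows from the monotonicity of norms for p <= 2 and, for
   p > 2, from |g|_p^p <= |g|_2 |g|_(2p-2)^(p-1) and boundedness in L^(2p-2).

   Two classical theorems are needed on the way.

   Riesz: for 1 < p < 2 and an analytic polynomial F = u + i v with u >= 0 and
   F(0) real, the mean of Re (F^2 / (F + s)) is F(0)^2 / (F(0) + s) >= 0 for
   every s > 0.  Summing these inequalities with weights s^(p-1) over dyadic s
   bounds the p-norm of F by that of u.  Nonnegative bounded functions are
   approximated by nonnegative trigonometric polynomials, bounded ones are
   combinations of nonnegative ones, and p > 2 follows by duality.

   Beurling: let k be the least index of a nonzero Fourier coefficient of an
   element of V.  The part of such an element orthogonal to
   {f in V | coefficient k of f is 0}, which contains z V, has constant modulus
   and generates V. *)

Import Order.TTheory GRing.Theory Num.Theory.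
Import numFieldNormedType.Exports.

Local Open Scope classical_set_scope.
Local Open Scope ring_scope.

Set Implicit Arguments.
Unset Strict Implicit.
Unset Printing Implicit Defensive.
Local Open Scope complex_scope.
Local Open Scope ring_scope.

(** * Integration over the circle *)

Section RealMean.
Context {R : realType}.
Local Notation mu := (@circle R).
Local Notation mfun g := (measurable_fun [set: measurableTypeR R] (g : R -> R)).
Implicit Types (f g : R -> R).

(** [Riesz_projection] and [subspace_inner] are choices by [xget]: nothing can be said about them
    until the theorems of Riesz and Beurling supply a candidate, and the projections for two
    exponents are unrelated choices. They are compared through L^2: on a function lying in both L^2
    and L^p the value is an orthogonal projection, hence determined almost everywhere. Bounded
    functions, which lie in every L^p, are therefore treated before density is invoked.

    No analytic function on the disk occurs. Analytic parts are described by Fourier coefficients,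
    and the mean of (F + s)^-1 is found by a geometric series on the circle. Positivity of u keeps F
    + s away from 0. In the real part of F^2 / (F + s) the function v contributes the negative term
    - s v^2 / |F + s|^2, so that the sign of the mean bounds v in terms of u. The positive terms are
    at most 2 u min(1, w / s) with w = max(u, |v|); their weighted sum over dyadic s is controlled
    by u w^(p-1) at both ends of the range because 0 < p - 1 < 1, whence the restriction p < 2. *)

Definition summable_on_circle g := mu.-integrable setT (EFin \o g).
Local Notation ig := summable_on_circle.
Definition mean g : R := \int[mu]_t g t.

Lemma circle_ae_filter : Filter (almost_everywhere mu).
Proof. exact: ae_filter_ringOfSetsType. Qed.

Lemma aeS (P Q : R -> Prop) : (forall t, P t -> Q t) ->
  {ae mu, forall t, P t} -> {ae mu, forall t, Q t}.
Proof. by move=> PQ p; exact: (@filterS _ _ circle_ae_filter _ _ PQ p). Qed.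

Lemma aeS2 (P Q S : R -> Prop) : (forall t, P t -> Q t -> S t) ->
  {ae mu, forall t, P t} -> {ae mu, forall t, Q t} -> {ae mu, forall t, S t}.
Proof. by move=> PQ p q; exact: (@filterS2 _ _ circle_ae_filter _ _ _ PQ p q). Qed.

Lemma ig_mfun f : ig f -> mfun f.
Proof. by move=> /measurable_int/measurable_EFinP. Qed.

Lemma ig_le f g : mfun f -> (forall t, `|f t| <= g t) -> ig g -> ig f.
Proof.
move=> mf fg ig_g; apply: (le_integrable _ _ _ ig_g) => //.
  exact/measurable_EFinP.
move=> t _ /=; rewrite lee_fin (le_trans (fg t))//; exact: ler_norm.
Qed.

Lemma ig_cst c : ig (fun=> c).
Proof. exact: finite_measure_integrable_cst. Qed.

Lemma ig_bnd f c : mfun f -> (forall t, `|f t| <= c) -> ig f.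
Proof. by move=> mf fc; apply: (ig_le mf fc); exact: ig_cst. Qed.

Lemma igD f g : ig f -> ig g -> ig (fun t => f t + g t).
Proof. by move=> F G; apply: eq_integrable (integrableD _ F G). Qed.

Lemma igZ c f : ig f -> ig (fun t => c * f t).
Proof. by move=> F; apply: eq_integrable (integrableZl _ c F). Qed.

Lemma igN f : ig f -> ig (fun t => - f t).
Proof. by move=> F; apply: eq_integrable (integrableN F). Qed.

Lemma igB f g : ig f -> ig g -> ig (fun t => f t - g t).
Proof. by move=> F G; apply: igD => //; exact: igN. Qed.

Lemma ig_norm f : ig f -> ig (fun t => `|f t|).
Proof. by move=> F; exact: integrable_norm. Qed.

Lemma ig_sum (I : Type) (s : seq I) (F : I -> R -> R) :
  (forall i, ig (F i)) -> ig (fun t => \sum_(i <- s) F i t).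
Proof.
move=> iF; elim: s => [|i s ih].
  by under eq_fun do rewrite big_nil; exact: ig_cst.
by under eq_fun do rewrite big_cons; exact: igD.
Qed.

Lemma meanD f g : ig f -> ig g -> mean (fun t => f t + g t) = mean f + mean g.
Proof. by move=> F G; rewrite /mean RintegralD. Qed.

Lemma meanZ c f : ig f -> mean (fun t => c * f t) = c * mean f.
Proof. by move=> F; rewrite /mean RintegralZl. Qed.

Lemma meanN f : ig f -> mean (fun t => - f t) = - mean f.
Proof. by move=> F; rewrite -mulN1r -meanZ//; congr mean; apply/funext=> t; rewrite mulN1r. Qed.

Lemma meanB f g : ig f -> ig g -> mean (fun t => f t - g t) = mean f - mean g.
Proof. by move=> F G; rewrite /mean RintegralB. Qed.

Lemma mean_cst c : mean (fun=> c) = c.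
Proof. rewrite /mean Rintegral_cst//;
rewrite [X in fine X](_ : _ = 1%E); first by rewrite mulr1.
exact: (@probability_setT _ _ _ mu). Qed.

Lemma mean_ge0 f : (forall t, 0 <= f t) -> 0 <= mean f.
Proof. by move=> f0; apply: Rintegral_ge0. Qed.

Lemma mean_le f g : ig f -> ig g -> (forall t, f t <= g t) -> mean f <= mean g.
Proof. by move=> F G fg; apply: le_Rintegral. Qed.

Lemma mean_norm f : ig f -> `|mean f| <= mean (fun t => `|f t|).
Proof. by move=> F; apply: le_normr_Rintegral. Qed.

Lemma mean_sum (I : Type) (s : seq I) (F : I -> R -> R) :
  (forall i, ig (F i)) ->
  mean (fun t => \sum_(i <- s) F i t) = \sum_(i <- s) mean (F i).
Proof.
move=> iF; elim: s => [|i s ih].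
  by under eq_fun do rewrite big_nil; rewrite big_nil mean_cst.
under eq_fun do rewrite big_cons.
by rewrite big_cons meanD// ?ih//; exact: ig_sum.
Qed.

Lemma meanE f : ig f -> (mean f)%:E = (\int[mu]_t (f t)%:E)%E.
Proof. by move=> F; rewrite /mean /Rintegral fineK//; exact: integrable_fin_num. Qed.

Lemma mean_ae f g : mfun f -> mfun g -> {ae mu, forall t, f t = g t} ->
  mean f = mean g.
Proof.
move=> mf mg fg; rewrite /mean /Rintegral; congr fine; apply: ae_eq_integral => //.
- exact/measurable_EFinP.
- exact/measurable_EFinP.
- by apply: (aeS _ fg) => t /= -> _.
Qed.

Lemma ig_ae f g : ig f -> mfun g -> {ae mu, forall t, f t = g t} -> ig g.
Proof.
move=> F mg fg; have := F; move/integrableP=> [mf fy].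
apply/integrableP; split; first exact/measurable_EFinP.
rewrite [X in (X < _)%E](_ : _ = \int[mu]_t `|(f t)%:E|)%E//.
apply: ae_eq_integral => //.
- by apply: measurableT_comp => //; exact/measurable_EFinP.
- exact: measurableT_comp.
- by apply: (aeS _ fg) => t /= -> _.
Qed.

Lemma mean_eq0_ae f : ig f -> (forall t, 0 <= f t) -> mean f = 0 ->
  {ae mu, forall t, f t = 0}.
Proof.
move=> F f0 mf0.
have : (\int[mu]_(t in setT) `|(f t)%:E| = 0)%E.
  by under eq_integral do rewrite gee0_abs ?lee_fin//; rewrite -meanE// mf0.
have mf : measurable_fun [set: measurableTypeR R] (EFin \o f).
  by apply/measurable_EFinP; exact: ig_mfun.
move/(ae_eq_integral_abs mu measurableT mf) => ae0.
by apply: (aeS _ ae0) => t /(_ Logic.I) [].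
Qed.

Lemma mean_cvg_dominated (F : nat -> R -> R) f g :
  (forall n, mfun (F n)) -> mfun f -> ig g ->
  {ae mu, forall t, F ^~ t @ \oo --> f t} ->
  (forall n t, `|F n t| <= g t) ->
  ig f /\ mean (fun t => `|F n t - f t|) @[n --> \oo] --> 0.
Proof.
move=> mF mf G cvF Fg.
have m1 n : measurable_fun [set: measurableTypeR R] (EFin \o F n).
  exact/measurable_EFinP.
have m2 : measurable_fun [set: measurableTypeR R] (EFin \o f).
  exact/measurable_EFinP.
have cv : {ae mu, forall t, setT t -> (EFin \o F n) t @[n --> \oo] --> (EFin \o f) t}.
  by apply: (aeS _ cvF) => t h _; apply: cvg_EFin => //; exact: nearW.
have dom : {ae mu, forall t, forall n, setT t -> (`|(EFin \o F n) t| <= (EFin \o g) t)%E}.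
  by apply: aeW => t n _; rewrite lee_fin.
have [iF c0 _] := dominated_convergence measurableT m1 m2 cv G dom.
split=> //.
suff h n : (mean (fun t => `|F n t - f t|))%:E =
    (\int[mu]_t `|(EFin \o F n) t - (EFin \o f) t|)%E.
  have /fine_cvgP[_] := c0; apply: cvg_trans; apply: near_eq_cvg; apply: nearW => n /=.
  by rewrite -[in LHS]h.
rewrite meanE//; apply: ig_norm; apply: igB => //.
exact: (ig_le (mF n) (Fg n)).
Qed.
End RealMean.

(** * Complex-valued functions on the circle *)

Section ComplexFun.
Context {R : realType}.
Local Notation mfun g := (measurable_fun [set: measurableTypeR R] (g : R -> R)).
Local Notation ig := summable_on_circle.
Local Notation cabs := (@Normc.normc R).
Implicit Types (f g h : R -> R[i]).

Lemma cabsE (z : R[i]) : cabs z = Num.sqrt (complex.Re z ^+ 2 + complex.Im z ^+ 2).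
Proof. by case: z. Qed.

Lemma cabs_ge0 (z : R[i]) : 0 <= cabs z.
Proof. by rewrite cabsE sqrtr_ge0. Qed.

Lemma sqr_cabs (z : R[i]) : cabs z ^+ 2 = complex.Re z ^+ 2 + complex.Im z ^+ 2.
Proof. by rewrite cabsE sqr_sqrtr// addr_ge0 ?sqr_ge0. Qed.

Lemma cabsD (z w : R[i]) : cabs (z + w) <= cabs z + cabs w.
Proof. exact: le_normcD. Qed.

Lemma cabsN (z : R[i]) : cabs (- z) = cabs z.
Proof. exact: normcN. Qed.

Lemma cabsB (z w : R[i]) : cabs (z - w) <= cabs z + cabs w.
Proof. by rewrite -(cabsN w) cabsD. Qed.

Lemma cabsM (z w : R[i]) : cabs (z * w) = cabs z * cabs w.
Proof. exact: Normc.normcM. Qed.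

Lemma cabsJ (z : R[i]) : cabs z^* = cabs z.
Proof. by case: z => a b /=; rewrite sqrrN. Qed.

Lemma cabs0 : cabs 0 = 0.
Proof. exact: Normc.normc0. Qed.

Lemma cabs1 : cabs 1 = 1.
Proof. exact: Normc.normc1. Qed.

Lemma cabs2 : cabs 2 = 2.
Proof. by rewrite -[2]/((1 + 1 : R[i])) cabsE /= addr0 expr0n addr0 sqrtr_sqr ger0_norm. Qed.

Lemma cabs_real (x : R) : cabs x%:C = `|x|.
Proof. by rewrite cabsE /= expr0n addr0 sqrtr_sqr. Qed.

Lemma le_Re_cabs (z : R[i]) : `|complex.Re z| <= cabs z.
Proof. by rewrite cabsE -sqrtr_sqr ler_sqrt ?addr_ge0 ?sqr_ge0// lerDl sqr_ge0. Qed.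

Lemma le_Im_cabs (z : R[i]) : `|complex.Im z| <= cabs z.
Proof. by rewrite cabsE -sqrtr_sqr ler_sqrt ?addr_ge0 ?sqr_ge0// lerDr sqr_ge0. Qed.

Lemma cabs_le (z : R[i]) : cabs z <= `|complex.Re z| + `|complex.Im z|.
Proof.
rewrite -(ler_pXn2r (ltn0Sn 1)) ?nnegrE ?cabs_ge0 ?addr_ge0 ?normr_ge0//.
rewrite sqr_cabs sqrrD !real_normK ?num_real// addrAC lerDl.
by rewrite mulrn_wge0// mulr_ge0.
Qed.

Lemma cReM (z w : R[i]) : complex.Re (z * w) =
  complex.Re z * complex.Re w - complex.Im z * complex.Im w.
Proof. by case: z w => [a b] []. Qed.

Lemma cImM (z w : R[i]) : complex.Im (z * w) =
  complex.Re z * complex.Im w + complex.Im z * complex.Re w.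
Proof. by case: z w => [a b] [c d] /=. Qed.

Lemma cReD (z w : R[i]) : complex.Re (z + w) = complex.Re z + complex.Re w.
Proof. by case: z w => [a b] []. Qed.

Lemma cImD (z w : R[i]) : complex.Im (z + w) = complex.Im z + complex.Im w.
Proof. by case: z w => [a b] []. Qed.

Lemma cReN (z : R[i]) : complex.Re (- z) = - complex.Re z.
Proof. by case: z. Qed.

Lemma cImN (z : R[i]) : complex.Im (- z) = - complex.Im z.
Proof. by case: z. Qed.

Lemma mulJ (z : R[i]) : z * z^* = (cabs z ^+ 2)%:C.
Proof.
by rewrite sqr_cabs; case: z => a b /=; apply/eqP; rewrite eq_complex /=; apply/andP; split; apply/eqP; ring.
Qed.

Lemma cabs_eq0 (z : R[i]) : cabs z = 0 -> z = 0.
Proof. exact: Normc.eq0_normc. Qed.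

Lemma cabsV (z : R[i]) : cabs z^-1 = (cabs z)^-1.
Proof. exact: Normc.normcV. Qed.

Lemma unimodularV (z : R[i]) : cabs z = 1 -> z^-1 = z^*.
Proof.
move=> z1; have z0 : z != 0.
  by apply/eqP => z0; move: z1; rewrite z0 cabs0 => /eqP; rewrite eq_sym oner_eq0.
by apply: (mulfI z0); rewrite divff// mulJ z1 expr1n.
Qed.

Lemma cabs_expi (t : R) : cabs (expi t) = 1.
Proof. by rewrite cabsE /= cos2Dsin2 sqrtr1. Qed.

Lemma expiD (s t : R) : expi (s + t) = expi s * expi t.
Proof. by apply/eqP; rewrite eq_complex /= cosD sinD; apply/andP; split; apply/eqP; ring. Qed.

Lemma expi0 : expi 0 = 1 :> R[i].
Proof. by rewrite /expi cos0 sin0. Qed.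

Lemma expiN (t : R) : expi (- t) = (expi t)^*.
Proof. by rewrite /expi cosN sinN. Qed.

Lemma expiV (t : R) : (expi t)^-1 = expi (- t).
Proof. by rewrite expiN unimodularV// cabs_expi. Qed.

Lemma expiX (t : R) (n : nat) : expi t ^+ n = expi (n%:R * t).
Proof.
elim: n => [|n ih]; first by rewrite expr0 mul0r expi0.
by rewrite exprS ih -expiD; congr expi; rewrite -[in RHS]nat1r mulrDl mul1r.
Qed.

Lemma expiXz (t : R) (n : int) : expi t ^ n = expi (n%:~R * t).
Proof.
case: n => n; first by rewrite -exprnP expiX.
by rewrite NegzE -exprnN expiX expiV; congr expi; rewrite mulrNz mulNr.
Qed.

Definition cmeas f := mfun (fun t => complex.Re (f t)) /\ mfun (fun t => complex.Im (f t)).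

Lemma cmeasD f g : cmeas f -> cmeas g -> cmeas (fun t => f t + g t).
Proof.
move=> [f1 f2] [g1 g2]; split.
  by under eq_fun do rewrite cReD; exact: measurable_funD.
by under eq_fun do rewrite cImD; exact: measurable_funD.
Qed.

Lemma cmeasN f : cmeas f -> cmeas (fun t => - f t).
Proof.
move=> [f1 f2]; split.
  by under eq_fun do rewrite cReN; exact: measurable_funN.
by under eq_fun do rewrite cImN; exact: measurable_funN.
Qed.

Lemma cmeasB f g : cmeas f -> cmeas g -> cmeas (fun t => f t - g t).
Proof. by move=> F G; apply: cmeasD => //; exact: cmeasN. Qed.

Lemma cmeasM f g : cmeas f -> cmeas g -> cmeas (fun t => f t * g t).
Proof.
move=> [f1 f2] [g1 g2]; split.
  by under eq_fun do rewrite cReM; apply: measurable_funB; exact: measurable_funM.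
by under eq_fun do rewrite cImM; apply: measurable_funD; exact: measurable_funM.
Qed.

Lemma cmeas_cst c : cmeas (fun=> c).
Proof. by split; exact: measurable_cst. Qed.

Lemma cmeasZ c f : cmeas f -> cmeas (fun t => c * f t).
Proof. by move=> F; apply: cmeasM => //; exact: cmeas_cst. Qed.

Lemma cRe_conj (z : R[i]) : complex.Re z^* = complex.Re z.
Proof. by case: z. Qed.

Lemma cIm_conj (z : R[i]) : complex.Im z^* = - complex.Im z.
Proof. by case: z. Qed.

Lemma cmeasJ f : cmeas f -> cmeas (fun t => (f t)^*).
Proof.
move=> [f1 f2]; split; first by under eq_fun do rewrite cRe_conj.
by under eq_fun do rewrite cIm_conj; exact: measurable_funN.
Qed.

Lemma cmeas_real (r : R -> R) : mfun r -> cmeas (fun t => (r t)%:C).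
Proof. by move=> mr; split => //=; exact: measurable_cst. Qed.

Lemma mfun_cabs f : cmeas f -> mfun (fun t => cabs (f t)).
Proof.
move=> [f1 f2]; rewrite (_ : (fun t => _) = (fun t => Num.sqrt
  (complex.Re (f t) ^+ 2 + complex.Im (f t) ^+ 2))); last by apply/funext => t; rewrite cabsE.
apply: (measurableT_comp (f := @Num.sqrt R)).
  by apply: continuous_measurable_fun; exact: sqrt_continuous.
by apply: measurable_funD; apply: measurable_funX.
Qed.

Lemma cmeasV f : cmeas f -> cmeas (fun t => (f t)^-1).
Proof.
move=> F; have [f1 f2] := F.
(* True at the zeros of [f] as well, since the inverse of 0 is 0. *)
have vE t : (f t)^-1 = ((cabs (f t) ^+ 2)^-1)%:C * (f t)^*.
  have [->|f0] := eqVneq (f t) 0; first by rewrite invr0 cabs0 expr0n /= invr0 mul0r.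
  apply: (mulfI f0); rewrite divff// mulrCA mulJ -rmorphM/= mulVf//.
  by rewrite expf_eq0/=; apply: contra_neq f0; exact: cabs_eq0.
under eq_fun do rewrite vE.
apply: cmeasM; last exact: cmeasJ.
apply: cmeas_real; under eq_fun do rewrite -powR_inv1 ?sqr_ge0//.
apply: (measurableT_comp (measurable_powR _)).
by apply: measurable_funX; exact: mfun_cabs.
Qed.

Lemma mfun_cos (a b : R) : mfun (fun t => cos (a * t + b)).
Proof.
apply: continuous_measurable_fun => t; apply: continuous_comp; last exact: continuous_cos.
apply: cvgD; last exact: cvg_cst.
by apply: cvgM; [exact: cvg_cst|exact: cvg_id].
Qed.

Lemma mfun_sin (a b : R) : mfun (fun t => sin (a * t + b)).
Proof.
apply: continuous_measurable_fun => t; apply: continuous_comp; last exact: continuous_sin.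
apply: cvgD; last exact: cvg_cst.
by apply: cvgM; [exact: cvg_cst|exact: cvg_id].
Qed.

Lemma cmeas_expiX (n : int) : cmeas (fun t => expi t ^ n).
Proof.
under eq_fun do rewrite expiXz; split; rewrite /expi/=.
  by under eq_fun do rewrite -[X in cos X]addr0; exact: mfun_cos.
by under eq_fun do rewrite -[X in sin X]addr0; exact: mfun_sin.
Qed.

Lemma cmeas_horner (P : {poly R[i]}) : cmeas (fun t => P.[expi t]).
Proof.
under eq_fun do rewrite horner_coef.
elim: (size P) => [|n ih].
  by under eq_fun do rewrite big_ord0; exact: cmeas_cst.
under eq_fun do rewrite big_ord_recr/=.
by apply: cmeasD => //; apply: cmeasZ; exact: (cmeas_expiX n).
Qed.

Lemma cmeas_ext f g : (forall t, f t = g t) -> cmeas f -> cmeas g.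
Proof. by move=> fg; rewrite (_ : f = g)//; apply/funext. Qed.

Definition csummable_on_circle f := cmeas f /\ ig (fun t => cabs (f t)).
Local Notation ci := csummable_on_circle.

Lemma ci_Re f : ci f -> ig (fun t => complex.Re (f t)).
Proof. by move=> [[f1 _] F]; apply: ig_le F => // t; exact: le_Re_cabs. Qed.

Lemma ci_Im f : ci f -> ig (fun t => complex.Im (f t)).
Proof. by move=> [[_ f2] F]; apply: ig_le F => // t; exact: le_Im_cabs. Qed.

Lemma ci_le f (g : R -> R) : cmeas f -> (forall t, cabs (f t) <= g t) -> ig g -> ci f.
Proof.
move=> F fg G; split => //; apply: ig_le G; first exact: mfun_cabs.
by move=> t; rewrite ger0_norm// cabs_ge0.
Qed.

Lemma ci_bnd f c : cmeas f -> (forall t, cabs (f t) <= c) -> ci f.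
Proof. by move=> F fc; apply: (ci_le F fc); exact: ig_cst. Qed.

Lemma ciD f g : ci f -> ci g -> ci (fun t => f t + g t).
Proof.
move=> [mf F] [mg G]; apply: (@ci_le _ (fun t => cabs (f t) + cabs (g t))).
- exact: cmeasD.
- by move=> t; exact: cabsD.
- exact: igD.
Qed.

Lemma ciZ c f : ci f -> ci (fun t => c * f t).
Proof.
move=> [mf F]; apply: (@ci_le _ (fun t => cabs c * cabs (f t))).
- exact: cmeasZ.
- by move=> t; rewrite cabsM.
- exact: igZ.
Qed.

Lemma ciN f : ci f -> ci (fun t => - f t).
Proof.
by move=> F; under eq_fun do rewrite -mulN1r; exact: ciZ.
Qed.

Lemma ciB f g : ci f -> ci g -> ci (fun t => f t - g t).
Proof. by move=> F G; apply: ciD => //; exact: ciN. Qed.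

Lemma ciJ f : ci f -> ci (fun t => (f t)^*).
Proof.
by move=> [mf F]; split; [exact: cmeasJ|under eq_fun do rewrite cabsJ].
Qed.

Lemma ciM_bnd f g c : ci f -> cmeas g -> (forall t, cabs (g t) <= c) ->
  ci (fun t => f t * g t).
Proof.
move=> [mf F] mg gc; apply: (@ci_le _ (fun t => c * cabs (f t))).
- exact: cmeasM.
- by move=> t; rewrite cabsM mulrC ler_wpM2r// cabs_ge0.
- exact: igZ.
Qed.

Local Notation I := (@circle_int R).

Lemma circle_intE f : I f = mean (fun t => complex.Re (f t)) +i* mean (fun t => complex.Im (f t)).
Proof. by []. Qed.

Lemma circle_intD f g : ci f -> ci g -> I (fun t => f t + g t) = I f + I g.
Proof.
move=> F G; rewrite !circle_intE.
under eq_fun do rewrite cReD.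
rewrite meanD; [|exact: ci_Re|exact: ci_Re].
under [X in _ +i* mean X = _]eq_fun do rewrite cImD.
by rewrite meanD; [|exact: ci_Im|exact: ci_Im].
Qed.

Lemma circle_intZ c f : ci f -> I (fun t => c * f t) = c * I f.
Proof.
move=> F; rewrite !circle_intE.
have F1 := ci_Re F; have F2 := ci_Im F.
under eq_fun do rewrite cReM.
rewrite meanB; [|exact: igZ|exact: igZ].
rewrite !meanZ//.
under [X in _ +i* mean X = _]eq_fun do rewrite cImM.
rewrite meanD; [|exact: igZ|exact: igZ].
by rewrite !meanZ//; case: c.
Qed.

Lemma circle_intN f : ci f -> I (fun t => - f t) = - I f.
Proof.
by move=> F; under eq_fun do rewrite -mulN1r; rewrite circle_intZ// mulN1r.
Qed.

Lemma circle_intB f g : ci f -> ci g -> I (fun t => f t - g t) = I f - I g.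
Proof. by move=> F G; rewrite circle_intD ?circle_intN//; exact: ciN. Qed.

Lemma circle_intJ f : ci f -> I (fun t => (f t)^*) = (I f)^*.
Proof.
move=> F; rewrite !circle_intE.
under eq_fun do rewrite cRe_conj.
under [X in _ +i* mean X]eq_fun do rewrite cIm_conj.
by rewrite meanN//; exact: ci_Im.
Qed.

Lemma circle_int_cst c : I (fun=> c) = c.
Proof. by rewrite circle_intE !mean_cst; case: c. Qed.

Lemma circle_int_sum_ci (J : Type) (s : seq J) (F : J -> R -> R[i]) :
  (forall i, ci (F i)) -> ci (fun t => \sum_(i <- s) F i t) /\
  I (fun t => \sum_(i <- s) F i t) = \sum_(i <- s) I (F i).
Proof.
move=> iF; elim: s => [|i s [ih1 ih2]].
  under eq_fun do rewrite big_nil; rewrite big_nil circle_int_cst; split => //.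
  by apply: (@ci_bnd _ 0); [exact: cmeas_cst|move=> t; rewrite cabs0].
under eq_fun do rewrite big_cons.
by rewrite big_cons circle_intD// ih2; split => //; exact: ciD.
Qed.

Lemma circle_int_sum (J : Type) (s : seq J) (F : J -> R -> R[i]) :
  (forall i, ci (F i)) ->
  I (fun t => \sum_(i <- s) F i t) = \sum_(i <- s) I (F i).
Proof. by move=> iF; have [] := circle_int_sum_ci s iF. Qed.

Lemma circle_int_ae f g : cmeas f -> cmeas g -> circle_ae_eq f g -> I f = I g.
Proof.
move=> [f1 f2] [g1 g2] fg; rewrite !circle_intE; congr Complex; apply: mean_ae => //.
  by apply: (aeS _ fg) => t ->.
by apply: (aeS _ fg) => t ->.
Qed.

(** Real and imaginary parts are estimated separately, whence the factor 2; it is absorbed later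
    into unspecified constants. *)
Lemma cabs_circle_int f : ci f -> cabs (I f) <= 2 * mean (fun t => cabs (f t)).
Proof.
move=> F; have [mf F'] := F; apply: le_trans (cabs_le _) _.
rewrite circle_intE/= mulrDl mul1r lerD//.
  apply: le_trans (mean_norm (ci_Re F)) _; apply: mean_le => //.
    exact/ig_norm/ci_Re.
  by move=> t; exact: le_Re_cabs.
apply: le_trans (mean_norm (ci_Im F)) _; apply: mean_le => //.
  exact/ig_norm/ci_Im.
by move=> t; exact: le_Im_cabs.
Qed.

End ComplexFun.

(** * Completeness of L^p *)

Section LpNorm.
Context {R : realType}.
Local Notation mu := (@circle R).
Local Notation mfun g := (measurable_fun [set: measurableTypeR R] (g : R -> R)).
Local Notation ig := summable_on_circle.
Local Notation cabs := (@Normc.normc R).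
Local Notation ci := csummable_on_circle.
Local Notation lp p := (@circle_Lp R p%:E).
Implicit Types (f g h : R -> R[i]) (p q : R).

(** A real number, for the sake of arithmetic. As [fine] sends +oo to 0, the value is meaningful
    only together with [lp p f]. *)
Definition nrm p f : R := fine (circle_norm p%:E f).

Lemma circle_norm_integral p f :
  circle_norm p%:E f = ((\int[mu]_t (cabs (f t) `^ p)%:E) `^ p^-1)%E.
Proof.
rewrite /circle_norm unlock; apply: (congr1 (fun x => (x `^ p^-1)%E)).
apply: eq_integral => t _.
by rewrite abse_EFin ger0_norm ?cabs_ge0// poweR_EFin.
Qed.

Lemma mfun_powR p (g : R -> R) : mfun g -> mfun (fun t => g t `^ p).
Proof. by move=> mg; apply: (measurableT_comp (measurable_powR _)). Qed.

Lemma lpP p f : 0 < p -> lp p f <-> cmeas f /\ ig (fun t => cabs (f t) `^ p).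
Proof.
move=> p0; have p'0 : p^-1 != 0 by rewrite gt_eqF// invr_gt0.
split=> [[f1 f2 fy]|[mf F]].
  have mf : cmeas f by [].
  split => //; apply/integrableP; split.
    by apply/measurable_EFinP; apply: mfun_powR; exact: mfun_cabs.
  move: fy; rewrite circle_norm_integral => /(lty_poweRy p'0); apply: le_lt_trans.
  by under eq_integral do rewrite /= ger0_norm ?powR_ge0//.
have [f1 f2] := mf; split => //.
rewrite circle_norm_integral poweR_lty// -meanE//; exact: ltry.
Qed.

Lemma lp_cmeas p f : lp p f -> cmeas f.
Proof. by case. Qed.

Lemma nrmE p f : 0 < p -> lp p f -> nrm p f = mean (fun t => cabs (f t) `^ p) `^ p^-1.
Proof.
move=> p0 /(lpP _ p0)[mf F].
by rewrite /nrm circle_norm_integral -meanE// poweR_EFin.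
Qed.

Lemma circle_normE p f : lp p f -> circle_norm p%:E f = (nrm p f)%:E.
Proof.
move=> [_ _ fy]; rewrite /nrm fineK// ge0_fin_numE//; exact: Lnorm_ge0.
Qed.

Lemma nrm_ge0 p f : 0 <= nrm p f.
Proof. by rewrite /nrm fine_ge0// Lnorm_ge0. Qed.

Lemma nrm_powR p f : 0 < p -> lp p f -> nrm p f `^ p = mean (fun t => cabs (f t) `^ p).
Proof.
move=> p0 fp; rewrite nrmE// -powRrM mulVf ?gt_eqF// powRr1// mean_ge0// => t.
exact: powR_ge0.
Qed.

Lemma powR_le_inv p (x y : R) : 0 < p -> 0 <= x -> 0 <= y -> x `^ p <= y `^ p -> x <= y.
Proof.
move=> p0 x0 y0; apply: contraTT; rewrite -!ltNge => yx.
by apply: gt0_ltr_powR.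
Qed.

Lemma nrm_le_of_mean p f (C : R) : 0 < p -> 0 <= C -> lp p f ->
  mean (fun t => cabs (f t) `^ p) <= C `^ p -> nrm p f <= C.
Proof. by move=> p0 C0 fp h; apply: (@powR_le_inv p) => //; rewrite ?nrm_ge0// nrm_powR. Qed.

Lemma le_powR p (x y : R) : 0 < p -> 0 <= x -> x <= y -> x `^ p <= y `^ p.
Proof.
by move=> p0 x0 xy; apply: ge0_ler_powR => //; rewrite ?nnegrE//; [exact: ltW|exact: le_trans xy].
Qed.

Lemma lp_le p f (g : R -> R) : 0 < p -> cmeas f ->
  (forall t, cabs (f t) <= g t) -> ig (fun t => g t `^ p) -> lp p f.
Proof.
move=> p0 mf fg G; apply/lpP => //; split => //; apply: ig_le G.
  by apply: mfun_powR; exact: mfun_cabs.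
by move=> t; rewrite ger0_norm ?powR_ge0// le_powR// cabs_ge0.
Qed.

Lemma lp_le_lp p f g : 0 < p -> cmeas f ->
  (forall t, cabs (f t) <= cabs (g t)) -> lp p g -> lp p f.
Proof. by move=> p0 mf fg /(lpP _ p0)[_ G]; exact: lp_le fg G. Qed.

Lemma nrm_le p f g : 0 < p -> lp p f -> lp p g ->
  (forall t, cabs (f t) <= cabs (g t)) -> nrm p f <= nrm p g.
Proof.
move=> p0 fp gp fg; apply: nrm_le_of_mean => //; first exact: nrm_ge0.
rewrite nrm_powR//; apply: mean_le.
- by have /lpP[] := fp.
- by have /lpP[] := gp.
- by move=> t; rewrite le_powR// cabs_ge0.
Qed.

Lemma lp_bnd p f c : 0 < p -> cmeas f -> (forall t, cabs (f t) <= c) -> lp p f.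
Proof. by move=> p0 mf fc; apply: (lp_le p0 mf fc); exact: ig_cst. Qed.

Lemma lp_cst p (c : R[i]) : 0 < p -> lp p (fun=> c).
Proof. by move=> p0; apply: (@lp_bnd _ _ (cabs c)) => //; exact: cmeas_cst. Qed.

Lemma nrm_cst p (c : R[i]) : 0 < p -> nrm p (fun=> c) = cabs c.
Proof.
move=> p0; rewrite nrmE//; last exact: lp_cst.
by rewrite mean_cst -powRrM mulfV ?gt_eqF// powRr1// cabs_ge0.
Qed.

Lemma nrm_bnd p f c : 0 < p -> cmeas f -> (forall t, cabs (f t) <= c) -> nrm p f <= c.
Proof.
move=> p0 mf fc; have c0 : 0 <= c := le_trans (cabs_ge0 _) (fc 0).
rewrite -[c]ger0_norm// -cabs_real -(nrm_cst _ p0).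
apply: nrm_le => //; [exact: lp_bnd fc|exact: lp_cst|].
by move=> t; rewrite cabs_real ger0_norm.
Qed.

Lemma lp_ae p f g : 0 < p -> lp p f -> cmeas g -> circle_ae_eq f g -> lp p g.
Proof.
move=> p0 /(lpP _ p0)[mf F] mg fg; apply/lpP => //; split => //; apply: ig_ae F _ _.
  by apply: mfun_powR; exact: mfun_cabs.
by apply: (aeS _ fg) => t ->.
Qed.

Lemma nrm_ae p f g : 0 < p -> lp p f -> cmeas g -> circle_ae_eq f g -> nrm p f = nrm p g.
Proof.
move=> p0 fp mg fg; rewrite (nrmE p0 fp) (nrmE p0 (lp_ae p0 fp mg fg)).
apply: (congr1 (fun x => x `^ p^-1)); apply: mean_ae.
- by apply: mfun_powR; apply: mfun_cabs; exact: lp_cmeas fp.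
- by apply: mfun_powR; exact: mfun_cabs.
- by apply: (aeS _ fg) => t ->.
Qed.

Lemma lpZ p c f : 0 < p -> lp p f -> lp p (fun t => c * f t).
Proof.
move=> p0 /(lpP _ p0)[mf F]; apply: (@lp_le _ _ (fun t => cabs c * cabs (f t))) => //.
- exact: cmeasZ.
- by move=> t; rewrite cabsM.
- by under eq_fun do rewrite powRM ?cabs_ge0//; exact: igZ.
Qed.

Lemma nrmZ p c f : 0 < p -> lp p f -> nrm p (fun t => c * f t) = cabs c * nrm p f.
Proof.
move=> p0 fp; have /lpP[//|mf F] := fp; rewrite !nrmE//; last exact: lpZ.
under eq_fun do rewrite cabsM powRM ?cabs_ge0//.
rewrite meanZ// powRM ?powR_ge0//; last by apply: mean_ge0 => t; exact: powR_ge0.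
by rewrite -powRrM mulfV ?gt_eqF// powRr1// cabs_ge0.
Qed.

Lemma lpN p f : 0 < p -> lp p f -> lp p (fun t => - f t).
Proof. by move=> p0 fp; under eq_fun do rewrite -mulN1r; exact: lpZ. Qed.

Lemma nrmN p f : nrm p (fun t => - f t) = nrm p f.
Proof. by rewrite /nrm /circle_norm; under eq_fun do rewrite cabsN. Qed.

Lemma nrm_distC p f g : nrm p (fun t => f t - g t) = nrm p (fun t => g t - f t).
Proof. by rewrite -nrmN; congr (nrm _ _); apply/funext => t; rewrite opprB. Qed.

Lemma circle_norm_real p (g : R -> R) : (forall t, 0 <= g t) ->
  circle_norm p%:E (fun t => (g t)%:C) = Lnorm mu p%:E (EFin \o g).
Proof.
by move=> g0; apply: eq_Lnorm => t /=; rewrite ?cabs_real expr0n /= addr0 sqrtr_sqr ger0_norm.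
Qed.

(** Minkowski's inequality is applied to the real functions |f| and |g|, whose sum dominates |f +
    g|. *)
Lemma lp_add_and_nrm p f g : 1 <= p -> lp p f -> lp p g ->
  lp p (fun t => f t + g t) /\ nrm p (fun t => f t + g t) <= nrm p f + nrm p g.
Proof.
move=> p1 fp gp; have p0 : 0 < p := lt_le_trans ltr01 p1.
have mf := lp_cmeas fp; have mg := lp_cmeas gp.
pose h t := cabs (f t) + cabs (g t).
have h0 t : 0 <= h t by rewrite addr_ge0 ?cabs_ge0.
have mh : mfun h by apply: measurable_funD; exact: mfun_cabs.
have nh : (circle_norm p%:E (fun t => (h t)%:C) <= (nrm p f + nrm p g)%:E)%E.
  rewrite circle_norm_real// EFinD -!circle_normE//.
  exact: (minkowski_EFin mu (mfun_cabs mf) (mfun_cabs mg) p1).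
have lph : lp p (fun t => (h t)%:C).
  by split; [exact: mh|exact: measurable_cst|rewrite (le_lt_trans nh)// ltry].
have le1 t : cabs (f t + g t) <= cabs (h t)%:C by rewrite cabs_real ger0_norm// cabsD.
have lpfg : lp p (fun t => f t + g t) by apply: (lp_le_lp p0 _ le1 lph); exact: cmeasD.
split => //; apply: le_trans (nrm_le p0 lpfg lph le1) _.
by rewrite -lee_fin -circle_normE.
Qed.

Lemma lpD p f g : 1 <= p -> lp p f -> lp p g -> lp p (fun t => f t + g t).
Proof. by move=> p1 fp gp; have [] := lp_add_and_nrm p1 fp gp. Qed.

Lemma nrmD p f g : 1 <= p -> lp p f -> lp p g ->
  nrm p (fun t => f t + g t) <= nrm p f + nrm p g.
Proof. by move=> p1 fp gp; have [] := lp_add_and_nrm p1 fp gp. Qed.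

Lemma lpB p f g : 1 <= p -> lp p f -> lp p g -> lp p (fun t => f t - g t).
Proof. by move=> p1 fp gp; apply: lpD => //; apply: lpN => //; exact: lt_le_trans p1. Qed.

Lemma nrmB p f g : 1 <= p -> lp p f -> lp p g ->
  nrm p (fun t => f t - g t) <= nrm p f + nrm p g.
Proof.
move=> p1 fp gp; rewrite -(nrmN _ g); apply: nrmD => //.
by apply: lpN => //; exact: lt_le_trans p1.
Qed.

Lemma nrm_dist_triangle p f g h : 1 <= p -> lp p f -> lp p g -> lp p h ->
  nrm p (fun t => f t - h t) <= nrm p (fun t => f t - g t) + nrm p (fun t => g t - h t).
Proof.
move=> p1 fp gp hp.
rewrite [X in X <= _](_ : _ = nrm p (fun t => (f t - g t) + (g t - h t))).
  by apply: nrmD => //; exact: lpB.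
by congr (nrm p _); apply/funext => t; ring.
Qed.

Lemma nrm_le_dist p f g : 1 <= p -> lp p f -> lp p g ->
  nrm p f <= nrm p g + nrm p (fun t => f t - g t).
Proof.
move=> p1 fp gp.
rewrite [X in X <= _](_ : _ = nrm p (fun t => g t + (f t - g t))).
  by apply: nrmD => //; exact: lpB.
by congr (nrm p _); apply/funext => t; ring.
Qed.

Lemma nrm_eq0_ae p f : 0 < p -> lp p f -> nrm p f = 0 -> circle_ae_eq f (fun=> 0).
Proof.
move=> p0 fp f0; have /lpP[//|mf F] := fp.
have : mean (fun t => cabs (f t) `^ p) = 0.
  by rewrite -nrm_powR// f0 powR0// gt_eqF.
move=> /(mean_eq0_ae F (fun t => powR_ge0 _ _)) ae0.
by apply: (aeS _ ae0) => t /powR_eq0_eq0; exact: cabs_eq0.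
Qed.

Lemma hoelder_circle p q f g : 0 < p -> 0 < q -> p^-1 + q^-1 = 1 ->
  lp p f -> lp q g ->
  ci (fun t => f t * g t) /\ mean (fun t => cabs (f t * g t)) <= nrm p f * nrm q g.
Proof.
move=> p0 q0 pq fp gq; have mf := lp_cmeas fp; have mg := lp_cmeas gq.
have h := hoelder mu (mfun_cabs mf) (mfun_cabs mg) p0 q0 pq.
have mfg : cmeas (fun t => f t * g t) by exact: cmeasM.
have e : (\int[mu]_t (cabs (f t * g t))%:E)%E = Lnorm mu 1 (EFin \o ((fun t => cabs (f t)) \* (fun t => cabs (g t)))).
  rewrite Lnorm1; apply: eq_integral => t _ /=.
  by rewrite cabsM ger0_norm// mulr_ge0 ?cabs_ge0.
have le1 : (\int[mu]_t (cabs (f t * g t))%:E <= (nrm p f * nrm q g)%:E)%E.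
  by rewrite e EFinM -!circle_normE.
have cifg : ig (fun t => cabs (f t * g t)).
  apply/integrableP; split; first by apply/measurable_EFinP; exact: mfun_cabs.
  apply: (@le_lt_trans _ _ (nrm p f * nrm q g)%:E); last exact: ltry.
  by under eq_integral do rewrite /= ger0_norm ?cabs_ge0//.
by split; [split|rewrite -lee_fin meanE].
Qed.

(** Hölder for |f|^p against the constant 1, with exponent r = q / p and its conjugate s; the total
    mass being 1, no constant appears. *)
Lemma nrm_mono p q f : 0 < p -> p <= q -> lp q f -> lp p f /\ nrm p f <= nrm q f.
Proof.
move=> p0 pq fq; have q0 : 0 < q := lt_le_trans p0 pq.
have [pqE|pnq] := eqVneq p q; first by rewrite pqE.
have pltq : p < q by rewrite lt_neqAle pnq.
have /lpP[//|mf F] := fq.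
pose r := q / p; have r0 : 0 < r by rewrite divr_gt0.
pose s := r / (r - 1).
have r1 : 0 < r - 1 by rewrite subr_gt0 ltr_pdivlMr// mul1r.
have s0 : 0 < s by rewrite divr_gt0.
have rs : r^-1 + s^-1 = 1.
  by rewrite /s; field; rewrite !gt_eqF.
have e t : cabs (cabs (f t) `^ p)%:C `^ r = cabs (f t) `^ q.
  by rewrite cabs_real ger0_norm ?powR_ge0// -powRrM /r mulrCA divff ?mulr1// gt_eqF.
have gr : lp r (fun t => (cabs (f t) `^ p)%:C).
  apply/lpP => //; split; first by apply: cmeas_real; apply: mfun_powR; exact: mfun_cabs.
  by under eq_fun do rewrite e.
have [[_ h1] h2] := hoelder_circle r0 s0 rs gr (lp_cst 1 s0).
have e1 : (fun t => cabs ((cabs (f t) `^ p)%:C * 1)) = (fun t => cabs (f t) `^ p).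
  by apply/funext => t; rewrite mulr1 cabs_real ger0_norm// powR_ge0.
rewrite e1 in h1; rewrite e1 nrm_cst// cabs1 mulr1 in h2.
have fp : lp p f by apply/lpP.
split => //; apply: nrm_le_of_mean => //; first exact: nrm_ge0.
apply: le_trans h2 _; apply: nrm_le_of_mean => //; first exact: powR_ge0.
under eq_fun do rewrite e.
by rewrite -nrm_powR// -powRrM /r mulrCA divff ?mulr1// gt_eqF.
Qed.

Lemma lp_mono p q f : 0 < p -> p <= q -> lp q f -> lp p f.
Proof. by move=> p0 pq fq; have [] := nrm_mono p0 pq fq. Qed.

Lemma lp_mean_abs p f : 1 <= p -> lp p f -> ci f /\ mean (fun t => cabs (f t)) <= nrm p f.
Proof.
move=> p1 fp; have [f1 h] := nrm_mono ltr01 p1 fp.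
have e : (fun t => cabs (f t) `^ 1) = (fun t => cabs (f t)).
  by apply/funext => t; rewrite powRr1// cabs_ge0.
have /lpP[//|mf F] := f1; split; first by split => //; rewrite -e.
by rewrite -e -nrm_powR// powRr1 ?nrm_ge0.
Qed.

Lemma lp_ci p f : 1 <= p -> lp p f -> ci f.
Proof. by move=> p1 fp; have [] := lp_mean_abs p1 fp. Qed.

(** For a positive limit the power is expR (p ln), which is continuous; at 0 this formula breaks
    down and e^(1/p) serves as modulus of continuity. *)
Lemma cvg_powR p (u : nat -> R) (l : R) : 0 < p -> (forall n, 0 <= u n) ->
  u @ \oo --> l -> u n `^ p @[n --> \oo] --> l `^ p.
Proof.
move=> p0 u0 ul; have l0 : 0 <= l.
  rewrite -(cvg_lim (@Rhausdorff R) ul); apply: limr_ge; last exact: nearW.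
  by apply/cvg_ex; exists l.
have [l_eq0|l_neq0] := eqVneq l 0.
  rewrite l_eq0 powR0 ?gt_eqF//; rewrite l_eq0 in ul.
  apply/cvgrPdist_le => e e0.
  have e'0 : 0 < e `^ p^-1 by exact: powR_gt0.
  move/cvgrPdist_le : ul => /(_ _ e'0); apply: filterS => n.
  rewrite !sub0r !normrN !ger0_norm ?powR_ge0// => ue.
  apply: le_trans (le_powR p0 (u0 n) ue) _.
  by rewrite -powRrM mulVf ?gt_eqF// powRr1// ltW.
have l_gt0 : 0 < l by rewrite lt_neqAle eq_sym l_neq0.
have : expR (p * ln (u n)) @[n --> \oo] --> expR (p * ln l).
  apply: cvg_comp; last exact: continuous_expR.
  apply: cvgM; first exact: cvg_cst.
  by apply: cvg_comp ul _; exact: continuous_ln.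
rewrite /powR (negbTE l_neq0); apply: cvg_trans; apply: near_eq_cvg.
have : \forall n \near \oo, 0 < u n by exact: (cvgr_gt l ul).
by apply: filterS => n un; rewrite gt_eqF.
Qed.

Lemma limn_einf_le (u : (\bar R)^nat) (c : \bar R) : (forall n, u n <= c)%E -> (limn_einf u <= c)%E.
Proof.
move=> uc; rewrite limn_einf_lim; apply: lime_le; first exact: is_cvg_einfs.
apply: nearW => n; apply: le_trans (uc n); apply: ereal_inf_lbound.
by exists n => /=.
Qed.

(** Membership of the limit in L^p is a conclusion. This serves to identify limits in the
    completeness proof and, for p > 2, to show that an analytic part known only to be in L^2 lies in
    L^p. *)
Lemma nrm_fatou p (G : nat -> R -> R[i]) g (C : R) : 0 < p -> 0 <= C ->
  (forall k, lp p (G k)) -> (forall k, nrm p (G k) <= C) -> cmeas g ->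
  {ae mu, forall t, cabs (G k t) @[k --> \oo] --> cabs (g t)} ->
  lp p g /\ nrm p g <= C.
Proof.
move=> p0 C0 Gp GC mg Gg.
pose h k t := (cabs (G k t) `^ p)%:E.
have mh k : measurable_fun [set: measurableTypeR R] (h k).
  by apply/measurable_EFinP; apply: mfun_powR; apply: mfun_cabs; exact: lp_cmeas (Gp k).
have h0 k t : setT t -> (0 <= h k t)%E by move=> _; rewrite lee_fin powR_ge0.
have ft := fatou mu measurableT mh h0.
have ft2 : (\int[mu]_(t in setT) limn_einf (h^~ t) <= (C `^ p)%:E)%E.
  apply: le_trans ft _; apply: limn_einf_le => k.
  have /lpP[//|mG iG] := Gp k.
  by rewrite /h -meanE// lee_fin -nrm_powR// le_powR// nrm_ge0.
have mgp : mfun (fun t => cabs (g t) `^ p) by apply: mfun_powR; exact: mfun_cabs.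
have e : (\int[mu]_(t in setT) limn_einf (h^~ t) = \int[mu]_(t in setT) (cabs (g t) `^ p)%:E)%E.
  apply: ae_eq_integral => //.
  - rewrite (_ : (fun t => _) = (fun t => - limn_esup ((fun k t => - h k t)^~ t)))%E.
      apply: measurableT_comp => //; apply: measurable_fun_limn_esup => k.
      by apply: measurableT_comp => //; exact: mh.
    apply/funext => t; rewrite -limn_einfN; congr limn_einf.
    by apply/funext => k; rewrite /h /= opprK.
  - exact/measurable_EFinP.
  apply: (aeS _ Gg) => t ct _.
  have cp : h k t @[k --> \oo] --> (cabs (g t) `^ p)%:E.
    apply: cvg_EFin; first exact: nearW.
    by apply: cvg_powR ct => // k; exact: cabs_ge0.
  by rewrite (cvg_limn_einf_sup cp).1.
rewrite e in ft2.
have ig_g : ig (fun t => cabs (g t) `^ p).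
  apply/integrableP; split; first exact/measurable_EFinP.
  apply: le_lt_trans (ltry (C `^ p)); apply: le_trans ft2.
  by under eq_integral do rewrite /= ger0_norm ?powR_ge0//.
have gp : lp p g by apply/lpP.
split => //; apply: nrm_le_of_mean => //.
by rewrite -lee_fin meanE.
Qed.

(** By monotone convergence the full sum has a finite integral, so it is finite almost
    everywhere. *)
Lemma ae_bounded_sums (D : nat -> R -> R) (C : R) :
  (forall k, ig (D k)) -> (forall k t, 0 <= D k t) ->
  (forall n, \sum_(0 <= k < n) mean (D k) <= C) ->
  {ae mu, forall t, cvgn (series (D ^~ t))}.
Proof.
move=> iD D0 DC.
pose h n t := (\sum_(0 <= k < n) D k t)%:E.
have iS n : ig (fun t => \sum_(0 <= k < n) D k t) by exact: ig_sum.
have mh n : measurable_fun [set: measurableTypeR R] (h n).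
  by apply/measurable_EFinP; exact: ig_mfun.
have h0 n t : setT t -> (0 <= h n t)%E.
  by move=> _; rewrite lee_fin; apply: sumr_ge0.
have nd t : setT t -> {homo h^~ t : n m / (n <= m)%N >-> (n <= m)%E}.
  move=> _ n m nm; rewrite lee_fin (big_cat_nat (leq0n n) nm)/= lerDl.
  exact: sumr_ge0.
have lim_le : (\int[mu]_(t in setT) limn (h^~ t) <= C%:E)%E.
  rewrite (monotone_convergence mu measurableT mh h0 nd).
  apply: lime_le.
    apply: ereal_nondecreasing_is_cvgn => n m nm; apply: ge0_le_integral => //.
      by move=> t _; exact: h0.
    by move=> t _; exact: nd.
  apply: nearW => n; rewrite /h -meanE// mean_sum//; exact: DC.
have mlim : measurable_fun [set: measurableTypeR R] (fun t => limn (h^~ t)).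
  apply: emeasurable_fun_cvg mh _ => t _.
  by apply: ereal_nondecreasing_is_cvgn; exact: nd.
have lim_ge n t : (h n t <= limn (h^~ t))%E.
  rewrite (cvg_lim _ (ereal_nondecreasing_cvgn (nd t Logic.I)))//.
  by apply: ereal_sup_ubound; exists n.
have ilim : mu.-integrable setT (fun t => limn (h^~ t)).
  apply/integrableP; split => //; apply: le_lt_trans (ltry C); apply: le_trans lim_le.
  apply: ge0_le_integral => //.
  - exact: measurableT_comp.
  move=> t _; rewrite gee0_abs//; apply: le_trans (lim_ge 0%N t); exact: h0.
have := integrable_ae measurableT ilim.
move=> fin; apply: (aeS _ fin) => t /(_ Logic.I) ft.
apply: nondecreasing_is_cvgn.
  by move=> n m nm; have := nd t Logic.I n m nm; rewrite lee_fin.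
exists (fine (limn (h^~ t))) => _ [n _ <-].
by rewrite -lee_fin fineK//; exact: lim_ge.
Qed.

Definition lp_cvg p (F : nat -> R -> R[i]) f := nrm p (fun t => F n t - f t) @[n --> \oo] --> (0 : R).

Definition lp_cauchy p (F : nat -> R -> R[i]) := forall e : R, 0 < e ->
  exists N, forall n m, (N <= n)%N -> (N <= m)%N -> nrm p (fun t => F n t - F m t) <= e.

Lemma lp_cvgP p F f : lp_cvg p F f <->
  forall e : R, 0 < e -> exists N, forall n, (N <= n)%N -> nrm p (fun t => F n t - f t) <= e.
Proof.
split=> [/cvgrPdist_le Ff e e0|Ff].
  have [N _ NP] := Ff e e0; exists N => n Nn.
  by have := NP n Nn; rewrite /= sub0r normrN ger0_norm// nrm_ge0.
apply/cvgrPdist_le => e e0; have [N NP] := Ff e e0; exists N => // n Nn /=.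
by rewrite sub0r normrN ger0_norm ?nrm_ge0// NP.
Qed.

Lemma cvg_cabs (u : nat -> R[i]) (z : R[i]) :
  complex.Re (u n) @[n --> \oo] --> complex.Re z ->
  complex.Im (u n) @[n --> \oo] --> complex.Im z ->
  cabs (u n) @[n --> \oo] --> cabs z.
Proof.
move=> cr ci; rewrite cabsE; under eq_fun do rewrite cabsE.
apply: cvg_comp; last exact: sqrt_continuous.
exact: (cvgD (cvgM cr cr) (cvgM ci ci)).
Qed.

(** Riesz-Fischer: a subsequence with summable increments converges almost everywhere, and Fatou's
    lemma turns the Cauchy property into convergence to the pointwise limit. *)
Theorem lp_complete p (F : nat -> R -> R[i]) : 1 <= p -> (forall n, lp p (F n)) ->
  lp_cauchy p F -> exists2 f, lp p f & lp_cvg p F f.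
Proof.
move=> p1 Fp cF; have p0 : 0 < p := lt_le_trans ltr01 p1.
have e_gt0 k : (0 : R) < 2^-1 ^+ k by rewrite exprn_gt0// invr_gt0.
have /choice[N NP] : forall k, exists N, forall n m, (N <= n)%N -> (N <= m)%N ->
  nrm p (fun t => F n t - F m t) <= 2^-1 ^+ k by move=> k; exact: cF.
(* The running maximum makes the indices nondecreasing, so that consecutive terms of the subsequence
   are within 2^-k. *)
pose phi k := (\max_(j < k.+1) N j)%N.
have phiN k : (N k <= phi k)%N by rewrite /phi; apply: (@leq_bigmax _ (fun j : 'I_k.+1 => N j) ord_max).
have phiS k : (phi k <= phi k.+1)%N by rewrite /phi [leqRHS]big_ord_recr/= leq_maxl.
pose G k := F (phi k).
have GS k : nrm p (fun t => G k.+1 t - G k t) <= 2^-1 ^+ k.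
  by apply: NP; [exact: leq_trans (phiN k) (phiS k)|exact: phiN].
pose D k t := cabs (G k.+1 t - G k t).
have DG k : ci (fun t => G k.+1 t - G k t) /\ mean (D k) <= nrm p (fun t => G k.+1 t - G k t).
  by apply: lp_mean_abs => //; exact: (lpB p1 (Fp _) (Fp _)).
have iD k : ig (D k) by have [[]] := DG k.
have D0 k t : 0 <= D k t by exact: cabs_ge0.
have sumD n : \sum_(0 <= k < n) mean (D k) <= 2.
  apply: (@le_trans _ _ (\sum_(0 <= k < n) 2^-1 ^+ k)).
    by apply: ler_sum => k _; apply: le_trans (GS k); have [] := DG k.
  have -> : \sum_(0 <= k < n) (2^-1 : R) ^+ k = 2 - 2 * 2^-1 ^+ n.
    elim: n => [|n ih]; first by rewrite big_nil expr0 mulr1 subrr.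
    by rewrite big_nat_recr//= ih exprS; lra.
  by rewrite gerBl mulr_ge0// ltW.
have [Z [mZ Z0 ZP]] := ae_bounded_sums iD D0 sumD.
(* [pr] stands for the real or the imaginary part; only additivity and domination by the modulus are
   used. *)
have conv (pr : R[i] -> R) t : (forall z w, pr (z - w) = pr z - pr w) ->
    (forall z, `|pr z| <= cabs z) -> ~ Z t -> cvgn (fun k => pr (G k t)).
  move=> prB prle Zt.
  have cD : cvgn (series (D^~ t)) by apply: contrapT => h; apply: Zt; apply: ZP.
  have ct : cvgn (series (telescope (fun k => pr (G k t)))).
    apply: normed_cvg; apply: series_le_cvg cD => // k.
      by rewrite /= normr_ge0.
    by rewrite /telescope /= -prB.
  move: ct; rewrite telescopeK => /(is_cvgD (is_cvg_cst (pr (G 0%N t)))) ct.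
  rewrite (_ : (fun k => pr (G k t)) =
    (fun=> pr (G 0%N t)) + [sequence pr (G n t) - pr (G 0%N t)]_n)//.
  apply/funext => k.
  by rewrite [RHS](_ : _ = pr (G 0%N t) + (pr (G k t) - pr (G 0%N t)))// addrC subrK.
(* The value 0 on the exceptional set [Z] makes the limit measurable: it is the everywhere limit of
   the functions multiplied by the indicator of the complement of [Z]. *)
pose L (pr : R[i] -> R) t := if t \in Z then 0 else limn (fun k => pr (G k t)).
pose f t := L (@complex.Re R) t +i* L (@complex.Im R) t.
have ReB (z w : R[i]) : complex.Re (z - w) = complex.Re z - complex.Re w by rewrite cReD cReN.
have ImB (z w : R[i]) : complex.Im (z - w) = complex.Im z - complex.Im w by rewrite cImD cImN.
have cvL (pr : R[i] -> R) : (forall z w, pr (z - w) = pr z - pr w) ->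
    (forall z, `|pr z| <= cabs z) -> forall t, ~ Z t -> pr (G k t) @[k --> \oo] --> L pr t.
  by move=> prB prle t Zt; rewrite /L memNset//; exact: conv.
have mL (pr : R[i] -> R) : (forall z w, pr (z - w) = pr z - pr w) ->
    (forall z, `|pr z| <= cabs z) -> (forall k, mfun (fun t => pr (G k t))) -> mfun (L pr).
  move=> prB prle mpr.
  apply: (@measurable_fun_cvg _ _ _ _ (fun k t => \1_(~` Z) t * pr (G k t))).
    move=> k; apply: measurable_funM => //; apply: measurable_indic.
    exact: measurableC.
  move=> t _; have [Zt|Zt] := pselect (Z t).
    rewrite /L mem_set// indicE memNset; last by move/(_ Zt).
    by under eq_fun do rewrite mul0r; exact: cvg_cst.
  rewrite indicE mem_set//; under eq_fun do rewrite mul1r.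
  exact: cvL.
have mf : cmeas f.
  split.
    by apply: (mL (@complex.Re R)) => // [z|k]; [exact: le_Re_cabs|have [] := lp_cmeas (Fp (phi k))].
  by apply: (mL (@complex.Im R)) => // [z|k]; [exact: le_Im_cabs|have [] := lp_cmeas (Fp (phi k))].
have nZ : {ae mu, forall t, ~ Z t} by exists Z; split => // t /= /contrapT.
(* Fatou's lemma along [G]; the shift by [K] lets the bound be assumed from index [K] on only. *)
have lim_bound n (C : R) K : 0 <= C ->
    (forall k, (K <= k)%N -> nrm p (fun t => F n t - G k t) <= C) ->
    lp p (fun t => F n t - f t) /\ nrm p (fun t => F n t - f t) <= C.
  move=> C0 FC; apply: (@nrm_fatou p (fun k t => F n t - G (k + K)%N t)) => //.
  - by move=> k; exact: (lpB p1 (Fp _) (Fp _)).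
  - by move=> k; apply: FC; rewrite leq_addl.
  - by apply: cmeasB => //; exact: lp_cmeas (Fp n).
  apply: (aeS _ nZ) => t Zt; apply: cvg_cabs.
    under eq_fun do rewrite ReB; rewrite ReB; apply: cvgB; first exact: cvg_cst.
    by rewrite (cvg_shiftn K (fun k => complex.Re (G k t))); apply: (cvL (@complex.Re R)) => //; exact: le_Re_cabs.
  under eq_fun do rewrite ImB; rewrite ImB; apply: cvgB; first exact: cvg_cst.
  by rewrite (cvg_shiftn K (fun k => complex.Im (G k t))); apply: (cvL (@complex.Im R)) => //; exact: le_Im_cabs.
have step k n : (N k <= n)%N -> lp p (fun t => F n t - f t) /\ nrm p (fun t => F n t - f t) <= 2^-1 ^+ k.
  move=> Nn; apply: (lim_bound _ _ k) => [|j kj]; first exact: ltW.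
  apply: NP => //; apply: leq_trans (phiN k) _.
  by rewrite /phi -(subnK kj); elim: (j - k)%N => [//|i ih]; rewrite addSn; exact: leq_trans ih (phiS _).
exists f.
  have [h _] := step 0%N _ (leqnn _).
  rewrite (_ : f = (fun t => F (N 0%N) t - (F (N 0%N) t - f t))); last first.
    by apply/funext => t; rewrite subKr.
  exact: (lpB p1 (Fp (N 0%N)) h).
apply/lp_cvgP => e e0.
have [k ke] : exists k : nat, 2^-1 ^+ k <= e.
  have /cvgrPdist_le/(_ e e0)[k _ kP] : (2^-1 : R) ^+ n @[n --> \oo] --> 0.
    by apply: cvg_expr; rewrite ger0_norm// invf_lt1// ltr1n.
  by exists k; have := kP k (leqnn _); rewrite /= sub0r normrN ger0_norm// ltW.
by exists (N k) => n /step[_ h]; exact: le_trans h ke.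
Qed.

End LpNorm.

(** * Orthogonal projections in L^2 *)

Section L2.
Context {R : realType}.
Local Notation ig := summable_on_circle.
Local Notation cabs := (@Normc.normc R).
Local Notation ci := csummable_on_circle.
Local Notation lp p := (@circle_Lp R p%:E).
Local Notation I := (@circle_int R).
Local Notation ip := (@inner_prod R).
Implicit Types (f g h : R -> R[i]) (V : set (R -> R[i])).

(** Nonnegativity of [g] is what [integral_uniform] asks for; this is why 1 is added to cosine and
    sine in [mean_cosn] and [mean_sinn]. *)
Lemma mean_primitive (g G : R -> R) : (forall t, 0 <= g t) -> continuous g ->
  (forall t, is_derive t (1 : R) G (g t)) -> mean g = (G (2 * pi) - G 0) / (2 * pi).
Proof.
move=> g0 cg dG; have tp := @two_pi_gt0 R.
have mg : measurable_fun [set: measurableTypeR R] (EFin \o g).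
  by apply/measurable_EFinP; exact: continuous_measurable_fun.
have cG t : {for t, continuous G}.
  by apply/differentiable_continuous/derivable1_diffP; have [] := dG t.
have g0' t : (0 <= (EFin \o g) t)%E by rewrite lee_fin.
rewrite /mean /Rintegral (integral_uniform tp mg g0').
rewrite (@continuous_FTC2 _ g G) //.
- by rewrite subr0 -EFinB -EFinM/= mulrC.
- by apply: continuous_subspaceT.
- split.
  + by move=> t _; have [] := dG t.
  + by apply: cvg_at_right_filter; exact: cG.
  + by apply: cvg_at_left_filter; exact: cG.
- by move=> t _; rewrite derive1E; have [_] := dG t.
Qed.

Lemma sin_2pin (n : nat) : sin (n%:R * (2 * pi)) = 0 :> R.
Proof.
rewrite mulr_natl -[_ *+ n]add0r.
have -> : 2 * pi = pi *+ 2 :> R by rewrite mulr_natl.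
by rewrite (periodicn (@sinD2pi R)) sin0.
Qed.

Lemma cos_2pin (n : nat) : cos (n%:R * (2 * pi)) = 1 :> R.
Proof.
rewrite mulr_natl -[_ *+ n]add0r.
have -> : 2 * pi = pi *+ 2 :> R by rewrite mulr_natl.
by rewrite (periodicn (@cosD2pi R)) cos0.
Qed.

Lemma ig_cos (a b : R) : ig (fun t => cos (a * t + b)).
Proof. by apply: (@ig_bnd _ _ 1); [exact: mfun_cos|move=> t; exact: cos_max]. Qed.

Lemma ig_sin (a b : R) : ig (fun t => sin (a * t + b)).
Proof. by apply: (@ig_bnd _ _ 1); [exact: mfun_sin|move=> t; exact: sin_max]. Qed.

Lemma mean_cosn (n : nat) : (0 < n)%N -> mean (fun t : R => cos (n%:R * t)) = 0.
Proof.
move=> n0; have n0' : (n%:R : R) != 0 by rewrite pnatr_eq0 -lt0n.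
have : mean (fun t : R => 1 + cos (n%:R * t)) = 1.
  have g0 t : 0 <= 1 + cos (n%:R * t) :> R by rewrite -lerBlDl sub0r cos_geN1.
  have cg : continuous (fun t : R => 1 + cos (n%:R * t)).
    move=> t; apply: cvgD; first exact: cvg_cst.
    by apply: continuous_comp; [apply: cvgM; [exact: cvg_cst|exact: cvg_id]|exact: continuous_cos].
  have dG t : is_derive t (1 : R) (fun t : R => t + n%:R^-1 * sin (n%:R * t)) (1 + cos (n%:R * t)).
    apply: is_derive_eq.
    by congr (_ + _); rewrite /GRing.scale/= mulr1 mulrCA mulVf ?mulr1.
  rewrite (mean_primitive g0 cg dG).
  rewrite sin_2pin !mulr0 sin0 !mulr0 !addr0 subr0 divff// gt_eqF//.
  exact: two_pi_gt0.
have h : ig (fun t : R => cos (n%:R * t)).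
  by under eq_fun do rewrite -[X in cos X]addr0; exact: ig_cos.
rewrite (meanD (ig_cst 1) h) mean_cst => /eqP.
by rewrite -subr_eq0 addrAC subrr add0r => /eqP.
Qed.

Lemma mean_sinn (n : nat) : mean (fun t : R => sin (n%:R * t)) = 0.
Proof.
have [->|n0] := eqVneq n 0%N.
  by under eq_fun do rewrite mul0r sin0; rewrite mean_cst.
have n0' : (n%:R : R) != 0 by rewrite pnatr_eq0.
have : mean (fun t : R => 1 + sin (n%:R * t)) = 1.
  have g0 t : 0 <= 1 + sin (n%:R * t) :> R by rewrite -lerBlDl sub0r sin_geN1.
  have cg : continuous (fun t : R => 1 + sin (n%:R * t)).
    move=> t; apply: cvgD; first exact: cvg_cst.
    by apply: continuous_comp; [apply: cvgM; [exact: cvg_cst|exact: cvg_id]|exact: continuous_sin].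
  have dG t : is_derive t (1 : R) (fun t : R => t - n%:R^-1 * cos (n%:R * t)) (1 + sin (n%:R * t)).
    apply: is_derive_eq.
    by congr (_ + _); rewrite /GRing.scale/= mulr1 mulNr mulrN opprK mulrCA mulVf ?mulr1.
  rewrite (mean_primitive g0 cg dG).
  rewrite cos_2pin mulr0 cos0 !mulr1 sub0r opprK subrK divff// gt_eqF//.
  exact: two_pi_gt0.
have h : ig (fun t : R => sin (n%:R * t)).
  by under eq_fun do rewrite -[X in sin X]addr0; exact: ig_sin.
rewrite (meanD (ig_cst 1) h) mean_cst => /eqP.
by rewrite -subr_eq0 addrAC subrr add0r => /eqP.
Qed.

Lemma ci_expiX (n : int) : ci (fun t : R => expi t ^ n).
Proof.
apply: (@ci_bnd _ _ 1); first exact: cmeas_expiX.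
by move=> t; rewrite expiXz cabs_expi.
Qed.

Lemma circle_int_expiXn (n : nat) : I (fun t => expi t ^+ n) = (n == 0%N)%:R.
Proof.
have [->|n0] := eqVneq n 0%N.
  by under eq_fun do rewrite expr0; rewrite circle_int_cst.
under eq_fun do rewrite expiX.
by rewrite circle_intE /expi /= mean_cosn ?lt0n// mean_sinn.
Qed.

Lemma circle_int_expiX (n : int) : I (fun t => expi t ^ n) = (n == 0)%:R.
Proof.
case: n => n; first by under eq_fun do rewrite -exprnP; rewrite circle_int_expiXn.
rewrite (_ : (fun t => _) = (fun t => (expi t ^+ n.+1)^*)).
  by rewrite (circle_intJ (ci_expiX n.+1)) circle_int_expiXn rmorph0.
apply/funext => t.
by rewrite NegzE expiXz expiX -expiN; congr expi; rewrite mulrNz mulNr.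
Qed.

(** The mean value property at the origin, in its polynomial form. *)
Lemma circle_int_horner (P : {poly R[i]}) : I (fun t => P.[expi t]) = P`_0.
Proof.
under eq_fun do rewrite horner_coef.
rewrite circle_int_sum; last first.
  by move=> i; apply: ciZ; exact: (ci_expiX i).
rewrite (eq_bigr (fun i : 'I_(size P) => P`_i * ((i : nat) == 0%N)%:R)); last first.
  by move=> i _; rewrite (circle_intZ _ (ci_expiX i)) circle_int_expiXn.
case sP : (size P) => [|n].
  by move/eqP: sP; rewrite size_poly_eq0 => /eqP ->; rewrite big_ord0 coef0.
rewrite big_ord_recl [X in X + _](_ : _ = P`_0); last by rewrite /= mulr1.
by rewrite big1 ?addr0// => i _; rewrite /= mulr0.
Qed.

Lemma ge1_2 : (1 : R) <= 2. Proof. by rewrite ler1n. Qed.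
Lemma gt0_2 : (0 : R) < 2. Proof. by rewrite ltr0n. Qed.

Lemma sqr_nrm2 f : lp 2 f -> nrm 2 f ^+ 2 = mean (fun t => cabs (f t) ^+ 2).
Proof.
move=> fp; rewrite -powR_mulrn ?nrm_ge0// nrm_powR//.
by congr mean; apply/funext => t; rewrite powR_mulrn// cabs_ge0.
Qed.

Lemma lp2B f g : lp 2 f -> lp 2 g -> lp 2 (fun t => f t - g t).
Proof. exact: lpB ge1_2. Qed.

Lemma lp2D f g : lp 2 f -> lp 2 g -> lp 2 (fun t => f t + g t).
Proof. exact: lpD ge1_2. Qed.

Lemma conjK (z : R[i]) : z^*^* = z.
Proof. exact: conjcK. Qed.

Lemma conjM (z w : R[i]) : (z * w)^* = z^* * w^*.
Proof. exact: rmorphM. Qed.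

Lemma conj_real (x : R) : (x%:C)^* = x%:C.
Proof. exact: conjc_real. Qed.

Lemma lp2_mul f g : lp 2 f -> lp 2 g ->
  ci (fun t => f t * g t) /\ mean (fun t => cabs (f t * g t)) <= nrm 2 f * nrm 2 g.
Proof. by apply: hoelder_circle => //; rewrite -mulr2n -[_ *+ 2]mulr_natr mulVf. Qed.

Lemma lpJ (p : R) f : 0 < p -> lp p f -> lp p (fun t => (f t)^*).
Proof.
move=> p0 fp; apply: (lp_le_lp p0 _ _ fp); first exact/cmeasJ/(lp_cmeas fp).
by move=> t; rewrite cabsJ.
Qed.

Lemma nrmJ (p : R) f : nrm p (fun t => (f t)^*) = nrm p f.
Proof. by rewrite /nrm /circle_norm; under eq_fun do rewrite cabsJ. Qed.

Lemma ip_ci f g : lp 2 f -> lp 2 g -> ci (fun t => f t * (g t)^*).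
Proof. by move=> fp gp; have [] := lp2_mul fp (lpJ gt0_2 gp). Qed.

Lemma cabs_ip f g : lp 2 f -> lp 2 g -> cabs (ip f g) <= 2 * (nrm 2 f * nrm 2 g).
Proof.
move=> fp gp; have [h1 h2] := lp2_mul fp (lpJ gt0_2 gp).
apply: le_trans (cabs_circle_int h1) _; rewrite ler_pM2l//.
by rewrite nrmJ in h2.
Qed.

Lemma ipDl f g h : lp 2 f -> lp 2 g -> lp 2 h ->
  ip (fun t => f t + g t) h = ip f h + ip g h.
Proof.
move=> fp gp hp; rewrite /inner_prod -circle_intD; try exact: ip_ci.
by congr circle_int; apply/funext => t; rewrite mulrDl.
Qed.

Lemma ipBl f g h : lp 2 f -> lp 2 g -> lp 2 h ->
  ip (fun t => f t - g t) h = ip f h - ip g h.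
Proof.
move=> fp gp hp; rewrite /inner_prod -circle_intB; try exact: ip_ci.
by congr circle_int; apply/funext => t; rewrite mulrBl.
Qed.

Lemma ipZl a f h : lp 2 f -> lp 2 h -> ip (fun t => a * f t) h = a * ip f h.
Proof.
move=> fp hp; rewrite /inner_prod -circle_intZ; last exact: ip_ci.
by congr circle_int; apply/funext => t; rewrite mulrA.
Qed.

Lemma ipC f g : lp 2 f -> lp 2 g -> ip g f = (ip f g)^*.
Proof.
move=> fp gp; rewrite /inner_prod -circle_intJ; last exact: ip_ci.
by congr circle_int; apply/funext => t; rewrite conjM conjK mulrC.
Qed.

Lemma ip_self f : lp 2 f -> ip f f = (nrm 2 f ^+ 2)%:C.
Proof.
move=> fp; rewrite sqr_nrm2// /inner_prod circle_intE.
under eq_fun do rewrite mulJ /=.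
by under [X in _ +i* mean X]eq_fun do rewrite mulJ /=; rewrite mean_cst.
Qed.

Lemma ip_ae f f' g g' : lp 2 f -> lp 2 g -> cmeas f' -> cmeas g' ->
  circle_ae_eq f f' -> circle_ae_eq g g' -> ip f g = ip f' g'.
Proof.
move=> fp gp mf' mg' ff gg; apply: circle_int_ae.
- by apply: cmeasM; [exact: lp_cmeas fp|exact/cmeasJ/(lp_cmeas gp)].
- by apply: cmeasM => //; exact: cmeasJ.
- by apply: (aeS2 _ ff gg) => t -> ->.
Qed.

(** The parallelogram law, the minimality argument for projections and Pythagoras are all read off
    from this expansion by a choice of [a]. *)
Lemma sqr_nrm2_sub a f g : lp 2 f -> lp 2 g ->
  nrm 2 (fun t => f t - a * g t) ^+ 2 =
  nrm 2 f ^+ 2 - 2 * complex.Re (a^* * ip f g) + cabs a ^+ 2 * nrm 2 g ^+ 2.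
Proof.
move=> fp gp; apply: complexI.
have agp : lp 2 (fun t => a * g t) by exact: lpZ.
have fag : lp 2 (fun t => f t - a * g t) by exact: lp2B.
rewrite -ip_self// ipBl// (ipC fag fp) (ipC fag agp) !ipBl// !ipZl// (ipC agp fp).
rewrite (ipC agp gp) !ipZl// !ip_self//.
rewrite (ipC fp gp).
case: (ip f g) a {agp fag} => x y [a b].
rewrite sqr_cabs.
by apply/eqP; rewrite eq_complex /=; apply/andP; split; apply/eqP; ring.
Qed.

Lemma parallelogram f g : lp 2 f -> lp 2 g ->
  nrm 2 (fun t => f t - g t) ^+ 2 + nrm 2 (fun t => f t + g t) ^+ 2 =
  2 * nrm 2 f ^+ 2 + 2 * nrm 2 g ^+ 2.
Proof.
move=> fp gp.
have e1 : (fun t => f t - g t) = (fun t => f t - 1 * g t).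
  by apply/funext => t; rewrite mul1r.
have e2 : (fun t => f t + g t) = (fun t => f t - (-1) * g t).
  by apply/funext => t; rewrite mulN1r opprK.
have c1 : (1 : R[i])^* = 1 by exact: rmorph1.
have cN1 : (-1 : R[i])^* = -1 by exact: rmorphN1.
rewrite e1 e2 !sqr_nrm2_sub// cabsN cabs1 expr1n c1 cN1 !mul1r mulN1r cReN.
by ring.
Qed.

Record closed_subspace V : Prop := ClosedSubspace {
  csub_L2 : V `<=` circle_Lp 2%:E;
  csub0 : V (fun=> 0);
  csub_lin : forall (a : R[i]) f g, V f -> V g -> V (fun t => a * f t + g t);
  csub_closed : forall (F : nat -> R -> R[i]) f, (forall n, V (F n)) -> lp 2 f ->
    lp_cvg 2 F f -> V f }.

Lemma csubZ V a f : closed_subspace V -> V f -> V (fun t => a * f t).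
Proof.
move=> cV Vf; have := csub_lin cV a Vf (csub0 cV).
by under eq_fun do rewrite addr0.
Qed.

Lemma csubD V f g : closed_subspace V -> V f -> V g -> V (fun t => f t + g t).
Proof.
by move=> cV Vf Vg; have := csub_lin cV 1 Vf Vg; under eq_fun do rewrite mul1r.
Qed.

Lemma csubB V f g : closed_subspace V -> V f -> V g -> V (fun t => f t - g t).
Proof.
move=> cV Vf Vg; apply: csubD => //.
by have := csubZ (-1) cV Vg; under eq_fun do rewrite mulN1r.
Qed.

(** The constant sequence [f] converges in L^2 to every function almost everywhere equal to [f], so
    that closedness applies. *)
Lemma csub_ae V f g : closed_subspace V -> V f -> cmeas g -> circle_ae_eq f g -> V g.
Proof.
move=> cV Vf mg fg; have fp := csub_L2 cV Vf.
have gp : lp 2 g by exact: lp_ae fg.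
apply: (csub_closed cV (F := fun=> f)) => //; rewrite /lp_cvg.
rewrite (_ : (fun=> _) = (fun=> 0)); first exact: cvg_cst.
apply/funext => n; rewrite -[RHS](@cabs0 R) -(nrm_cst 0 gt0_2); apply: nrm_ae => //.
- exact: lp2B.
- by apply: (aeS _ fg) => t ->; rewrite subrr.
Qed.

Lemma orthogonal_of_minimal f h : lp 2 f -> lp 2 h ->
  (forall a, nrm 2 f <= nrm 2 (fun t => f t - a * h t)) -> ip f h = 0.
Proof.
move=> fp hp fmin.
set c := ip f h; set n := nrm 2 h ^+ 2.
have n0 : 0 <= n by exact: sqr_ge0.
(* The optimal multiple of [h] is c / n; adding 1 to the denominator avoids division by 0 and keeps
   x n <= 1, which is enough: minimality gives (2 - x n) |c|^2 <= 0. *)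
pose x := (n + 1)^-1.
have x0 : 0 < x by rewrite invr_gt0 ltr_wpDl.
have := fmin (x%:C * c).
rewrite -(ler_pXn2r (ltn0Sn 1)) ?nnegrE ?nrm_ge0// sqr_nrm2_sub// -/c -/n.
rewrite cabsM cabs_real (ger0_norm (ltW x0)) conjM conj_real -mulrA.
rewrite [c^* * c]mulrC mulJ -rmorphM.
have -> : complex.Re (x * cabs c ^+ 2)%:C = x * cabs c ^+ 2 by [].
have key (k N : R) : N <= N - 2 * (x * k ^+ 2) + (x * k) ^+ 2 * n ->
    2 * x * k ^+ 2 <= x * (x * n) * k ^+ 2 by rewrite exprMn; lra.
move=> /key hh.
have xn : x * n <= 1 by rewrite /x mulrC ler_pdivrMr ?mul1r ?lerDl// ltr_wpDl.
have : cabs c ^+ 2 <= 0.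
  move: hh; rewrite -!mulrA mulrCA ler_pM2l// => hh.
  have : x * n * cabs c ^+ 2 <= 1 * cabs c ^+ 2 by rewrite ler_wpM2r// sqr_ge0.
  by move: hh; rewrite !mulrA; lra.
move=> c2; apply: cabs_eq0; apply/eqP; rewrite -sqrf_eq0 eq_le c2.
exact: sqr_ge0.
Qed.

(** A minimizing sequence for the distance is Cauchy, and its limit attains the distance;
    orthogonality follows by varying along [h]. *)
Theorem orthogonal_projection V f : closed_subspace V -> lp 2 f ->
  exists g, is_orthogonal_projection V f g.
Proof.
move=> cV fp.
pose D := [set nrm 2 (fun t => f t - v t) | v in V].
have hD : has_inf D.
  split; first by exists (nrm 2 (fun t => f t - 0)); exists (fun=> 0) => //; exact: csub0 cV.
  by exists 0 => _ [v Vv <-]; exact: nrm_ge0.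
pose d := inf D.
have d0 : 0 <= d by apply: lb_le_inf; [case: hD|move=> _ [v Vv <-]; exact: nrm_ge0].
have dle v : V v -> d <= nrm 2 (fun t => f t - v t).
  by move=> Vv; apply: ge_inf; [case: hD|exists v].
have e_gt0 n : (0 : R) < n.+1%:R^-1 by rewrite invr_gt0 ltr0n.
have /choice[v vP] : forall n : nat, exists v, V v /\ nrm 2 (fun t => f t - v t) < d + n.+1%:R^-1.
  by move=> n; have [_ [w Vw <-] h] := inf_adherent (e_gt0 n) hD; exists w.
have Vv n : V (v n) by case: (vP n).
have vlt n : nrm 2 (fun t => f t - v n t) < d + n.+1%:R^-1 by case: (vP n).
have vp n : lp 2 (v n) by exact: csub_L2 cV _ (Vv n).
have fvp n : lp 2 (fun t => f t - v n t) by exact: lp2B.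
(* Parallelogram law for f - v m and f - v n: their half sum is [f] minus the midpoint, which lies
   in [V] and hence at distance at least [d]. *)
have key n m (e : R) : 0 <= e -> n.+1%:R^-1 <= e -> m.+1%:R^-1 <= e ->
    nrm 2 (fun t => v n t - v m t) ^+ 2 <= 4 * (2 * d * e + e ^+ 2).
  move=> e0 ne me; have := parallelogram (fvp m) (fvp n).
  rewrite (_ : (fun t => f t - v m t - (f t - v n t)) = (fun t => v n t - v m t)); last first.
    by apply/funext => t; ring.
  rewrite (_ : (fun t => f t - v m t + (f t - v n t)) =
    (fun t => 2 * (f t - 2^-1 * (v n t + v m t)))); last first.
    apply/funext => t; rewrite [RHS]mulrBr mulrA divff ?mul1r; first by ring.
    by rewrite pnatr_eq0.
  have Vh : V (fun t => 2^-1 * (v n t + v m t)) by apply: csubZ => //; exact: csubD.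
  have hp := csub_L2 cV Vh.
  rewrite nrmZ//; last exact: lp2B.
  rewrite cabs2.
  have h1 := dle _ Vh.
  have h2 : nrm 2 (fun t => f t - v m t) <= d + e by rewrite (le_trans (ltW (vlt m)))// lerD2l.
  have h3 : nrm 2 (fun t => f t - v n t) <= d + e by rewrite (le_trans (ltW (vlt n)))// lerD2l.
  have s1 : d ^+ 2 <= nrm 2 (fun t => f t - 2^-1 * (v n t + v m t)) ^+ 2.
    by rewrite ler_pXn2r// ?nnegrE ?nrm_ge0.
  have s2 : nrm 2 (fun t => f t - v m t) ^+ 2 <= (d + e) ^+ 2.
    by rewrite ler_pXn2r// ?nnegrE ?nrm_ge0// addr_ge0.
  have s3 : nrm 2 (fun t => f t - v n t) ^+ 2 <= (d + e) ^+ 2.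
    by rewrite ler_pXn2r// ?nnegrE ?nrm_ge0// addr_ge0.
  rewrite exprMn.
  rewrite (_ : (d + e) ^+ 2 = d ^+ 2 + 2 * d * e + e ^+ 2) in s2 s3; last by ring.
  by move: s1 s2 s3; lra.
have cauchy : lp_cauchy 2 v.
  move=> e e0.
  (* As x <= 1, the bound 4 (2 d x + x^2) of [key] is at most (8 d + 4) x, hence at most e^2. *)
  pose x := Num.min 1 (e ^+ 2 / (8 * d + 4)).
  have p0 : 0 < 8 * d + 4 by rewrite ltr_wpDl// mulr_ge0.
  have x0 : 0 < x by rewrite lt_min ltr01 divr_gt0// exprn_gt0.
  have [N NP] : exists N : nat, N.+1%:R^-1 <= x.
    exists (Num.truncn x^-1); rewrite -[leRHS]invrK lef_pV2 ?posrE ?invr_gt0//.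
    by rewrite ltW// truncnS_gt.
  have small n : (N <= n)%N -> n.+1%:R^-1 <= x.
    move=> Nn; apply: le_trans NP.
    by rewrite lef_pV2 ?posrE ?ltr0n// ler_nat.
  exists N => n m Nn Nm.
  rewrite -(ler_pXn2r (ltn0Sn 1)) ?nnegrE ?nrm_ge0 ?(ltW e0)//.
  apply: le_trans (key _ _ x (ltW x0) (small _ Nn) (small _ Nm)) _.
  have x1 : x <= 1 by rewrite ge_min lexx.
  have xe : x * (8 * d + 4) <= e ^+ 2 by rewrite -ler_pdivlMr// ge_min lexx orbT.
  have : x ^+ 2 <= x by rewrite expr2 ler_piMr// ltW.
  by move: xe; lra.
have [g gp vg] := lp_complete ge1_2 vp cauchy.
have Vg : V g by exact: csub_closed cV _ _ Vv gp vg.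
have gmin : nrm 2 (fun t => f t - g t) <= d.
  apply/ler_addgt0Pr => e e0.
  have e20 : 0 < e / 2 by rewrite divr_gt0.
  have [N1 N1P] := (lp_cvgP _ _ _).1 vg _ e20.
  have [N2 N2P] : exists N : nat, N.+1%:R^-1 <= e / 2.
    exists (Num.truncn (e / 2)^-1); rewrite -[leRHS]invrK lef_pV2 ?posrE ?invr_gt0//.
    by rewrite ltW// truncnS_gt.
  pose N := maxn N1 N2.
  have h1 := N1P N (leq_maxl _ _).
  have h2 : N.+1%:R^-1 <= e / 2.
    by apply: le_trans N2P; rewrite lef_pV2 ?posrE ?ltr0n// ler_nat ltnS leq_maxr.
  have h3 := vlt N.
  have h4 := nrm_dist_triangle ge1_2 fp (vp N) gp.
  move: h1 h2 h3 h4; move: (N.+1%:R^-1) (nrm 2 _) (nrm 2 _) (nrm 2 _) => z1 z2 z3 z4.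
  by lra.
exists g; split => // h Vh.
apply: orthogonal_of_minimal; [exact: lp2B|exact: csub_L2 cV _ Vh|] => a.
apply: le_trans gmin _.
rewrite (_ : (fun t => f t - g t - a * h t) = (fun t => f t - (a * h t + g t))); last first.
  by apply/funext => t; ring.
by apply: dle; exact: csub_lin.
Qed.

End L2.

(** * Density of trigonometric polynomials *)

Section Density.
Context {R : realType}.
Local Notation mu := (@circle R).
Local Notation mfun g := (measurable_fun [set: measurableTypeR R] (g : R -> R)).
Local Notation ig := summable_on_circle.
Local Notation cabs := (@Normc.normc R).
Local Notation ci := csummable_on_circle.
Local Notation lp p := (@circle_Lp R p%:E).
Local Notation I := (@circle_int R).
Implicit Types (f g : R -> R[i]) (h k w : R -> R) (A B : set R).

(** Real trigonometric polynomials, presented as real parts of analytic ones: this is the form in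
    which the conjugate function estimate is stated. Stability under products then takes an
    argument. *)
Definition rtrig h := exists P : {poly R[i]}, forall t, h t = complex.Re P.[expi t].

Lemma rtrig_ext h k : h =1 k -> rtrig h -> rtrig k.
Proof. by move=> hk [P hP]; exists P => t; rewrite -hk. Qed.

Lemma rtrigD h k : rtrig h -> rtrig k -> rtrig (fun t => h t + k t).
Proof. by move=> [P hP] [Q kQ]; exists (P + Q) => t; rewrite hornerD cReD hP kQ. Qed.

Lemma ReZ (c : R) (z : R[i]) : complex.Re (c%:C * z) = c * complex.Re z.
Proof. by rewrite cReM /= mul0r subr0. Qed.

Lemma rtrigZ c h : rtrig h -> rtrig (fun t => c * h t).
Proof. by move=> [P hP]; exists (c%:C *: P) => t; rewrite hornerZ ReZ hP. Qed.

Lemma rtrig_cst c : rtrig (fun=> c).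
Proof. by exists (c%:C)%:P => t; rewrite hornerC. Qed.

Lemma rtrigB h k : rtrig h -> rtrig k -> rtrig (fun t => h t - k t).
Proof.
by move=> hh hk; apply: rtrigD => //; apply: rtrig_ext (rtrigZ (-1) hk) => t; rewrite mulN1r.
Qed.

Lemma rtrig_sum (J : Type) (s : seq J) (F : J -> R -> R) :
  (forall i, rtrig (F i)) -> rtrig (fun t => \sum_(i <- s) F i t).
Proof.
move=> hF; elim: s => [|i s ih].
  by apply: rtrig_ext (rtrig_cst 0) => t; rewrite big_nil.
by apply: rtrig_ext (rtrigD (hF i) ih) => t; rewrite big_cons.
Qed.

(** On the circle the monomial is a power of z or the conjugate of one, and a real part does not
    change under conjugation. *)
Lemma rtrig_monom c (n m : nat) :
  rtrig (fun t => complex.Re (c * (expi t ^+ n * (expi t ^+ m)^*))).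
Proof.
have e t a b : expi t ^+ (a + b) * (expi t ^+ b)^* = expi t ^+ a :> R[i].
  by rewrite exprD -mulrA mulJ [X in cabs X]expiX cabs_expi expr1n mulr1.
have [mn|nm] := leqP m n.
  exists (c *: 'X^(n - m)) => t; rewrite hornerZ hornerXn.
  by rewrite -{1}(subnK mn) e.
exists (c^* *: 'X^(m - n)) => t; rewrite hornerZ hornerXn -cRe_conj conjM.
by rewrite conjM conjK mulrC [in RHS]mulrC mulrC -{1}(subnK (ltnW nm)) [(expi t ^+ n)^* * _]mulrC e mulrC.
Qed.

Lemma rtrig_mulJ (P Q : {poly R[i]}) :
  rtrig (fun t => complex.Re (P.[expi t] * (Q.[expi t])^*)).
Proof.
have hs : rtrig (fun t => \sum_(i < size P) \sum_(j < size Q)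
    complex.Re ((P`_i * (Q`_j)^*) * (expi t ^+ i * (expi t ^+ j)^*))).
  by apply: rtrig_sum => i; apply: rtrig_sum => j; exact: rtrig_monom.
apply: rtrig_ext hs => t; rewrite !horner_coef.
rewrite [(\sum_(i < size Q) _)^*]rmorph_sum/= mulr_suml.
rewrite (big_morph _ cReD (erefl : complex.Re 0 = 0 :> R)); apply: eq_bigr => i _.
rewrite mulr_sumr (big_morph _ cReD (erefl : complex.Re 0 = 0 :> R)).
by apply: eq_bigr => j _; rewrite rmorphM/=; congr complex.Re; ring.
Qed.

Lemma rtrigM h k : rtrig h -> rtrig k -> rtrig (fun t => h t * k t).
Proof.
move=> [P hP] [Q kQ].
have h1 : rtrig (fun t => complex.Re (P * Q).[expi t]) by exists (P * Q).
apply: rtrig_ext (rtrigZ 2^-1 (rtrigD h1 (rtrig_mulJ P Q))) => t.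
rewrite hP kQ hornerM !cReM cRe_conj cIm_conj.
set a := complex.Re _; set b := complex.Re _; set c := complex.Im _; set d := complex.Im _.
by field.
Qed.

Lemma rtrigX h n : rtrig h -> rtrig (fun t => h t ^+ n).
Proof.
move=> hh; elim: n => [|n ih]; first exact: rtrig_cst.
by apply: rtrig_ext (rtrigM hh ih) => t; rewrite exprS.
Qed.

Lemma rtrig_cos (a : R) : rtrig (fun t => cos (t - a)).
Proof.
exists (expi (- a) *: 'X) => t; rewrite hornerZ hornerX -expiD addrC.
by [].
Qed.

Lemma rtrig_mfun h : rtrig h -> mfun h.
Proof.
move=> [P hP]; have [m _] := cmeas_horner P.
by rewrite (_ : h = (fun t => complex.Re P.[expi t]))//; apply/funext.
Qed.

Lemma bernoulli_le (a : R) n : 0 <= a <= 1 -> 1 - n%:R * a <= (1 - a) ^+ n.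
Proof.
move=> /andP[a0 a1]; elim: n => [|n ih]; first by rewrite mul0r subr0 expr0.
rewrite exprS; have := ler_wpM2l (_ : 0 <= 1 - a) ih.
rewrite subr_ge0 => /(_ a1); apply: le_trans.
rewrite -nat1r; set m : R := n%:R.
have : 0 <= m * a ^+ 2 by rewrite mulr_ge0// ?ler0n ?sqr_ge0.
by lra.
Qed.

Lemma bernoulli_ge (a : R) n : 0 <= a -> 1 + n%:R * a <= (1 + a) ^+ n.
Proof.
move=> a0; elim: n => [|n ih]; first by rewrite mul0r addr0 expr0.
rewrite exprS; have := ler_wpM2l (_ : 0 <= 1 + a) ih.
rewrite addr_ge0// => /(_ isT); apply: le_trans.
rewrite -nat1r; set m : R := n%:R.
have : 0 <= m * a ^+ 2 by rewrite mulr_ge0// ?ler0n ?sqr_ge0.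
by lra.
Qed.

(* Stone's polynomials, approximate indicators of [0, 1/2[ on [0, 1]. *)
Definition stone (n : nat) (z : R) := (1 - z ^+ n) ^+ (2 ^ n).

Lemma stone_itv n z : 0 <= z <= 1 -> 0 <= stone n z <= 1.
Proof.
move=> /andP[z0 z1]; have h1 : 0 <= z ^+ n by rewrite exprn_ge0.
have h2 : z ^+ n <= 1 by rewrite exprn_ile1.
by rewrite exprn_ge0 ?subr_ge0//= exprn_ile1 ?subr_ge0// gerBl.
Qed.

(** Bernoulli's inequality bounds the polynomial from below by 1 - (2 z)^n. *)
Lemma stone_cvg1 z : 0 <= z < 2^-1 -> stone n z @[n --> \oo] --> (1 : R).
Proof.
move=> /andP[z0 z1]; have zle : z <= 1 by rewrite (le_trans (ltW z1))// invf_le1// ler1n.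
apply: (@squeeze_cvgr _ _ _ _ (fun n => 1 - (2 * z) ^+ n) (fun=> 1)).
- have z01 : 0 <= z <= 1 by rewrite z0.
  apply: nearW => n; have /andP[_ ->] := stone_itv n z01.
  rewrite andbT exprMn.
  have := @bernoulli_le (z ^+ n) (2 ^ n).
  by rewrite natrX; apply; rewrite exprn_ge0//= exprn_ile1.
- rewrite -[X in _ --> X]subr0; apply: cvgB; first exact: cvg_cst.
  apply: cvg_expr; rewrite ger0_norm ?mulr_ge0//.
  by rewrite mulrC -ltr_pdivlMr// mul1r.
- exact: cvg_cst.
Qed.

(** Multiplying by (1 + z^n)^(2^n), which is at least (2 z)^n by Bernoulli, leaves (1 - z^(2
    n))^(2^n) <= 1; hence the upper bound (2 z)^-n. *)
Lemma stone_cvg0 z : 2^-1 < z <= 1 -> stone n z @[n --> \oo] --> (0 : R).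
Proof.
move=> /andP[z1 zle]; have z0 : 0 < z by rewrite (lt_trans _ z1)// invr_gt0.
apply: (@squeeze_cvgr _ _ _ _ (fun=> 0) (fun n => ((2 * z)^-1) ^+ n)).
- have z01 : 0 <= z <= 1 by rewrite ltW.
  apply: nearW => n; have /andP[-> _] := stone_itv n z01.
  rewrite /= exprVn -[leRHS]mul1r ler_pdivlMr ?exprn_gt0 ?mulr_gt0//.
  have a0 : 0 <= z ^+ n by rewrite exprn_ge0// ltW.
  have a1 : z ^+ n <= 1 by rewrite exprn_ile1// ltW.
  have h := @bernoulli_ge (z ^+ n) (2 ^ n) a0.
  apply: (@le_trans _ _ (stone n z * (1 + z ^+ n) ^+ (2 ^ n))).
    apply: ler_wpM2l; first by rewrite exprn_ge0// subr_ge0.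
    by apply: le_trans h; rewrite exprMn natrX lerDr.
  rewrite /stone -exprMn exprn_ile1//.
    by rewrite mulr_ge0 ?subr_ge0// addr_ge0.
  have : 0 <= z ^+ n * z ^+ n by rewrite mulr_ge0.
  by lra.
- exact: cvg_cst.
- apply: cvg_expr; rewrite ger0_norm ?invr_ge0 ?mulr_ge0 ?ltW//.
  by rewrite invf_lt1 ?mulr_gt0// mulrC -ltr_pdivrMr// mul1r.
Qed.

(** Discards the points where the trigonometric test function of [trig_approx_ray] vanishes: the two
    endpoints, at which sin (t / 2) = 0, and the end [x] of the ray. *)
Lemma circle_ae_itv (x : R) : {ae mu, forall t, [/\ 0 < t, t < 2 * pi & t != x]}.
Proof.
have n1 : mu.-negligible (~` `[0, 2 * pi]%classic).
  apply/negligibleP; first exact: measurableC.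
  rewrite /circle/= /uniform_prob integral_uniform_pdf.
  by rewrite setICl integral_set0.
have ns y : mu.-negligible [set y].
  apply/negligibleP => //.
  by rewrite /circle/= /uniform_prob; exact: integral_set1.
have nU := negligibleU n1 (negligibleU (ns 0) (negligibleU (ns (2 * pi)) (ns x))).
apply: negligibleS nU => t /=; apply: contra_notP => nZ.
have [t0 t1] : 0 <= t /\ t <= 2 * pi.
  apply/andP; apply: contrapT => h; apply: nZ; left => /=.
  by rewrite in_itv/=.
split.
- by rewrite lt_neqAle t0 andbT; apply/eqP => e; apply: nZ; right; left; rewrite /= -e.
- by rewrite lt_neqAle t1 andbT; apply/eqP => e; apply: nZ; right; right; left.
- by apply/eqP => e; apply: nZ; right; right; right.
Qed.

(** * Approximation of indicators by trigonometric polynomials in a weighted L^1 *)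

Section Weight.
Variable w : R -> R.
Hypotheses (w0 : forall t, 0 <= w t) (iw : ig w).

(* The weight makes room for testing against an arbitrary integrable function
   (w = |a|) as well as for approximating in L^p (w = 1). *)
Definition trig_approx A := forall e, 0 < e -> exists h, [/\ rtrig h,
  forall t, 0 <= h t <= 1 & mean (fun t => `|\1_A t - h t| * w t) <= e].

Lemma ind_itv A t : 0 <= (\1_A t : R) <= 1.
Proof. by rewrite indicE; case: (_ \in _) => /=; rewrite ?lexx ?ler01. Qed.

Lemma ig_ind_dist A h : measurable (A : set (measurableTypeR R)) -> rtrig h ->
  (forall t, 0 <= h t <= 1) -> ig (fun t => `|\1_A t - h t| * w t).
Proof.
move=> mA hh h01; apply: ig_le iw.
  apply: measurable_funM; last exact: ig_mfun.
  apply: measurableT_comp => //; apply: measurable_funB; last exact: rtrig_mfun.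
  exact: measurable_indic.
move=> t; rewrite normrM normr_id (ger0_norm (w0 t)) ler_piMl//.
by have := ind_itv A t; have := h01 t; rewrite ler_norml; lra.
Qed.

Lemma trig_approxC A : trig_approx A -> trig_approx (~` A).
Proof.
move=> hA e e0; have [h [hh h01 he]] := hA e e0.
exists (fun t => 1 - h t); split.
- by apply: rtrigB => //; exact: rtrig_cst.
- by move=> t; have := h01 t; lra.
- rewrite (_ : (fun t => _) = (fun t => `|\1_A t - h t| * w t))//.
  apply/funext => t; congr (_ * _).
  rewrite !indicE in_setC; case: (_ \in _) => /=.
    by rewrite sub0r normrN.
  by rewrite subKr sub0r normrN.
Qed.

(** The product of the approximants works: for factors in [0, 1] the error of a product is at most
    the sum of the errors. *)
Lemma trig_approxI A B : measurable (A : set (measurableTypeR R)) ->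
  measurable (B : set (measurableTypeR R)) ->
  trig_approx A -> trig_approx B -> trig_approx (A `&` B).
Proof.
move=> mA mB hA hB e e0; have e20 : 0 < e / 2 by rewrite divr_gt0.
have [h [hh h01 he]] := hA _ e20; have [k [hk k01 ke]] := hB _ e20.
have hk01 t : 0 <= h t * k t <= 1.
  have /andP[a b] := h01 t; have /andP[c d] := k01 t.
  by rewrite mulr_ge0//= mulr_ile1.
exists (fun t => h t * k t); split => //; first exact: rtrigM.
rewrite (splitr e); apply: le_trans (lerD he ke).
rewrite -meanD; [|exact: ig_ind_dist|exact: ig_ind_dist].
apply: mean_le.
- by apply: ig_ind_dist => //; [exact: measurableI|exact: rtrigM].
- by apply: igD; exact: ig_ind_dist.
move=> t; rewrite -mulrDl ler_wpM2r//.
rewrite indicI /=.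
have -> : \1_A t * \1_B t - h t * k t =
  (\1_A t - h t) * \1_B t + h t * (\1_B t - k t) by ring.
apply: le_trans (ler_normD _ _) _; rewrite !normrM; apply: lerD.
  by rewrite ler_piMr// ler_norml; have := ind_itv B t; lra.
by rewrite ler_piMl// ler_norml; have := h01 t; lra.
Qed.

Lemma trig_approx0 : trig_approx set0.
Proof.
move=> e e0; exists (fun=> 0); split; [exact: rtrig_cst|by move=> t; rewrite lexx ler01|].
under eq_fun do rewrite indic0 subrr normr0 mul0r.
by rewrite mean_cst ltW.
Qed.

(** Finite unions come from complements and intersections; they increase to the whole union, and
    dominated convergence with dominating function [w] concludes. *)
Lemma trig_approx_bigcup (F : nat -> set R) :
  (forall n, measurable (F n : set (measurableTypeR R)) /\ trig_approx (F n)) ->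
  trig_approx (\bigcup_n F n).
Proof.
move=> hF.
have hU n : measurable (\bigcup_(i < n) F i : set (measurableTypeR R)) /\
    trig_approx (\bigcup_(i < n) F i).
  elim: n => [|n [m1 a1]].
    rewrite (_ : \bigcup_(i < 0) F i = set0); first by split => //; exact: trig_approx0.
    by apply/seteqP; split => // t [].
  have -> : \bigcup_(i < n.+1) F i = ~` (~` (\bigcup_(i < n) F i) `&` ~` F n).
    rewrite setCI !setCK; apply/seteqP; split => t.
      move=> [i /= ]; rewrite ltnS leq_eqVlt => /predU1P[-> Ft|lin Ft]; first by right.
      by left; exists i.
    by case=> [[i /= lin Ft]|Ft]; [exists i => //=; exact: ltnW|exists n => /=].
  have [m2 a2] := hF n; have mI := measurableI _ _ (measurableC m1) (measurableC m2).
  split; first exact: measurableC.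
  apply: trig_approxC; apply: trig_approxI; try exact: measurableC; exact: trig_approxC.
set B := \bigcup_n F n.
have mB : measurable (B : set (measurableTypeR R)) by apply: bigcup_measurable => n _; have [] := hF n.
pose U n := \bigcup_(i < n) F i.
have m1 n : mfun (fun t => \1_(U n) t * w t).
  by apply: measurable_funM; [exact: measurable_indic (hU n).1|exact: ig_mfun].
have m2 : mfun (fun t => \1_B t * w t).
  by apply: measurable_funM; [exact: measurable_indic mB|exact: ig_mfun].
have cv : {ae mu, forall t, (fun n => \1_(U n) t * w t) @ \oo --> \1_B t * w t}.
  apply: aeW => t; apply: cvgM; last exact: cvg_cst.
  rewrite !indicE; have [Bt|Bt] := pselect (B t).
    rewrite mem_set//; have [i _ Fit] := Bt.
    apply: (@cvg_trans _ (1 @[n --> \oo])); last exact: cvg_cst.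
    apply: near_eq_cvg; exists i.+1 => // n /= lin.
    by rewrite indicE mem_set//; exists i.
  rewrite memNset//; under eq_fun => n.
    rewrite indicE memNset; last by move=> [i _ Fit]; apply: Bt; exists i.
    over.
  exact: cvg_cst.
have dom n t : `|\1_(U n) t * w t| <= w t.
  by have := ind_itv (U n) t; rewrite normrM (ger0_norm (w0 t)) => h; rewrite ler_piMl// ler_norml; lra.
have [iB cv0] := mean_cvg_dominated m1 m2 iw cv dom.
move=> e e0; have e20 : 0 < e / 2 by rewrite divr_gt0.
have /cvgrPdist_le/(_ _ e20)[n _ /(_ n (leqnn _))] := cv0.
rewrite /= sub0r normrN ger0_norm; last by apply: mean_ge0.
move=> hn; have [h [hh h01 he]] := (hU n).2 _ e20.
exists h; split => //; rewrite (splitr e); apply: le_trans (lerD hn he).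
have iUn : ig (fun t => `|\1_(U n) t * w t - \1_B t * w t|).
  by apply: ig_norm; apply: igB => //; exact: ig_le (m1 n) (dom n) iw.
have iUh : ig (fun t => `|\1_(U n) t - h t| * w t) by apply: ig_ind_dist => //; exact: (hU n).1.
rewrite -meanD//; apply: mean_le; [exact: ig_ind_dist|exact: igD|].
move=> t; rewrite -mulrBl normrM (ger0_norm (w0 t)) -mulrDl ler_wpM2r//.
by rewrite (distrC (\1_(U n) t)); exact: ler_distD.
Qed.

(** Rays starting outside [0, 2 pi[ have an almost everywhere constant indicator. For the others,
    Stone's polynomials are composed with a trigonometric polynomial that separates the two sides of
    [x]. *)
Lemma trig_approx_ray x : trig_approx `]x, +oo[%classic.
Proof.
have ae_case (c : R) (A : set R) : c = 0 \/ c = 1 -> measurable (A : set (measurableTypeR R)) ->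
    {ae mu, forall t, (\1_A t : R) = c} -> trig_approx A.
  move=> c01 mA hA e e0; exists (fun=> c).
  have hc : rtrig (fun=> c) by exact: rtrig_cst.
  have hc01 (t : R) : 0 <= c <= 1 by case: c01 => ->; rewrite ?lexx ler01.
  split => //; rewrite (@mean_ae _ _ (fun=> 0)) ?mean_cst ?ltW//.
    by apply: ig_mfun; exact: ig_ind_dist.
  by apply: (aeS _ hA) => t ->; rewrite subrr normr0 mul0r.
have mray : measurable (`]x, +oo[%classic : set (measurableTypeR R)) by exact: measurable_itv.
have [x0|x0] := ltP x 0.
  apply: (ae_case 1) => //; first by right.
  apply: (aeS _ (circle_ae_itv 0)) => t [t0 _ _].
  by rewrite indicE mem_set//= in_itv/= andbT (lt_trans x0).
have [x1|x1] := leP (2 * pi) x.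
  apply: (ae_case 0) => //; first by left.
  apply: (aeS _ (circle_ae_itv 0)) => t [_ t1 _].
  by rewrite indicE memNset//= in_itv/= andbT => h; have := lt_trans h t1; rewrite ltNge x1.
(* k t = 2 sin (t / 2) sin ((t - x) / 2) has the sign of t - x on ]0, 2 pi[. *)
pose k t := cos (x / 2) - cos (t - x / 2).
(* As |k| <= 2, this lies in [0, 1]; it is below 1/2 exactly where [k] is positive, that is, on the
   ray. *)
pose z t := 2^-1 - 4^-1 * k t.
have z01 t : 0 <= z t <= 1.
  have := cos_geN1 (x / 2); have := cos_le1 (x / 2).
  have := cos_geN1 (t - x / 2); have := cos_le1 (t - x / 2).
  by rewrite /z /k; lra.
have kE t : k t = 2 * (sin (t / 2) * sin ((t - x) / 2)).
  rewrite /k.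
  have -> : cos (x / 2) = cos (t / 2 - (t - x) / 2) by congr cos; field.
  have -> : cos (t - x / 2) = cos (t / 2 + (t - x) / 2) by congr cos; field.
  by rewrite cosB cosD; ring.
have hz : rtrig z.
  apply: rtrigB; first exact: rtrig_cst.
  by apply: rtrigZ; apply: rtrigB; [exact: rtrig_cst|exact: rtrig_cos].
have hst n : rtrig (fun t => stone n (z t)).
  rewrite /stone; apply: (rtrigX (h := fun t => 1 - z t ^+ n)).
  by apply: rtrigB; [exact: rtrig_cst|exact: rtrigX].
have cvst : {ae mu, forall t, (fun n => `|\1_(`]x, +oo[%classic) t - stone n (z t)| * w t) @ \oo --> 0}.
  apply: (aeS _ (circle_ae_itv x)) => t [t0 t1 tx].
  rewrite -[X in _ --> X](mul0r (w t)); apply: cvgM; last exact: cvg_cst.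
  rewrite -[X in _ --> X](@normr0 _ R); apply: cvg_norm.
  rewrite -[X in _ --> X](subrr (\1_(`]x, +oo[%classic) t)); apply: cvgB; first exact: cvg_cst.
  have st : 0 < sin (t / 2) by apply: sin_gt0_pi; rewrite divr_gt0//= ltr_pdivrMr// mulrC.
  rewrite indicE; have [xt|xt] := ltP x t.
    rewrite mem_set; last by rewrite /= in_itv/= xt.
    apply: stone_cvg1; have /andP[-> _] := z01 t.
    have : 0 < sin ((t - x) / 2).
      by apply: sin_gt0_pi; rewrite divr_gt0 ?subr_gt0//= ltr_pdivrMr// mulrC; lra.
    move=> st2; have := mulr_gt0 st st2; rewrite /z kE => hh.
    by rewrite gtrBl; lra.
  rewrite memNset; last by rewrite /= in_itv/= andbT ltNge xt.
  apply: stone_cvg0; have /andP[_ ->] := z01 t.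
  have : 0 < sin ((x - t) / 2).
    apply: sin_gt0_pi; rewrite divr_gt0 ?subr_gt0//=.
      by rewrite ltr_pdivrMr// mulrC; lra.
    by rewrite lt_neqAle tx.
  move=> st2; have := mulr_gt0 st st2; rewrite /z kE => hh.
  have e1 : (t - x) / 2 = - ((x - t) / 2) by field.
  by rewrite e1 sinN andbT; lra.
have s01 n t : 0 <= stone n (z t) <= 1 by exact: stone_itv.
have mst n : mfun (fun t => `|\1_(`]x, +oo[%classic) t - stone n (z t)| * w t).
  by apply: ig_mfun; exact: ig_ind_dist.
have dom n t : `| `|\1_(`]x, +oo[%classic) t - stone n (z t)| * w t| <= w t.
  rewrite normrM normr_id (ger0_norm (w0 t)) ler_piMl//.
  by have := ind_itv `]x, +oo[%classic t; have := s01 n t; rewrite ler_norml; lra.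
have m0 : mfun (fun=> 0) by exact: measurable_cst.
have [_ cv0] := mean_cvg_dominated mst m0 iw cvst dom.
move=> e e0.
have /cvgrPdist_le/(_ _ e0)[n _ /(_ n (leqnn _))] := cv0.
rewrite /= sub0r normrN ger0_norm; last by apply: mean_ge0.
move=> hn; exists (fun t => stone n (z t)); split => //.
apply: le_trans hn; apply: mean_le.
- exact: ig_ind_dist.
- by apply: ig_norm; apply: igB (ig_cst 0); exact: ig_ind_dist.
- by move=> t; rewrite subr0 ler_norm.
Qed.

(** The sets with the approximation property form a sigma-algebra, and the rays generate the Borel
    sets. *)
Theorem trig_approx_measurable A : measurable (A : set (measurableTypeR R)) -> trig_approx A.
Proof.
move=> mA.
pose M := [set B : set R | measurable (B : set (measurableTypeR R)) /\ trig_approx B].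
suff : M A by case.
have sM : sigma_algebra setT M.
  split.
  - by split => //; exact: trig_approx0.
  - by move=> B [mB hB]; rewrite setTD; split; [exact: measurableC|exact: trig_approxC].
  - move=> F hF; split; last exact: trig_approx_bigcup.
    by apply: bigcup_measurable => n _; have [] := hF n.
move: mA; rewrite RGenOInfty.measurableE; apply: smallest_sub => // _ [x ->].
by split; [exact: measurable_itv|exact: trig_approx_ray].
Qed.

End Weight.

(** Approximation with weight |a| makes [a] orthogonal to every indicator; those of {a >= 0} and of
    its complement force [a] to vanish. *)
Lemma rtrig_orth_eq0 (a : R -> R) : ig a ->
  (forall h, rtrig h -> mean (fun t => a t * h t) = 0) -> {ae mu, forall t, a t = 0}.
Proof.
move=> ia ah; have ma := ig_mfun ia.
have indA A : measurable (A : set (measurableTypeR R)) -> mean (fun t => a t * \1_A t) = 0.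
  move=> mA; have mi : mfun (\1_A : R -> R) by exact: measurable_indic.
  have iA : ig (fun t => a t * \1_A t).
    apply: (ig_le _ _ (ig_norm ia)); first exact: measurable_funM.
    by move=> t; rewrite normrM ler_piMr// ler_norml; have := ind_itv A t; lra.
  apply/eqP; rewrite -normr_le0; apply/ler_addgt0Pr => e e0; rewrite add0r.
  have [h [hh h01 he]] := trig_approx_measurable (fun t => normr_ge0 (a t)) (ig_norm ia) mA e0.
  have ih : ig (fun t => a t * h t).
    apply: (ig_le _ _ (ig_norm ia)); first by apply: measurable_funM => //; exact: rtrig_mfun.
    by move=> t; rewrite normrM ler_piMr// ler_norml; have := h01 t; lra.
  rewrite -[mean _]subr0 -(ah h hh) -meanB//; apply: le_trans he.
  apply: le_trans (mean_norm _) _; first exact: igB.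
  apply: mean_le; first by apply: ig_norm; exact: igB.
    by apply: ig_ind_dist => //; exact: ig_norm.
  by move=> t; rewrite -mulrBr normrM mulrC.
pose A := [set t | 0 <= a t].
have mA : measurable (A : set (measurableTypeR R)).
  have := ma measurableT `[0, +oo[%classic (measurable_itv _); rewrite setTI.
  by congr measurable; apply/seteqP; split => t; rewrite /= in_itv/= andbT.
have iA B : measurable (B : set (measurableTypeR R)) -> ig (fun t => a t * \1_B t).
  move=> mB; apply: (ig_le _ _ (ig_norm ia)).
    by apply: measurable_funM => //; exact: measurable_indic.
  by move=> t; rewrite normrM ler_piMr// ler_norml; have := ind_itv B t; lra.
have h1 : {ae mu, forall t, a t * \1_A t = 0}.
  apply: mean_eq0_ae; [exact: iA|move=> t|exact: indA].
  rewrite indicE; have [At|At] := pselect (A t); last by rewrite memNset// mulr0.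
  by rewrite mem_set// mulr1.
have h2 : {ae mu, forall t, - (a t * \1_(~` A) t) = 0}.
  apply: mean_eq0_ae; [apply: igN; exact/iA/measurableC|move=> t|].
    rewrite indicE; have [At|At] := pselect (A t).
      by rewrite memNset ?mulr0 ?oppr0// => /(_ At).
    by rewrite mem_set// mulr1 oppr_ge0 ltW// ltNge; apply/negP.
  by rewrite meanN ?indA ?oppr0//; [exact: measurableC|exact/iA/measurableC].
apply: (aeS2 _ h1 h2) => t.
rewrite !indicE; have [At|At] := pselect (A t).
  by rewrite mem_set// mulr1.
by move=> _; rewrite mem_set// mulr1 => /eqP; rewrite oppr_eq0 => /eqP.
Qed.

(** Vanishing coefficients make [f] orthogonal to analytic polynomials and to their conjugates,
    hence to real trigonometric polynomials; against these its real and imaginary parts separate. *)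
Theorem fourier_coef_unique f : ci f -> (forall n, fourier_coef f n = 0) ->
  circle_ae_eq f (fun=> 0).
Proof.
move=> cf fn.
have monom c (n : nat) : I (fun t => f t * (c * expi t ^+ n)) = 0.
  rewrite (_ : (fun t => _) = (fun t => c * (f t * expi t ^ (- (- (n%:Z)))))).
    rewrite circle_intZ; last first.
      by apply: (@ciM_bnd _ _ _ 1) => // [|t]; [exact: cmeas_expiX|rewrite expiXz cabs_expi].
    by have := fn (- n%:Z); rewrite /fourier_coef => ->; rewrite mulr0.
  by apply/funext => t; rewrite opprK -exprnP; ring.
have monomJ c (n : nat) : I (fun t => f t * (c * expi t ^+ n)^*) = 0.
  rewrite (_ : (fun t => _) = (fun t => c^* * (f t * expi t ^ (- n%:Z)))).
    rewrite circle_intZ; last first.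
      by apply: (@ciM_bnd _ _ _ 1) => // [|t]; [exact: cmeas_expiX|rewrite expiXz cabs_expi].
    by have := fn n%:Z; rewrite /fourier_coef => ->; rewrite mulr0.
  apply/funext => t; rewrite conjM mulrCA; congr (_ * (_ * _)).
  by rewrite expiX expiXz -expiN; congr expi; rewrite mulrNz mulNr.
have cmon c (n : nat) : cmeas (fun t : R => c * expi t ^+ n).
  by apply: cmeasZ; exact: (cmeas_expiX n).
have bmon c (n : nat) (t : R) : cabs (c * expi t ^+ n) <= cabs c.
  by rewrite cabsM expiX cabs_expi mulr1.
have polyP (P : {poly R[i]}) : ci (fun t => f t * P.[expi t]) /\ I (fun t => f t * P.[expi t]) = 0.
  have cF (i : 'I_(size P)) : ci (fun t => f t * (P`_i * expi t ^+ i)).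
    by apply: (ciM_bnd cf (cmon _ _)); exact: bmon.
  rewrite (_ : (fun t => _) = (fun t => \sum_(i < size P) f t * (P`_i * expi t ^+ i))); last first.
    by apply/funext => t; rewrite horner_coef mulr_sumr.
  by have [h1 h2] := circle_int_sum_ci (index_enum _) cF; split => //; rewrite h2 big1.
have polyJ (P : {poly R[i]}) : ci (fun t => f t * (P.[expi t])^*) /\ I (fun t => f t * (P.[expi t])^*) = 0.
  have cF (i : 'I_(size P)) : ci (fun t => f t * (P`_i * expi t ^+ i)^*).
    by apply: (ciM_bnd cf (cmeasJ (cmon _ _))) => t; rewrite cabsJ; exact: bmon.
  rewrite (_ : (fun t => _) = (fun t => \sum_(i < size P) f t * (P`_i * expi t ^+ i)^*)); last first.
    by apply/funext => t; rewrite horner_coef rmorph_sum mulr_sumr.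
  by have [h1 h2] := circle_int_sum_ci (index_enum _) cF; split => //; rewrite h2 big1.
have real h : rtrig h -> I (fun t => f t * (h t)%:C) = 0.
  move=> [P hP]; have [c1 i1] := polyP P; have [c2 i2] := polyJ P.
  rewrite (_ : (fun t => _) = (fun t => 2^-1 * (f t * P.[expi t] + f t * (P.[expi t])^*))).
    by rewrite circle_intZ ?circle_intD ?i1 ?i2 ?addr0 ?mulr0//; exact: ciD.
  apply/funext => t; rewrite -mulrDr mulrCA; congr (_ * _); rewrite hP.
  case: (P.[expi t]) => x y; apply/eqP; rewrite eq_complex /=; apply/andP.
  by split; apply/eqP; field.
have h1 : {ae mu, forall t, complex.Re (f t) = 0}.
  apply: rtrig_orth_eq0; first exact: ci_Re.
  move=> h /real/(congr1 (@complex.Re R)) /= ie.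
  transitivity (mean (fun t => complex.Re (f t * (h t)%:C))); last exact: ie.
  by congr mean; apply/funext => t; rewrite [LHS]mulrC [in RHS]mulrC ReZ.
have h2 : {ae mu, forall t, complex.Im (f t) = 0}.
  apply: rtrig_orth_eq0; first exact: ci_Im.
  move=> h /real/(congr1 (@complex.Im R)) /= ie.
  transitivity (mean (fun t => complex.Im (f t * (h t)%:C))); last exact: ie.
  by congr mean; apply/funext => t; rewrite cImM /= mulr0 add0r.
by apply: (aeS2 _ h1 h2) => t; case: (f t) => x y /= -> ->.
Qed.

(** The sum counts, in units of [d], the levels k d lying below [x]: this rounds [x] up to a
    multiple of [d], until the levels run out. *)
Lemma staircase (d : R) (n : nat) (x : R) : 0 < d -> 0 <= x ->
  let s := \sum_(k < n) (if k%:R * d < x then d else 0) in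
  s <= x + d /\ (x <= n%:R * d -> x <= s).
Proof.
(* The third clause, saturation once [x] exceeds all levels, is what carries the induction. *)
move=> d0 x0 /=; suff : \sum_(k < n) (if k%:R * d < x then d else 0) <= x + d /\
    (x <= n%:R * d -> x <= \sum_(k < n) (if k%:R * d < x then d else 0)) /\
    (n%:R * d < x -> \sum_(k < n) (if k%:R * d < x then d else 0) = n%:R * d).
  by move=> [? []].
elim: n => [|n [ih1 [ih2 ih3]]].
  by rewrite big_ord0 mul0r; split; [rewrite addr_ge0// ltW|].
rewrite big_ord_recr/= -natr1 mulrDl mul1r; have [nx|nx] := ltP (n%:R * d) x.
  by rewrite ih3//; split; [rewrite lerD2r ltW|].
rewrite addr0; split => //; split; first by move=> _; exact: ih2.
by move=> h; have := lt_le_trans h nx; lra.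
Qed.

(** Layer cake: [g] is within [d] of a sum of indicators of its level sets, and each indicator is
    replaced by a trigonometric polynomial with values in [0, 1], so that the approximant stays
    nonnegative, as the conjugate function estimate requires. *)
Lemma approx_nonneg (p : R) (g : R -> R) (M : R) : 1 <= p -> mfun g ->
  (forall t, 0 <= g t <= M) -> forall e, 0 < e ->
  exists h, [/\ rtrig h, forall t, 0 <= h t &
    lp p (fun t => (h t)%:C) /\ nrm p (fun t => (g t)%:C - (h t)%:C) <= e].
Proof.
move=> p1 mg gM e e0; have p0 : 0 < p := lt_le_trans ltr01 p1.
have M0 : 0 <= M by have /andP[a b] := gM 0; exact: le_trans b.
pose d := e / 2; have d0 : 0 < d by rewrite divr_gt0.
pose n := (Num.truncn (M / d)).+1.
have Mn : M <= n%:R * d by rewrite -ler_pdivrMr// ltW// truncnS_gt.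
pose A (k : nat) := [set t | k%:R * d < g t].
have mA (k : nat) : measurable (A k : set (measurableTypeR R)).
  have := mg measurableT `]k%:R * d, +oo[%classic (measurable_itv _); rewrite setTI.
  by congr measurable; apply/seteqP; split => t; rewrite /= in_itv/= andbT.
have n0 : (0 : R) < n%:R by rewrite ltr0n.
(* An error |1_A - h| <= 1 has p-th power at most itself, so an L^1 error [eta] is an L^p error
   eta^(1/p); [n] such errors with coefficient [d] add up to e / 2. *)
pose eta := (e / (2 * n%:R * d)) `^ p.
have q0 : 0 < e / (2 * n%:R * d) by rewrite divr_gt0// !mulr_gt0.
have eta0 : 0 < eta by exact: powR_gt0.
have /choice[h hP] : forall k : nat, exists h, [/\ rtrig h,
    forall t, 0 <= h t <= 1 & mean (fun t => `|\1_(A k) t - h t| * 1) <= eta].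
  move=> k; exact: (@trig_approx_measurable (fun=> 1) (fun=> ler01) (ig_cst 1) _ (mA k) eta eta0).
have hh (k : nat) : rtrig (h k) by case: (hP k).
have h01 (k : nat) t : 0 <= h k t <= 1 by case: (hP k).
have he (k : nat) : mean (fun t => `|\1_(A k) t - h k t| * 1) <= eta by case: (hP k).
have mh (k : nat) : mfun (h k) by exact: rtrig_mfun.
have mi (k : nat) : mfun (\1_(A k) : R -> R) by exact: measurable_indic.
have lpk (k : nat) : lp p (fun t => (\1_(A k) t - h k t)%:C).
  apply: (@lp_bnd _ _ _ 1) => //; first by apply: cmeas_real; exact: measurable_funB.
  by move=> t; rewrite cabs_real ler_norml; have := h01 k t; have := ind_itv (A k) t; lra.
have nk (k : nat) : nrm p (fun t => (\1_(A k) t - h k t)%:C) <= e / (2 * n%:R * d).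
  apply: nrm_le_of_mean => //; first exact: ltW.
  apply: le_trans (he k); apply: mean_le.
  - by have /lpP[] := lpk k.
  - apply: (ig_ind_dist (w := fun=> 1)) => //; exact: ig_cst.
  move=> t; rewrite mulr1 cabs_real; set y := `|_|.
  have y1 : y <= 1 by rewrite /y ler_norml; have := h01 k t; have := ind_itv (A k) t; lra.
  have [y_eq0|y_neq0] := eqVneq y 0; first by rewrite y_eq0 powR0// gt_eqF.
  by rewrite ge1r_powR// y1 andbT lt_neqAle eq_sym y_neq0 normr_ge0.
pose H t := \sum_(k < n) d * h k t.
have hH : rtrig H by apply: rtrig_sum => k; exact: rtrigZ.
have H0 t : 0 <= H t.
  by apply: sumr_ge0 => k _; rewrite mulr_ge0 ?(ltW d0)//; have /andP[] := h01 k t.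
have HM t : H t <= n%:R * d.
  have -> : n%:R * d = \sum_(k < n) d by rewrite sumr_const card_ord mulr_natl.
  by apply: ler_sum => k _; rewrite ler_piMr ?(ltW d0)//; have /andP[] := h01 k t.
have lpH : lp p (fun t => (H t)%:C).
  apply: (@lp_bnd _ _ _ (n%:R * d)) => //; first by apply: cmeas_real; exact: rtrig_mfun.
  by move=> t; rewrite cabs_real ger0_norm.
exists H; split => //; split => //.
pose S t := \sum_(k < n) d * \1_(A k) t.
have mS : mfun S.
  by apply: measurable_sum => k; apply: measurable_funM => //; exact: measurable_cst.
have gS t : `|g t - S t| <= d.
  have /andP[g0 gM'] := gM t.
  have [s1 s2] := staircase n d0 g0.
  have SE : S t = \sum_(k < n) (if k%:R * d < g t then d else 0).
    apply: eq_bigr => k _; rewrite indicE; case: ifP => h'.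
      by rewrite mem_set// mulr1.
    have nA : ~ A k t by rewrite /A /= h'.
    by rewrite memNset// mulr0.
  have s3 := s2 (le_trans gM' Mn).
  by rewrite ler_norml SE; lra.
have l1 : lp p (fun t => (g t - S t)%:C).
  apply: (@lp_bnd _ _ _ d) => //; first by apply: cmeas_real; exact: measurable_funB.
  by move=> t; rewrite cabs_real.
have sumS m : lp p (fun t => (\sum_(k < m) d * \1_(A k) t - \sum_(k < m) d * h k t)%:C) /\
    nrm p (fun t => (\sum_(k < m) d * \1_(A k) t - \sum_(k < m) d * h k t)%:C)
      <= m%:R * (e / (2 * n%:R)).
  elim: m => [|m [ih1 ih2]].
    under eq_fun do rewrite !big_ord0 subrr.
    by rewrite mul0r nrm_cst// cabs0; split => //; exact: lp_cst.
  have E : (fun t => (\sum_(k < m.+1) d * \1_(A k) t - \sum_(k < m.+1) d * h k t)%:C) =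
      (fun t => (\sum_(k < m) d * \1_(A k) t - \sum_(k < m) d * h k t)%:C +
        d%:C * (\1_(A m) t - h m t)%:C).
    apply/funext => t; rewrite !big_ord_recr/= -rmorphM -rmorphD /=; congr (_%:C).
    by ring.
  rewrite E; have lm := lpZ (d%:C) p0 (lpk m).
  split; first exact: lpD.
  apply: le_trans (nrmD p1 ih1 lm) _; rewrite -natr1 mulrDl mul1r lerD//.
  rewrite nrmZ// cabs_real ger0_norm ?(ltW d0)//.
  apply: le_trans (ler_wpM2l (ltW d0) (nk m)) _.
  by rewrite le_eqVlt; apply/orP; left; apply/eqP; field; rewrite !gt_eqF.
have [l2 n2] := sumS n.
rewrite (_ : (fun t => _) = (fun t => (g t - S t)%:C + (S t - H t)%:C)); last first.
  by apply/funext => t; rewrite -rmorphB -rmorphD /=; congr (_%:C); ring.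
apply: le_trans (nrmD p1 l1 l2) _.
have n1 : nrm p (fun t => (g t - S t)%:C) <= d.
  apply: nrm_bnd => //; first by apply: cmeas_real; exact: measurable_funB.
  by move=> t; rewrite cabs_real.
rewrite (splitr e); apply: lerD => //; apply: le_trans n2 _.
by rewrite le_eqVlt; apply/orP; left; apply/eqP; field; rewrite !gt_eqF.
Qed.

End Density.

(** * The conjugate function for 1 < p < 2 *)

Section Conjugate.
Context {R : realType}.
Local Notation mfun g := (measurable_fun [set: measurableTypeR R] (g : R -> R)).
Local Notation ig := summable_on_circle.
Local Notation cabs := (@Normc.normc R).
Local Notation ci := csummable_on_circle.
Local Notation lp p := (@circle_Lp R p%:E).
Local Notation I := (@circle_int R).

Lemma horner_expi_bounded (P : {poly R[i]}) :
  exists2 M : R, 0 < M & forall t, cabs P.[expi t] <= M.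
Proof.
exists (1 + \sum_(i < size P) cabs P`_i).
  by rewrite ltr_pwDl// sumr_ge0// => i _; exact: cabs_ge0.
move=> t; rewrite horner_coef.
apply: (@le_trans _ _ (\sum_(i < size P) cabs P`_i)); last by rewrite lerDr.
elim: (size P) => [|n ih]; first by rewrite !big_ord0 cabs0.
rewrite !big_ord_recr/=; apply: le_trans (cabsD _ _) _; apply: lerD => //.
by rewrite cabsM expiX cabs_expi mulr1.
Qed.

Lemma ci_horner (P : {poly R[i]}) : ci (fun t => P.[expi t]).
Proof.
by have [M _ PM] := horner_expi_bounded P; exact: (ci_bnd (cmeas_horner P) PM).
Qed.

Lemma geometric_sum (q : R[i]) n : q != 1 ->
  (1 - q)^-1 = \sum_(k < n) q ^+ k + q ^+ n * (1 - q)^-1.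
Proof.
move=> q1; have q1' : 1 - q != 0 by rewrite subr_eq0 eq_sym.
apply: (mulfI q1'); rewrite divff// mulrDr mulrCA divff// mulr1.
by rewrite -[1 - q]opprB mulNr -subrX1 opprB subrK.
Qed.

(** The partial sums of the geometric series are polynomials, for which the mean value property is
    known; the remainders tend to 0 uniformly. *)
Lemma circle_int_geometric (Q : {poly R[i]}) (r : R) : r < 1 ->
  (forall t, cabs Q.[expi t] <= r) -> cabs Q`_0 <= r ->
  I (fun t => (1 - Q.[expi t])^-1) = (1 - Q`_0)^-1.
Proof.
move=> r1 Qr Q0r; have r0 : 0 <= r := le_trans (cabs_ge0 _) Q0r.
have neq1 (q : R[i]) : cabs q <= r -> q != 1.
  by move=> qr; apply/eqP => q1; move: qr; rewrite q1 cabs1 leNgt r1.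
have inv_le (q : R[i]) : cabs q <= r -> cabs (1 - q)^-1 <= (1 - r)^-1.
  move=> qr; rewrite cabsV lef_pV2 ?posrE ?subr_gt0//; last first.
    rewrite lt_neqAle cabs_ge0 andbT eq_sym; apply/eqP => /cabs_eq0/eqP.
    by rewrite subr_eq0 eq_sym; apply/negP/neq1.
  rewrite lerBlDr -(@cabs1 R) -{1}(subrK q 1); apply: le_trans (cabsD _ _) _.
  by rewrite lerD2l.
have rem_le (q : R[i]) n : cabs q <= r -> cabs (q ^+ n * (1 - q)^-1) <= r ^+ n / (1 - r).
  move=> qr; rewrite cabsM; apply: ler_pM => //; try exact: cabs_ge0; last exact: inv_le.
  elim: n => [|n ih]; first by rewrite !expr0 cabs1.
  by rewrite !exprS cabsM ler_pM// cabs_ge0.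
have cQ n : cmeas (fun t => Q.[expi t] ^+ n).
  by apply: cmeas_ext (cmeas_horner (Q ^+ n)) => t; rewrite horner_exp.
have cV : cmeas (fun t => (1 - Q.[expi t])^-1).
  by apply: cmeasV; apply: cmeasB; [exact: cmeas_cst|exact: cmeas_horner].
have cR n : ci (fun t => Q.[expi t] ^+ n * (1 - Q.[expi t])^-1).
  by apply: (@ci_bnd _ _ (r ^+ n / (1 - r))); [exact: cmeasM|move=> t; exact: rem_le].
have eI n : I (fun t => (1 - Q.[expi t])^-1) - (1 - Q`_0)^-1 =
    I (fun t => Q.[expi t] ^+ n * (1 - Q.[expi t])^-1) - Q`_0 ^+ n * (1 - Q`_0)^-1.
  have -> : I (fun t => (1 - Q.[expi t])^-1) = \sum_(k < n) Q`_0 ^+ k +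
      I (fun t => Q.[expi t] ^+ n * (1 - Q.[expi t])^-1).
    rewrite (_ : (fun t => _) = (fun t => (\sum_(k < n) Q ^+ k).[expi t] +
        Q.[expi t] ^+ n * (1 - Q.[expi t])^-1)); last first.
      apply/funext => t; rewrite {1}(geometric_sum n (neq1 _ (Qr t))); congr (_ + _).
      by rewrite horner_sum; apply: eq_bigr => k _; rewrite horner_exp.
    rewrite circle_intD//; last exact: ci_horner.
    congr (_ + _); rewrite circle_int_horner -horner_coef0 horner_sum.
    by apply: eq_bigr => k _; rewrite horner_exp horner_coef0.
  by rewrite {1}(geometric_sum n (neq1 _ Q0r)); ring.
apply/eqP; rewrite -subr_eq0; apply/eqP/cabs_eq0.
apply/le_anti; rewrite cabs_ge0 andbT.
(* One remainder at the constant coefficient, and one under the integral, counted twice because of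
   the factor in [cabs_circle_int]. *)
have lim0 : 3 * (r ^+ n / (1 - r)) @[n --> \oo] --> 3 * (0 / (1 - r)).
  apply: cvgM; first exact: cvg_cst.
  apply: cvgM; last exact: cvg_cst.
  by apply: cvg_expr; rewrite ger0_norm.
rewrite mul0r mulr0 in lim0.
rewrite -(cvg_lim (@Rhausdorff R) lim0); apply: limr_ge; first by apply/cvg_ex; eexists; exact: lim0.
apply: nearW => n; rewrite (eI n); apply: le_trans (cabsB _ _) _.
have h1 := rem_le _ n Q0r.
have h2 := cabs_circle_int (cR n).
have h3 : mean (fun t => cabs (Q.[expi t] ^+ n * (1 - Q.[expi t])^-1)) <= r ^+ n / (1 - r).
  rewrite -[leRHS](mean_cst (R := R)); apply: mean_le.
  - by have [] := cR n.
  - exact: ig_cst.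
  - by move=> t; exact: rem_le.
by move: h1 h2 h3; lra.
Qed.

Lemma resolvent_bound (s : R) (z : R[i]) : 0 < s -> 0 <= complex.Re z ->
  cabs (z + s%:C)^-1 <= s^-1.
Proof.
move=> s0 z0; have h : s <= cabs (z + s%:C).
  apply: le_trans (le_Re_cabs _); rewrite cReD /=.
  by apply: le_trans (ler_norm _); rewrite lerDr.
by rewrite cabsV lef_pV2 ?posrE//; exact: lt_le_trans h.
Qed.

(** * The resolvent of an analytic polynomial with nonnegative real part *)

Section Resolvent.
Variables (P : {poly R[i]}).
Hypotheses (P_re : forall t, 0 <= complex.Re P.[expi t]) (P0_real : complex.Im P`_0 = 0).

Lemma constant_coef_re : complex.Re P`_0 = mean (fun t => complex.Re P.[expi t]).
Proof. by rewrite -circle_int_horner. Qed.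

Lemma constant_coef_ge0 : 0 <= complex.Re P`_0.
Proof. by rewrite constant_coef_re mean_ge0. Qed.

(* (P + s)^-1 is c^-1 (1 - Q)^-1 with Q := (K - P) / c and c := K + s; since
   0 <= Re P, the modulus of Q stays below some r < 1 for K large, and the
   geometric series converges uniformly. *)
Lemma circle_int_resolvent (s : R) : 0 < s ->
  I (fun t => (P.[expi t] + s%:C)^-1) = (P`_0 + s%:C)^-1.
Proof.
move=> s0; have [M M0 PM] := horner_expi_bounded P.
(* Chosen so that K^2 + M^2 = K^2 + K s < (K + s)^2, which makes r < 1. *)
pose K := M ^+ 2 / s.
have K0 : 0 < K by rewrite divr_gt0// exprn_gt0.
have Ks : K * s = M ^+ 2 by rewrite /K divfK// gt_eqF.
pose c := K + s; have c0 : 0 < c by rewrite addr_gt0.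
have cC0 : c%:C != 0 :> R[i] by rewrite eqE /= negb_and gt_eqF.
pose Q := (c%:C)^-1 *: ((K%:C)%:P - P).
pose r := Num.sqrt (K ^+ 2 + M ^+ 2) / c.
have r1 : r < 1.
  rewrite /r ltr_pdivrMr// mul1r -(ltr_pXn2r (ltn0Sn 1)) ?nnegrE ?sqrtr_ge0 ?ltW//.
  rewrite sqr_sqrtr ?addr_ge0 ?sqr_ge0// /c sqrrD -Ks.
  have : 0 < s ^+ 2 by rewrite exprn_gt0.
  by have := mulr_gt0 K0 s0; rewrite mulr2n; lra.
have est (z : R[i]) : 0 <= complex.Re z -> cabs z <= M -> cabs (K%:C - z) <= Num.sqrt (K ^+ 2 + M ^+ 2).
  move=> z0 zM; rewrite -(ler_pXn2r (ltn0Sn 1)) ?nnegrE ?sqrtr_ge0 ?cabs_ge0//.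
  rewrite sqr_sqrtr ?addr_ge0 ?sqr_ge0// sqr_cabs cReD cReN cImD cImN /= add0r sqrrN.
  have : cabs z ^+ 2 <= M ^+ 2 by rewrite ler_pXn2r// ?nnegrE ?cabs_ge0 ?ltW.
  rewrite sqr_cabs; have := mulr_ge0 (ltW K0) z0.
  by rewrite sqrrB mulr2n; lra.
have QE z : Q.[z] = (c%:C)^-1 * (K%:C - P.[z]) by rewrite hornerZ hornerD hornerN hornerC.
have Qr (z : R[i]) : 0 <= complex.Re z -> cabs z <= M -> cabs ((c%:C)^-1 * (K%:C - z)) <= r.
  move=> z0 zM; rewrite cabsM cabsV cabs_real (gtr0_norm c0) mulrC /r.
  by apply: ler_wpM2r; [rewrite invr_ge0 ltW|exact: est].
have P0M : cabs P`_0 <= M.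
  rewrite cabsE P0_real expr0n addr0 sqrtr_sqr ger0_norm ?constant_coef_ge0//.
  rewrite constant_coef_re -[leRHS](mean_cst (R := R)); apply: mean_le.
  - exact/ci_Re/ci_horner.
  - exact: ig_cst.
  - by move=> t; apply: le_trans (PM t); apply: le_trans (le_Re_cabs _); exact: ler_norm.
have Q0E : Q`_0 = (c%:C)^-1 * (K%:C - P`_0) by rewrite -!horner_coef0 QE.
have := @circle_int_geometric Q r r1.
rewrite Q0E => /(_ _ (Qr _ constant_coef_ge0 P0M)) h.
have {}h := h (fun t => (_ : cabs Q.[expi t] <= r)).
have inv_eq z : (1 - (c%:C)^-1 * (K%:C - z))^-1 = c%:C * (z + s%:C)^-1 :> R[i].
  have -> : 1 - (c%:C)^-1 * (K%:C - z) = (c%:C)^-1 * (z + s%:C).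
    apply: (mulfI cC0); rewrite mulrBr !mulrA divff// !mul1r mulr1 /c rmorphD/=; ring.
  by rewrite invfM invrK.
have Qr' t : cabs Q.[expi t] <= r by rewrite QE; exact: Qr.
have cv : cmeas (fun t => (P.[expi t] + s%:C)^-1).
  by apply: cmeasV; apply: cmeasD; [exact: cmeas_horner|exact: cmeas_cst].
have cis : ci (fun t => (P.[expi t] + s%:C)^-1).
  by apply: (ci_bnd cv) => t; exact: resolvent_bound.
apply: (mulfI cC0); rewrite -inv_eq -circle_intZ//.
rewrite -(h Qr'); congr circle_int; apply/funext => t.
by rewrite -inv_eq QE.
Qed.

(* The real part of F^2 / (F + s) = F - s + s^2 / (F + s) for F = u + i v; by
   analyticity its mean is its value at the origin, which is nonnegative. *)
Definition resolvent_re (s u v : R) : R := u - s + s ^+ 2 * (u + s) / ((u + s) ^+ 2 + v ^+ 2).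

Lemma resolvent_reE (s : R) (z : R[i]) : 0 < s -> 0 <= complex.Re z ->
  resolvent_re s (complex.Re z) (complex.Im z) =
  complex.Re (z - s%:C + (s ^+ 2)%:C * (z + s%:C)^-1).
Proof.
move=> s0; case: z => u v /= u0.
have D0 : (u + s) ^+ 2 + v ^+ 2 != 0.
  by rewrite gt_eqF// ltr_wpDr ?sqr_ge0// exprn_gt0// ltr_wpDl.
by rewrite /resolvent_re !addr0 mul0r subr0 mulrA.
Qed.

Lemma mean_resolvent_re (s : R) : 0 < s ->
  ig (fun t => resolvent_re s (complex.Re P.[expi t]) (complex.Im P.[expi t])) /\
  0 <= mean (fun t => resolvent_re s (complex.Re P.[expi t]) (complex.Im P.[expi t])).
Proof.
move=> s0.
have cis : ci (fun t => (P.[expi t] + s%:C)^-1).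
  apply: (@ci_bnd _ _ s^-1) => [|t].
    by apply: cmeasV; apply: cmeasD; [exact: cmeas_horner|exact: cmeas_cst].
  exact: resolvent_bound.
have cc : ci (fun=> s%:C : R[i]) by apply: (@ci_bnd _ _ (cabs s%:C)) => //; exact: cmeas_cst.
have c1 : ci (fun t => P.[expi t] - s%:C) by apply: ciB => //; exact: ci_horner.
have c2 : ci (fun t => (s ^+ 2)%:C * (P.[expi t] + s%:C)^-1) by exact: ciZ.
have c3 := ciD c1 c2.
rewrite (_ : (fun t => _) = (fun t => complex.Re (P.[expi t] - s%:C + (s ^+ 2)%:C * (P.[expi t] + s%:C)^-1))); last first.
  by apply/funext => t; rewrite resolvent_reE.
split; first exact: ci_Re.
have -> : mean (fun t => complex.Re (P.[expi t] - s%:C + (s ^+ 2)%:C * (P.[expi t] + s%:C)^-1)) =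
    complex.Re (I (fun t => P.[expi t] - s%:C + (s ^+ 2)%:C * (P.[expi t] + s%:C)^-1)) by [].
rewrite circle_intD// circle_intB//; last exact: ci_horner.
rewrite circle_int_cst circle_intZ// circle_int_resolvent// circle_int_horner.
have c0 := constant_coef_ge0; move: P0_real c0; case: (P`_0) => x y /= -> x0.
have xs : 0 < x + s by rewrite ltr_wpDl.
rewrite !addr0 mul0r subr0 expr0n addr0.
have -> : x - s + s ^+ 2 * ((x + s) / (x + s) ^+ 2) = x ^+ 2 / (x + s).
  by field; rewrite gt_eqF.
by rewrite divr_ge0 ?sqr_ge0// ltW.
Qed.

(** With D = |F + s|^2 the real part of F^2 / (F + s) is (u^2 (u + s) + u v^2) / D - s v^2 / D: an
    error carrying a factor u, and a gain that measures [v]. *)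
Lemma resolvent_re_upper (s u v w : R) : 0 < s -> 0 <= u -> u <= w -> `|v| <= w ->
  resolvent_re s u v <= 2 * u * Num.min 1 (w / s) - s * v ^+ 2 / ((u + s) ^+ 2 + v ^+ 2).
Proof.
move=> s0 u0 uw vw; have us : 0 < u + s by rewrite ltr_wpDl.
set D := (u + s) ^+ 2 + v ^+ 2.
have D0 : 0 < D by rewrite ltr_wpDr ?sqr_ge0// exprn_gt0.
have w0 : 0 <= w := le_trans u0 uw.
have -> : resolvent_re s u v = (u ^+ 2 * (u + s) + v ^+ 2 * u) / D - s * v ^+ 2 / D.
  have Dn : D != 0 by rewrite gt_eqF.
  rewrite /resolvent_re -/D; apply: (mulIf Dn).
  by rewrite [LHS]mulrDl [RHS]mulrBl !divfK// /D; ring.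
rewrite lerD2r ler_pdivrMr//.
have v2 : `|v| ^+ 2 = v ^+ 2 by rewrite real_normK ?num_real.
have [ws|sw] := leP 1 (w / s).
  rewrite mulr1 /D; have := mulr_ge0 u0 (sqr_ge0 v).
  have := mulr_ge0 u0 (mulr_ge0 u0 u0); have := mulr_ge0 u0 (mulr_ge0 u0 (ltW s0)).
  have := mulr_ge0 u0 (sqr_ge0 s).
  by rewrite !expr2; lra.
have : (u ^+ 2 * (u + s) + v ^+ 2 * u) * s <= 2 * u * w * D.
  rewrite -subr_ge0.
  have -> : 2 * u * w * D - (u ^+ 2 * (u + s) + v ^+ 2 * u) * s =
      u * (2 * w * D - (u * (u + s) + v ^+ 2) * s) by ring.
  apply: mulr_ge0 => //; rewrite subr_ge0.
  have h1 : u * (u + s) * s <= w * (u + s) ^+ 2.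
    rewrite expr2 -!mulrA; apply: ler_pM => //; first by rewrite mulr_ge0// ltW.
    by rewrite ler_pM2l// lerDr.
  have h2 : v ^+ 2 * s <= w * ((u + s) ^+ 2 + v ^+ 2).
    rewrite -v2 expr2 -mulrA; apply: ler_pM => //; first by rewrite mulr_ge0// ltW.
    have : 0 <= (`|v| - s) ^+ 2 by exact: sqr_ge0.
    have := mulr_ge0 (normr_ge0 v) (ltW s0); have := mulr_ge0 u0 (ltW s0); have := mulr_ge0 u0 u0.
    by rewrite !expr2; lra.
  have h3 : 0 <= w * v ^+ 2 by rewrite mulr_ge0 ?sqr_ge0.
  by rewrite /D; move: h1 h2 h3; lra.
by rewrite -ler_pdivlMr//; congr (_ <= _); field; rewrite gt_eqF.
Qed.

(** At a scale comparable to |v| one has u + s <= 3 |v|, so the denominator is at most 10 v^2. *)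
Lemma resolvent_gain (s u v : R) : 0 < s -> 0 <= u -> u <= `|v| -> `|v| <= s -> s <= 2 * `|v| ->
  s / 10 <= s * v ^+ 2 / ((u + s) ^+ 2 + v ^+ 2).
Proof.
move=> s0 u0 uv vs sv; have us : 0 < u + s by rewrite ltr_wpDl.
have D0 : 0 < (u + s) ^+ 2 + v ^+ 2 by rewrite ltr_wpDr ?sqr_ge0// exprn_gt0.
rewrite -mulrA ler_pM2l// ler_pdivlMr// mulrC ler_pdivrMr//.
have v2 : `|v| ^+ 2 = v ^+ 2 by rewrite real_normK ?num_real.
have h : (u + s) ^+ 2 <= (3 * `|v|) ^+ 2.
  by rewrite ler_pXn2r ?nnegrE ?mulr_ge0 ?(ltW us)//; lra.
by move: h; rewrite exprMn v2; lra.
Qed.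

End Resolvent.

(** * Sums over dyadic scales *)

Section DyadicSum.
Variables (a : R) (d w : R).
Hypotheses (a0 : 0 < a) (a1 : a < 1) (d0 : 0 < d) (w0 : 0 < w).

Definition dyadic (k : nat) : R := d * 2 ^+ k.

Lemma dyadic_gt0 k : 0 < dyadic k.
Proof. by rewrite mulr_gt0// exprn_gt0. Qed.

Lemma dyadicS k : dyadic k.+1 = 2 * dyadic k.
Proof. by rewrite /dyadic exprS mulrCA. Qed.

Lemma dyadic_powS k : dyadic k.+1 `^ a = 2 `^ a * dyadic k `^ a.
Proof. by rewrite dyadicS powRM ?ltW ?dyadic_gt0. Qed.

Lemma pow2_gt1 : 1 < 2 `^ a.
Proof.
have : 1 `^ a < 2 `^ a by apply: gt0_ltr_powR; rewrite ?nnegrE ?ltr1n.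
by rewrite powR1.
Qed.

Lemma pow2_lt2 : 2 `^ a < 2.
Proof.
have h : 1 < 2 `^ (1 - a).
  have a1' : 0 < 1 - a by rewrite subr_gt0.
  have : 1 `^ (1 - a) < 2 `^ (1 - a) by apply: gt0_ltr_powR; rewrite ?nnegrE ?ltr1n.
  by rewrite powR1.
have e : 2 `^ a * 2 `^ (1 - a) = 2 :> R.
  by rewrite -powRD ?subrKC ?powRr1// pnatr_eq0 implybT.
by rewrite -[X in _ < X]e ltr_pMr// powR_gt0.
Qed.

Let A : R := 2 `^ a.

(** A geometric sum of ratio 2^a > 1 is controlled by its last term; here a > 0 enters. *)
Lemma dyadic_head n : \sum_(k < n.+1) dyadic k `^ a <= A / (A - 1) * dyadic n `^ a.
Proof.
have A1 : 0 < A - 1 by rewrite subr_gt0; exact: pow2_gt1.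
elim: n => [|n ih].
  rewrite big_ord1 ler_peMl ?powR_ge0// ler_pdivlMr// mul1r.
  by rewrite gerBl.
rewrite big_ord_recr/=; apply: le_trans (lerD ih (lexx _)) _.
rewrite dyadic_powS -/A le_eqVlt; apply/orP; left; apply/eqP.
by field; rewrite gt_eqF.
Qed.

Lemma dyadic_low n : \sum_(k < n) (if dyadic k <= w then dyadic k `^ a else 0) <= A / (A - 1) * w `^ a.
Proof.
have A1 : 0 < A - 1 by rewrite subr_gt0; exact: pow2_gt1.
have AA : 0 <= A / (A - 1) by rewrite divr_ge0 ?powR_ge0// ltW.
elim: n => [|n ih]; first by rewrite big_ord0 mulr_ge0 ?powR_ge0.
rewrite big_ord_recr/=; case: ifP => [nw|_]; last by rewrite addr0.
apply: (@le_trans _ _ (A / (A - 1) * dyadic n `^ a)); last first.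
  by apply: ler_wpM2l => //; apply: le_powR => //; rewrite ltW ?dyadic_gt0.
apply: le_trans (dyadic_head n); rewrite [leRHS]big_ord_recr/= lerD2r.
by apply: ler_sum => k _; case: ifP => // _; exact: powR_ge0.
Qed.

(** Above [w] the terms decrease with ratio 2^a / 2 < 1, since a < 1, and the first of them is at
    most w^a / w. *)
Lemma dyadic_high n : \sum_(k < n) (if w < dyadic k then dyadic k `^ a / dyadic k else 0) <=
  2 / (2 - A) * (w `^ a / w).
Proof.
have A2 : 0 < 2 - A by rewrite subr_gt0; exact: pow2_lt2.
have C0 : 0 <= 2 / (2 - A) by rewrite divr_ge0// ltW.
have ww : 0 <= w `^ a / w by rewrite divr_ge0 ?powR_ge0// ltW.
pose t k := dyadic k `^ a / dyadic k.
have t0 k : 0 <= t k by rewrite divr_ge0 ?powR_ge0// ltW ?dyadic_gt0.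
have tS k : t k.+1 = A / 2 * t k.
  by rewrite /t dyadic_powS dyadicS -/A; field; rewrite gt_eqF ?dyadic_gt0.
have tw k : w < dyadic k -> t k <= w `^ a / w.
  move=> wk; rewrite /t ler_pdivrMr ?dyadic_gt0//.
  have e x : 0 < x -> x = x `^ a * x `^ (1 - a).
    move=> x0; rewrite -powRD ?subrKC ?powRr1 ?ltW//.
    by rewrite gt_eqF ?implybT.
  have h : w `^ (1 - a) <= dyadic k `^ (1 - a).
    by apply: le_powR; rewrite ?subr_gt0// ltW.
  rewrite mulrAC ler_pdivlMr// {1}(e w w0) {2}(e _ (dyadic_gt0 k)).
  have : 0 <= w `^ a * dyadic k `^ a * (dyadic k `^ (1 - a) - w `^ (1 - a)).
    by rewrite !mulr_ge0 ?powR_ge0// subr_ge0.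
  by lra.
(* The induction carries along the whole tail 2 / (2 - A) t n of the geometric series still to come:
   each new term is paid out of it. The first clause says that nothing has been summed before [w] is
   passed. *)
suff : (dyadic n <= w -> \sum_(k < n) (if w < dyadic k then t k else 0) = 0) /\
    \sum_(k < n) (if w < dyadic k then t k else 0) +
      (if w < dyadic n then 2 / (2 - A) * t n else 0) <= 2 / (2 - A) * (w `^ a / w).
  move=> [_]; apply: le_trans; rewrite lerDl; case: ifP => // _.
  exact: mulr_ge0.
elim: n => [|n [ih1 ih2]].
  rewrite big_ord0 add0r; split => //; case: ifP => h; last exact: mulr_ge0.
  by apply: ler_wpM2l => //; exact: tw.
rewrite big_ord_recr/=; have nS : dyadic n <= dyadic n.+1.
  by rewrite dyadicS ler_peMl ?ltW ?dyadic_gt0// ltr1n.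
have [wn|wn] := ltP w (dyadic n).
  split; first by move=> h; have := le_trans nS h; rewrite leNgt wn.
  rewrite (lt_le_trans wn nS); move: ih2; rewrite wn tS.
  have -> : 2 / (2 - A) * (A / 2 * t n) = 2 / (2 - A) * t n - t n.
    by field; rewrite gt_eqF.
  by lra.
rewrite ih1// !addr0 add0r; split => //; case: ifP => h; last exact: mulr_ge0.
by apply: ler_wpM2l => //; exact: tw.
Qed.

Definition dyadic_const : R := A / (A - 1) + 2 / (2 - A).

Lemma dyadic_const_gt0 : 0 < dyadic_const.
Proof.
have A1 : 0 < A - 1 by rewrite subr_gt0; exact: pow2_gt1.
have A2 : 0 < 2 - A by rewrite subr_gt0; exact: pow2_lt2.
by rewrite addr_gt0// divr_gt0// powR_gt0.
Qed.

(* A discrete form of int_0^oo s^(a - 1) min(1, w / s) ds = w^a / (a (1 - a)). *)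
Lemma dyadic_sum n :
  \sum_(k < n) dyadic k `^ a * Num.min 1 (w / dyadic k) <= dyadic_const * w `^ a.
Proof.
apply: (@le_trans _ _ (\sum_(k < n) (if dyadic k <= w then dyadic k `^ a else 0) +
    w * \sum_(k < n) (if w < dyadic k then dyadic k `^ a / dyadic k else 0))).
  rewrite mulr_sumr -big_split/=; apply: ler_sum => k _.
  have [kw|kw] := leP (dyadic k) w.
    rewrite mulr0 addr0 ler_piMr ?powR_ge0//.
    by rewrite ge_min lexx.
  rewrite add0r mulrCA ler_wpM2l ?powR_ge0//.
  by rewrite ge_min lexx orbT.
rewrite /dyadic_const mulrDl; apply: lerD; first exact: dyadic_low.
apply: le_trans (ler_wpM2l (ltW w0) (dyadic_high n)) _.
by rewrite le_eqVlt; apply/orP; left; apply/eqP; field; rewrite gt_eqF ?subr_gt0 ?pow2_lt2// gt_eqF.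
Qed.

End DyadicSum.

Lemma dyadic_sum_ge0 (a d w : R) n : 0 < a -> a < 1 -> 0 < d -> 0 <= w ->
  \sum_(k < n) dyadic d k `^ a * Num.min 1 (w / dyadic d k) <= dyadic_const a * w `^ a.
Proof.
move=> a0 a1 d0; rewrite le_eqVlt => /predU1P[<-|w0]; last exact: dyadic_sum.
rewrite big1 ?mulr_ge0 ?powR_ge0// ?(ltW (dyadic_const_gt0 a0 a1))// => k _.
by rewrite mul0r min_r// mulr0.
Qed.

(** The least scale not below [x]: its predecessor is below [x], and if there is none the scale is
    [d], which is at most [x]. *)
Lemma dyadic_locate (d x : R) n : 0 < d -> d <= x -> x <= dyadic d n ->
  exists2 k : 'I_n.+1, x <= dyadic d k & dyadic d k <= 2 * x.
Proof.
move=> d0 dx xn; have x0 : 0 < x := lt_le_trans d0 dx.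
have ex : exists k, (x <= dyadic d k) by exists n.
have [k xk kmin] := ex_minnP ex.
have kn : (k < n.+1)%N by rewrite ltnS; exact: kmin.
exists (Ordinal kn) => //=; case: k xk kmin {kn} => [|k] xk kmin.
  rewrite /dyadic expr0 mulr1; apply: le_trans dx _.
  by rewrite ler_peMl ?ltW// ltr1n.
rewrite dyadicS ler_pM2l//; rewrite leNgt; apply/negP => /ltW/kmin.
by rewrite ltnn.
Qed.

(* The dyadic scale s nearest to |v| contributes the gain |v|^p; the remaining
   error u max(u, |v|)^(p - 1) is absorbed by Young's inequality. *)
Lemma conjugate_pointwise (p d u v : R) n : 1 < p -> p < 2 -> 0 < d -> 0 <= u ->
  `|v| <= dyadic d n ->
  Num.max u `|v| `^ p <= u `^ p + d `^ p +
    20 * dyadic_const (p - 1) * (u * Num.max u `|v| `^ (p - 1)) -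
    10 * \sum_(k < n.+1) dyadic d k `^ (p - 1) * resolvent_re (dyadic d k) u v.
Proof.
move=> p1 p2 d0 u0 vn; set w := Num.max u `|v|.
have p0 : 0 < p := lt_trans ltr01 p1.
have a0 : 0 < p - 1 by rewrite subr_gt0.
have a1 : p - 1 < 1 by rewrite ltrBlDr.
have uw : u <= w by rewrite le_max lexx.
have vw : `|v| <= w by rewrite le_max lexx orbT.
have w0 : 0 <= w := le_trans u0 uw.
pose B k := dyadic d k * v ^+ 2 / ((u + dyadic d k) ^+ 2 + v ^+ 2).
have dk k : 0 < dyadic d k by exact: dyadic_gt0.
have B0 k : 0 <= B k.
  by rewrite /B divr_ge0 ?addr_ge0 ?sqr_ge0// mulr_ge0 ?sqr_ge0// ltW.
have h1 : \sum_(k < n.+1) dyadic d k `^ (p - 1) * resolvent_re (dyadic d k) u v <=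
    2 * u * (dyadic_const (p - 1) * w `^ (p - 1)) - \sum_(k < n.+1) dyadic d k `^ (p - 1) * B k.
  have h := dyadic_sum_ge0 n.+1 a0 a1 d0 w0.
  have u2 : 0 <= 2 * u by rewrite mulr_ge0.
  rewrite lerBrDr; apply: le_trans (ler_wpM2l u2 h).
  rewrite mulr_sumr -big_split/=; apply: ler_sum => k _.
  rewrite -mulrDr mulrCA; apply: ler_wpM2l; first exact: powR_ge0.
  by rewrite -lerBrDr; exact: resolvent_re_upper.
have h2 : w `^ p <= u `^ p + d `^ p + 10 * \sum_(k < n.+1) dyadic d k `^ (p - 1) * B k.
  have S0 : 0 <= 10 * \sum_(k < n.+1) dyadic d k `^ (p - 1) * B k.
    by rewrite mulr_ge0// sumr_ge0// => k _; rewrite mulr_ge0 ?powR_ge0.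
  have up0 := powR_ge0 u p; have dp0 := powR_ge0 d p.
  (* Only |v| above both [u] and the smallest scale [d] needs the gain; otherwise w^p is at most u^p
     or d^p. *)
  have [vu|uv] := leP `|v| u.
    by rewrite /w max_l// -addrA lerDl addr_ge0.
  have wv : w = `|v| by rewrite /w max_r// ltW.
  have [vd|dv] := ltP `|v| d.
    have : w `^ p <= d `^ p by apply: le_powR => //; rewrite wv ltW.
    by lra.
  have [k vk kv] := dyadic_locate d0 dv vn.
  have gain := resolvent_gain (dk k) u0 (ltW uv) vk kv.
  have : w `^ p <= 10 * (dyadic d k `^ (p - 1) * B k).
    apply: (@le_trans _ _ (dyadic d k `^ p)); first by apply: le_powR; rewrite // wv.
    rewrite -(mulr_powRB1 (ltW (dk k)) p0).
    have hg : dyadic d k <= 10 * B k by rewrite -ler_pdivrMl// mulrC.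
    have := ler_wpM2r (powR_ge0 (dyadic d k) (p - 1)) hg.
    by rewrite -[X in _ <= X -> _]mulrA [B k * _]mulrC.
  have : dyadic d k `^ (p - 1) * B k <= \sum_(k < n.+1) dyadic d k `^ (p - 1) * B k.
    rewrite (bigD1 k)//= lerDl sumr_ge0// => j _.
    by rewrite mulr_ge0 ?powR_ge0.
  by lra.
have e : 20 * dyadic_const (p - 1) * (u * w `^ (p - 1)) =
   10 * (2 * u * (dyadic_const (p - 1) * w `^ (p - 1))) by ring.
by rewrite e; lra.
Qed.

(** If u <= e w the first term suffices; otherwise w < u / e and the second one does. *)
Lemma young_absorb (p e u w : R) : 1 < p -> 0 < e -> 0 <= u -> 0 <= w ->
  u * w `^ (p - 1) <= e * w `^ p + e `^ (1 - p) * u `^ p.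
Proof.
move=> p1 e0 u0 w0; have p0 : 0 < p := lt_trans ltr01 p1.
have a0 : 0 < p - 1 by rewrite subr_gt0.
have [ue|eu] := leP u (e * w).
  apply: (@le_trans _ _ (e * w `^ p)); last by rewrite lerDl mulr_ge0 ?powR_ge0.
  by rewrite -(mulr_powRB1 w0 p0) mulrA ler_wpM2r// powR_ge0.
apply: (@le_trans _ _ (e `^ (1 - p) * u `^ p)); last by rewrite lerDr mulr_ge0 ?powR_ge0// ltW.
rewrite -(mulr_powRB1 u0 p0) mulrCA; apply: ler_wpM2l => //.
have -> : 1 - p = - (p - 1) by ring.
rewrite powRN mulrC ler_pdivlMr ?powR_gt0//.
rewrite -powRM// ?(ltW e0)//.
by apply: le_powR => //; [rewrite mulr_ge0// ltW|rewrite mulrC ltW].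
Qed.

Theorem conjugate_bound (p : R) : 1 < p -> p < 2 -> exists2 C : R, 0 < C &
  forall P : {poly R[i]}, (forall t, 0 <= complex.Re P.[expi t]) -> complex.Im P`_0 = 0 ->
  nrm p (fun t => P.[expi t]) <= C * nrm p (fun t => (complex.Re P.[expi t])%:C).
Proof.
move=> p1 p2; have p0 : 0 < p := lt_trans ltr01 p1.
have a0 : 0 < p - 1 by rewrite subr_gt0.
have a1 : p - 1 < 1 by rewrite ltrBlDr.
set D := dyadic_const (p - 1).
have D0 : 0 < D by exact: dyadic_const_gt0.
(* With this choice 20 D e = 1/2: half of w^p is absorbed on the left, and the factor 2 in C' comes
   from dividing by the other half. *)
pose e := (40 * D)^-1; have e0 : 0 < e by rewrite invr_gt0 mulr_gt0.
pose C' := 2 * (1 + 20 * D * e `^ (1 - p)).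
have C'0 : 0 < C'.
  by rewrite mulr_gt0// ltr_pwDl// !mulr_ge0 ?powR_ge0// ltW.
exists (2 * C' `^ p^-1); first by rewrite mulr_gt0// powR_gt0.
move=> P P_re P0_im; have [M M0 PM] := horner_expi_bounded P.
pose u t := complex.Re P.[expi t]; pose v t := complex.Im P.[expi t].
pose w t := Num.max (u t) `|v t|.
have [mu_ mv] := cmeas_horner P.
have mw : mfun w by apply: measurable_maxr => //; exact: measurableT_comp.
have uM t : u t <= M by apply: le_trans (PM t); apply: le_trans (le_Re_cabs _); exact: ler_norm.
have u0 t : 0 <= u t by exact: P_re.
have vM t : `|v t| <= M by apply: le_trans (PM t); exact: le_Im_cabs.
have w0 t : 0 <= w t by rewrite le_max P_re.
have wM t : w t <= M by rewrite ge_max uM vM.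
have lu : lp p (fun t => (u t)%:C).
  apply: (@lp_bnd _ _ _ M p0 (cmeas_real mu_)) => t.
  by rewrite cabs_real (ger0_norm (u0 t)); exact: uM.
have lw : lp p (fun t => (w t)%:C).
  by apply: (@lp_bnd _ _ _ M p0 (cmeas_real mw)) => t; rewrite cabs_real ger0_norm.
have iup : ig (fun t => u t `^ p).
  have /lpP[//|_] := lu; congr summable_on_circle; apply/funext => t.
  by rewrite cabs_real ger0_norm.
have iwp : ig (fun t => w t `^ p).
  have /lpP[//|_] := lw; congr summable_on_circle; apply/funext => t.
  by rewrite cabs_real ger0_norm.
(* [d] is the finest scale and [n] is such that the scales reach [M]; the constant depends on
   neither, so that [d] can be sent to 0 afterwards. *)
have main d : 0 < d -> mean (fun t => w t `^ p) <= C' * mean (fun t => u t `^ p) + 2 * d `^ p.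
  move=> d0.
  have [n Mn] : exists n, M <= dyadic d n.
    exists (Num.truncn (M / d)).+1; rewrite /dyadic mulrC -ler_pdivrMr//.
    apply: le_trans (ltW (truncnS_gt _)) _.
    by rewrite -natrX ler_nat ltnW// ltn_expl.
  pose X k t := resolvent_re (dyadic d k) (u t) (v t).
  have dk k : 0 < dyadic d k by exact: dyadic_gt0.
  have iX k : ig (fun t => dyadic d k `^ (p - 1) * X k t).
    by apply: igZ; have [] := mean_resolvent_re P_re P0_im (dk k).
  have X0 k : 0 <= mean (fun t => dyadic d k `^ (p - 1) * X k t).
    have [h1 h2] := mean_resolvent_re P_re P0_im (dk k).
    by rewrite meanZ// mulr_ge0 ?powR_ge0.
  (* The resolvent sum enters with a minus sign and has nonnegative mean, so it disappears upon
     integration. *)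
  have pw t : w t `^ p <= C' * u t `^ p + 2 * d `^ p -
      20 * \sum_(k < n.+1) dyadic d k `^ (p - 1) * X k t.
    have h1 := conjugate_pointwise p1 p2 d0 (P_re t) (le_trans (vM t) Mn).
    have h2 := young_absorb p1 e0 (P_re t) (w0 t).
    have h3 : 20 * D * (u t * w t `^ (p - 1)) <= 2^-1 * w t `^ p + 20 * D * e `^ (1 - p) * u t `^ p.
      have D20 : 0 <= 20 * D by rewrite mulr_ge0// ltW.
      apply: le_trans (ler_wpM2l D20 h2) _; rewrite mulrDr !mulrA lerD2r.
      by rewrite /e le_eqVlt; apply/orP; left; apply/eqP; field; rewrite gt_eqF.
    rewrite -/(u t) -/(v t) -/(w t) -/D in h1.
    rewrite /C'; move: h1 h3; rewrite -/(X _ _); move: (\sum_(_ < _) _) (w t `^ p) => S W.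
    by lra.
  have iS : ig (fun t => \sum_(k < n.+1) dyadic d k `^ (p - 1) * X k t) by exact: ig_sum.
  have iR : ig (fun t => C' * u t `^ p + 2 * d `^ p) by apply: igD; [exact: igZ|exact: ig_cst].
  have h := mean_le iwp (igB iR (igZ 20 iS)) pw.
  apply: le_trans h _; rewrite meanB//; last exact: igZ.
  rewrite meanD ?mean_cst; [|exact: igZ|exact: ig_cst].
  rewrite !meanZ// gerBl mulr_ge0// mean_sum//.
  by apply: sumr_ge0 => k _; exact: X0.
have {}main : mean (fun t => w t `^ p) <= C' * mean (fun t => u t `^ p).
  apply/ler_addgt0Pr => eps eps0.
  have e20 : 0 < eps / 2 by rewrite divr_gt0.
  have h := main _ (powR_gt0 p^-1 e20); rewrite -powRrM mulVf ?gt_eqF// powRr1 in h; last exact: ltW.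
  by apply: le_trans h _; rewrite mulrCA mulfV ?mulr1.
have lP : lp p (fun t => P.[expi t]) by apply: (@lp_bnd _ _ _ M) => //; exact: cmeas_horner.
have lw2 : lp p (fun t => 2 * (w t)%:C) by exact: lpZ.
apply: (@le_trans _ _ (nrm p (fun t => 2 * (w t)%:C))).
  apply: nrm_le => // t; rewrite cabsM cabs_real cabs2 ger0_norm//.
  apply: le_trans (cabs_le _) _; rewrite mulrDl mul1r; apply: lerD.
    by rewrite ger0_norm// le_max lexx.
  by rewrite le_max lexx orbT.
rewrite nrmZ// cabs2 -mulrA ler_pM2l//.
apply: nrm_le_of_mean => //; first by rewrite mulr_ge0 ?powR_ge0 ?nrm_ge0.
rewrite powRM ?powR_ge0 ?nrm_ge0// -powRrM mulVf ?gt_eqF// powRr1 ?(ltW C'0)//.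
have eE (g : R -> R) : (forall t, 0 <= g t) ->
    mean (fun t => cabs (g t)%:C `^ p) = mean (fun t => g t `^ p).
  by move=> g0; congr mean; apply/funext => t; rewrite cabs_real ger0_norm.
by rewrite (nrm_powR p0 lu) (eE _ w0) (eE _ u0).
Qed.

End Conjugate.

(** * Analytic parts *)

Section RieszProjection.
Context {R : realType}.
Local Notation mfun g := (measurable_fun [set: measurableTypeR R] (g : R -> R)).
Local Notation cabs := (@Normc.normc R).
Local Notation ci := csummable_on_circle.
Local Notation lp p := (@circle_Lp R p%:E).
Local Notation ip := (@inner_prod R).
Local Notation fc := (@fourier_coef R).
Local Notation H2 := (@Hardy R 2%:E).
Implicit Types (f g h : R -> R[i]) (p q : R).

Lemma fc_ci f n : ci f -> ci (fun t => f t * expi t ^ (- n)).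
Proof.
move=> cf; apply: (@ciM_bnd _ _ _ 1) => // [|t]; first exact: cmeas_expiX.
by rewrite expiXz cabs_expi.
Qed.

Lemma fcD f g n : ci f -> ci g -> fc (fun t => f t + g t) n = fc f n + fc g n.
Proof.
move=> cf cg; rewrite /fourier_coef -circle_intD; try exact: fc_ci.
by congr circle_int; apply/funext => t; rewrite mulrDl.
Qed.

Lemma fcZ c f n : ci f -> fc (fun t => c * f t) n = c * fc f n.
Proof.
move=> cf; rewrite /fourier_coef -circle_intZ; last exact: fc_ci.
by congr circle_int; apply/funext => t; rewrite mulrA.
Qed.

Lemma fcB f g n : ci f -> ci g -> fc (fun t => f t - g t) n = fc f n - fc g n.
Proof.
move=> cf cg; rewrite /fourier_coef -circle_intB; try exact: fc_ci.
by congr circle_int; apply/funext => t; rewrite mulrBl.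
Qed.

Lemma fc_ae f g n : ci f -> cmeas g -> circle_ae_eq f g -> fc f n = fc g n.
Proof.
move=> [mf _] mg fg; apply: circle_int_ae.
- by apply: cmeasM => //; exact: cmeas_expiX.
- by apply: cmeasM => //; exact: cmeas_expiX.
- by apply: (aeS _ fg) => t ->.
Qed.

Lemma expi_conj (t : R) (n : int) : (expi t ^ n)^* = expi t ^ (- n).
Proof. by rewrite !expiXz -expiN; congr expi; rewrite mulrNz mulNr. Qed.

Lemma fcJ f n : ci f -> fc (fun t => (f t)^*) n = (fc f (- n))^*.
Proof.
move=> cf; rewrite /fourier_coef -circle_intJ; last exact: fc_ci.
by congr circle_int; apply/funext => t; rewrite conjM expi_conj opprK.
Qed.

Lemma cabs_fc p f n : 1 <= p -> lp p f -> cabs (fc f n) <= 2 * nrm p f.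
Proof.
move=> p1 fp; have [cf h] := lp_mean_abs p1 fp.
apply: le_trans (cabs_circle_int (fc_ci n cf)) _; rewrite ler_pM2l//.
by apply: le_trans h; under eq_fun do rewrite cabsM expiXz cabs_expi mulr1.
Qed.

Lemma cabs_eps0 (z : R[i]) : (forall e, 0 < e -> cabs z <= e) -> z = 0.
Proof.
move=> ze; apply: cabs_eq0; apply/le_anti; rewrite cabs_ge0 andbT.
by apply/ler_addgt0Pr => e e0; rewrite add0r; exact: ze.
Qed.

Lemma fc_lim p (F : nat -> R -> R[i]) f n c : 1 <= p -> (forall k, lp p (F k)) -> lp p f ->
  lp_cvg p F f -> (forall k, fc (F k) n = c) -> fc f n = c.
Proof.
move=> p1 Fp fp Ff Fc; apply/eqP; rewrite -subr_eq0; apply/eqP/cabs_eps0 => e e0.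
have e20 : 0 < e / 2 by rewrite divr_gt0.
have [N /(_ N (leqnn _)) h] := (lp_cvgP _ _ _).1 Ff _ e20.
rewrite -(Fc N) -fcB; [|exact: lp_ci p1 fp|exact: lp_ci p1 (Fp N)].
apply: le_trans (cabs_fc _ p1 (lpB p1 fp (Fp N))) _.
by rewrite nrm_distC -ler_pdivlMl// mulrC.
Qed.

(** The Riesz projection described by coefficients alone. It makes sense for all integrable
    functions, so that functions obtained in different L^p can be compared. *)
Definition is_analytic_part f g :=
  forall n : int, fc g n = if 0 <= n then fc f n else 0.

Lemma analytic_part_unique f g g' : ci g -> ci g' ->
  is_analytic_part f g -> is_analytic_part f g' -> circle_ae_eq g g'.
Proof.
move=> cg cg' fg fg'.
have h : circle_ae_eq (fun t => g t - g' t) (fun=> 0).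
  by apply: fourier_coef_unique; [exact: ciB|move=> n; rewrite fcB// fg fg' subrr].
by apply: (aeS _ h) => t /eqP; rewrite subr_eq0 => /eqP.
Qed.

Lemma analytic_part_lin a f f' g g' : ci f -> ci f' -> ci g -> ci g' ->
  is_analytic_part f g -> is_analytic_part f' g' ->
  is_analytic_part (fun t => a * f t + f' t) (fun t => a * g t + g' t).
Proof.
move=> cf cf' cg cg' fg fg' n; rewrite !fcD ?fcZ//; try exact: ciZ.
by rewrite fg fg'; case: ifP => // _; rewrite mulr0 addr0.
Qed.

Lemma analytic_part_lim p (F G : nat -> R -> R[i]) f g : 1 <= p ->
  (forall k, lp p (F k)) -> lp p f -> lp_cvg p F f ->
  (forall k, lp p (G k)) -> lp p g -> lp_cvg p G g ->
  (forall k, is_analytic_part (F k) (G k)) -> is_analytic_part f g.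
Proof.
move=> p1 Fp fp Ff Gp gp Gg FG n; case: ifP => n0; last first.
  by apply: (fc_lim p1 Gp gp Gg) => k; rewrite FG n0.
apply/eqP; rewrite -subr_eq0; apply/eqP/cabs_eps0 => e e0.
have e40 : 0 < e / 4 by rewrite divr_gt0.
have [N1 h1] := (lp_cvgP _ _ _).1 Ff _ e40.
have [N2 h2] := (lp_cvgP _ _ _).1 Gg _ e40.
pose k := maxn N1 N2.
have := FG k n; rewrite n0 => FGk.
have -> : fc g n - fc f n = (fc g n - fc (G k) n) - (fc f n - fc (F k) n).
  by rewrite FGk; ring.
have e1 : fc g n - fc (G k) n = fc (fun t => g t - G k t) n.
  by rewrite fcB//; exact: lp_ci p1 _.
have e2 : fc f n - fc (F k) n = fc (fun t => f t - F k t) n.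
  by rewrite fcB//; exact: lp_ci p1 _.
rewrite e1 e2; apply: le_trans (cabsB _ _) _.
have := cabs_fc n p1 (lpB p1 gp (Gp k)); have := cabs_fc n p1 (lpB p1 fp (Fp k)).
rewrite !(nrm_distC _ _ (_ k)).
have := h1 k (leq_maxl _ _); have := h2 k (leq_maxr _ _).
by move: (nrm _ _) (nrm _ _) => a b; lra.
Qed.

Lemma fc_ip f n : fc f n = ip f (fun t => expi t ^ n).
Proof. by congr circle_int; apply/funext => t; rewrite expi_conj. Qed.

Lemma lp_expiX p n : 0 < p -> lp p (fun t => expi t ^ n).
Proof.
move=> p0; apply: (@lp_bnd _ _ _ 1) => //; first exact: cmeas_expiX.
by move=> t; rewrite expiXz cabs_expi.
Qed.

Lemma expi_exprzD (t : R) (m n : int) : expi t ^ m * expi t ^ n = expi t ^ (m + n).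
Proof. by rewrite !expiXz -expiD -mulrDl -intrD. Qed.

Lemma fc_expiX (m n : int) : fc (fun t => expi t ^ m) n = (m == n)%:R.
Proof.
rewrite /fourier_coef; under eq_fun do rewrite expi_exprzD.
by rewrite circle_int_expiX subr_eq0.
Qed.

Lemma Hardy_lp p f : Hardy p%:E f -> lp p f.
Proof. by case. Qed.

Lemma Hardy2_expiX (n : int) : 0 <= n -> H2 (fun t => expi t ^ n).
Proof.
move=> n0; split; first exact: lp_expiX.
by move=> m m0; rewrite fc_expiX gt_eqF// (lt_le_trans m0).
Qed.

Lemma Hardy2_closed : closed_subspace H2.
Proof.
split=> [f [] //| |a f g [fp f0] [gp g0]|F f HF fp Ff].
- split; first exact: lp_cst.
  move=> n n0; rewrite /fourier_coef; under eq_fun do rewrite mul0r.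
  by rewrite circle_int_cst.
- have afp : lp 2 (fun t => a * f t) by exact: lpZ.
  split; first exact: lp2D.
  move=> n n0; have cf := lp_ci ge1_2 fp; have cg := lp_ci ge1_2 gp.
  by rewrite fcD ?fcZ ?f0 ?g0 ?mulr0 ?addr0//; exact: ciZ.
- split => // n n0; apply: (fc_lim ge1_2 _ fp Ff) => k; have [h1 h2] := HF k => //.
  exact: h2.
Qed.

(** Pythagoras for f = (f - g) + g. *)
Lemma orthogonal_projection_nrm (V : set (R -> R[i])) f g : closed_subspace V -> lp 2 f ->
  is_orthogonal_projection V f g ->
  nrm 2 f ^+ 2 = nrm 2 (fun t => f t - g t) ^+ 2 + nrm 2 g ^+ 2.
Proof.
move=> cV fp [Vg o]; have gp := csub_L2 cV Vg.
have fgp := lp2B fp gp.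
have := sqr_nrm2_sub (-1) fgp gp; rewrite o// mulr0 (_ : complex.Re 0 = 0)// mulr0 subr0 cabsN cabs1 expr1n mul1r.
by rewrite (_ : (fun t => f t - g t - -1 * g t) = f)//; apply/funext => t; ring.
Qed.

Lemma orthogonal_projection_nrm_le (V : set (R -> R[i])) f g : closed_subspace V -> lp 2 f ->
  is_orthogonal_projection V f g -> nrm 2 g <= nrm 2 f.
Proof.
move=> cV fp o; have h := orthogonal_projection_nrm cV fp o.
rewrite -(ler_pXn2r (ltn0Sn 1)) ?nnegrE ?nrm_ge0// h lerDr.
exact: sqr_ge0.
Qed.

Lemma orthogonal_projection_unique (V : set (R -> R[i])) f g g' : closed_subspace V -> lp 2 f ->
  is_orthogonal_projection V f g -> is_orthogonal_projection V f g' -> circle_ae_eq g g'.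
Proof.
move=> cV fp [Vg o] [Vg' o']; have gp := csub_L2 cV Vg; have gp' := csub_L2 cV Vg'.
have Vd := csubB cV Vg Vg'; have dp := csub_L2 cV Vd.
have := ip_self dp.
have e : ip (fun t => g t - g' t) (fun t => g t - g' t) = 0.
  have := o _ Vd; have := o' _ Vd; have fgp := lp2B fp gp; have fgp' := lp2B fp gp'.
  rewrite (_ : (fun t => g t - g' t) = (fun t => (f t - g' t) - (f t - g t))); last first.
    by apply/funext => t; ring.
  move=> e1 e2; rewrite {1}ipBl// ?e1 ?e2 ?subrr//.
  by exact: lp2B.
rewrite e => /esym/(congr1 (@complex.Re R)) /= /eqP; rewrite sqrf_eq0 => /eqP n0.
have := nrm_eq0_ae gt0_2 dp n0.
by move=> h; apply: (aeS _ h) => t /eqP; rewrite subr_eq0 => /eqP.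
Qed.

Lemma orthogonal_projection_ae (V : set (R -> R[i])) f g g' : closed_subspace V -> lp 2 f ->
  is_orthogonal_projection V f g -> cmeas g' -> circle_ae_eq g g' ->
  is_orthogonal_projection V f g'.
Proof.
move=> cV fp [Vg o] mg' gg'; have gp := csub_L2 cV Vg.
split=> [|h Vh]; first exact: csub_ae cV Vg mg' gg'.
have hp := csub_L2 cV Vh.
rewrite -(o h Vh); apply/esym/ip_ae => //.
- exact: lp2B.
- by apply: cmeasB => //; exact: lp_cmeas fp.
- exact: lp_cmeas hp.
- by apply: (aeS _ gg') => t ->.
- by apply: aeW.
Qed.

Lemma orthogonal_projection_analytic f g : lp 2 f ->
  is_orthogonal_projection H2 f g -> is_analytic_part f g.
Proof.
move=> fp [[gp gn] o] n; case: ifP => n0; last by apply: gn; rewrite ltNge n0.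
have := o _ (Hardy2_expiX n0); rewrite -fc_ip fcB; [|exact: lp_ci ge1_2 _|exact: lp_ci ge1_2 _].
by move/eqP; rewrite subr_eq0 => /eqP.
Qed.

(** The orthogonal projection provided by L^2 theory has the same coefficients as [g], hence equals
    it almost everywhere. *)
Lemma analytic_part_orthogonal f g : lp 2 f -> ci g -> is_analytic_part f g ->
  is_orthogonal_projection H2 f g.
Proof.
move=> fp cg fg; have [g0 o] := orthogonal_projection Hardy2_closed fp.
have cg0 : ci g0 by apply: lp_ci ge1_2 _; apply: Hardy_lp; case: o.
have := analytic_part_unique cg0 cg (orthogonal_projection_analytic fp o) fg.
by apply: orthogonal_projection_ae => //; [exact: Hardy2_closed|case: cg].
Qed.

Lemma analytic_part_exists2 f : lp 2 f ->
  exists g, [/\ lp 2 g, is_analytic_part f g & nrm 2 g <= nrm 2 f].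
Proof.
move=> fp; have [g o] := orthogonal_projection Hardy2_closed fp; exists g; split.
- by apply: Hardy_lp; case: o.
- exact: orthogonal_projection_analytic.
- exact: orthogonal_projection_nrm_le Hardy2_closed fp o.
Qed.

Lemma fc_horner (P : {poly R[i]}) (n : int) :
  fc (fun t => P.[expi t]) n = if n is Posz k then P`_k else 0.
Proof.
have cF (i : 'I_(size P)) : ci (fun t => P`_i * expi t ^+ i).
  by apply: ciZ; exact: (ci_expiX i).
rewrite /fourier_coef.
rewrite (_ : (fun t => _) = (fun t => \sum_(i < size P) P`_i * expi t ^ (i%:Z - n))); last first.
  apply/funext => t; rewrite horner_coef mulr_suml; apply: eq_bigr => i _.
  by rewrite -mulrA [expi t ^+ i]exprnP expi_exprzD.
rewrite circle_int_sum; last by move=> i; apply: ciZ; exact: ci_expiX.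
rewrite (eq_bigr (fun i : 'I_(size P) => P`_i * (i%:Z == n)%:R)); last first.
  by move=> i _; rewrite circle_intZ ?circle_int_expiX ?subr_eq0//; exact: ci_expiX.
case: n => n; last by rewrite big1// => i _; rewrite mulr0.
have [nP|Pn] := ltP n (size P); last first.
  rewrite nth_default// big1// => i _; rewrite eqz_nat.
  by rewrite ltn_eqF ?mulr0// (leq_trans (ltn_ord i)).
rewrite (bigD1 (Ordinal nP))//= eqxx mulr1 big1 ?addr0// => i /eqP ni.
rewrite eqz_nat; case: eqP => [e|_]; last by rewrite mulr0.
by case: ni; apply/val_inj.
Qed.

(** * Boundedness of the analytic part on bounded functions, for 1 < p < 2 *)

Section SmallExponent.
Variable p : R.
Hypotheses (p1 : 1 < p) (p2 : p < 2).

Let p1' : 1 <= p. Proof. exact: ltW. Qed.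
Let p0 : 0 < p. Proof. exact: lt_trans p1. Qed.

Lemma analytic_part_nonneg_trig : exists2 C : R, 0 < C &
  forall h : R -> R, rtrig h -> (forall t, 0 <= h t) ->
  exists g, [/\ lp p g, is_analytic_part (fun t => (h t)%:C) g &
    nrm p g <= C * nrm p (fun t => (h t)%:C)].
Proof.
have [C C0 bnd] := conjugate_bound p1 p2.
exists (2 * C); first by rewrite mulr_gt0.
move=> h [P0 hP0] h0.
(* An imaginary constant does not change the real part; removing it makes the constant coefficient
   real. *)
pose P := P0 - (0 +i* complex.Im P0`_0)%:P.
have hP t : h t = complex.Re P.[expi t].
  by rewrite hP0 /P hornerD hornerN hornerC cReD cReN /= subr0.
have P_im : complex.Im P`_0 = 0.
  by rewrite /P coefD coefN coefC /= cImD cImN /= subrr.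
have Pre t : 0 <= complex.Re P.[expi t] by rewrite -hP.
have Pb := bnd P Pre P_im.
have hE : (fun t => (h t)%:C) = (fun t => (complex.Re P.[expi t])%:C).
  by apply/funext => t; rewrite hP.
have [M M0 PM] := horner_expi_bounded P.
have lP : lp p (fun t => P.[expi t]) by apply: (@lp_bnd _ _ _ M) => //; exact: cmeas_horner.
have lc : lp p (fun=> P`_0) by exact: lp_cst.
have cP := ci_horner P; have cc := lp_ci p1' lc.
pose g t := 2^-1 * (P.[expi t] + P`_0).
have lg : lp p g by apply: lpZ => //; exact: lpD.
exists g; split => //.
- have fc_c n : fc (fun=> P`_0) n = P`_0 * (n == 0)%:R.
    have := fcZ P`_0 n (ci_expiX (0 : int)); under eq_fun do rewrite expr0z mulr1.
    by move=> ->; rewrite fc_expiX eq_sym.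
  have hE2 : (fun t => (h t)%:C) = (fun t => 2^-1 * (P.[expi t] + (P.[expi t])^*)).
    apply/funext => t; rewrite hP; case: (P.[expi t]) => x y.
    by apply/eqP; rewrite eq_complex /=; apply/andP; split; apply/eqP; field.
  move=> n; rewrite hE2 /g !fcZ ?fcD ?fcJ ?fc_c//; try (by apply: ciD => //; exact: ciJ).
    rewrite !fc_horner; case: n => [[|n]|n] //=.
      congr (_ * (_ + _)); rewrite mulr1; move: P_im; case: (P`_0) => x y /= ->.
      by apply/eqP; rewrite eq_complex /= oppr0 !eqxx.
      by rewrite mulr0 addr0 rmorph0 addr0.
    by rewrite mulr0 addr0 mulr0.
  exact: ciJ.
- rewrite nrmZ//; last exact: lpD.
  have -> : cabs 2^-1 = 2^-1 by rewrite cabsV cabs2.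
  have c0 : cabs P`_0 <= 2 * nrm p (fun t => P.[expi t]).
    have := cabs_fc (Posz 0) p1' lP; by rewrite fc_horner.
  rewrite hE; apply: le_trans (ler_wpM2l _ (nrmD p1' lP lc)) _; first by rewrite invr_ge0.
  rewrite nrm_cst//; move: Pb c0; set a := nrm _ _; set b := nrm _ _ => Pb c0.
  have : a <= 2 * C * b by have := nrm_ge0 p (fun t => P.[expi t]); rewrite -/a; lra.
  by have := nrm_ge0 p (fun t => P.[expi t]); rewrite -/a; lra.
Qed.

Definition analytic_bound (C : R) f := exists g,
  [/\ lp p g, is_analytic_part f g & nrm p g <= C * nrm p f].

(** [f] is approximated by [h] in L^2, not in L^p: the analytic part of f - h is then small in L^2
    by orthogonal projection, hence small in L^p because p < 2. *)
Lemma analytic_bound_nonneg : exists2 C : R, 0 < C &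
  forall (f : R -> R) M, mfun f -> (forall t, 0 <= f t <= M) ->
  analytic_bound C (fun t => (f t)%:C).
Proof.
have [C C0 bnd] := analytic_part_nonneg_trig; exists C => // f M mf fM.
pose fC t := (f t)%:C.
have mfC : cmeas fC by exact: cmeas_real.
have fCM t : cabs (fC t) <= M by have /andP[f0 fM'] := fM t; rewrite cabs_real ger0_norm.
have lf2 : lp 2 fC by exact: lp_bnd fCM.
have lfp : lp p fC by exact: lp_bnd fCM.
have [g [gp2 fg _]] := analytic_part_exists2 lf2.
have gp : lp p g by apply: lp_mono gp2 => //; exact: ltW.
exists g; split => //; apply/ler_addgt0Pr => e e0.
have C10 : 0 < C + 1 by rewrite addr_gt0.
(* Replacing [f] by [h] costs C d, and the remainder costs [d]. *)
pose d := e / (C + 1); have d0 : 0 < d by rewrite divr_gt0.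
have [h [hh h0 [lh2 hd]]] := approx_nonneg ge1_2 mf fM d0.
have [k [kp hk kC]] := bnd h hh h0.
have lhp : lp p (fun t => (h t)%:C) by apply: lp_mono lh2 => //; exact: ltW.
have lfh := lp2B lf2 lh2.
have [r [rp fr rn]] := analytic_part_exists2 lfh.
have rpp : lp p r by apply: lp_mono rp => //; exact: ltW.
have cg := lp_ci p1' gp; have ck := lp_ci p1' kp; have cr := lp_ci p1' rpp.
have cfC := lp_ci p1' lfp; have chC := lp_ci p1' lhp.
have gkr : circle_ae_eq g (fun t => k t + r t).
  apply: (@analytic_part_unique fC) => //; first exact: ciD.
  move=> n; rewrite fcD// hk fr; case: ifP => // _; last by rewrite addr0.
  by rewrite fcB// addrC subrK.
have n1 : nrm p g = nrm p (fun t => k t + r t).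
  by apply: nrm_ae => //; apply: cmeasD; [case: ck|case: cr].
have n2 : nrm p r <= d.
  apply: le_trans (nrm_mono p0 (ltW p2) rp).2 _.
  exact: le_trans rn hd.
have n3 : nrm p (fun t => (h t)%:C) <= nrm p fC + d.
  have := nrm_le_dist p1' lhp lfp; rewrite nrm_distC.
  have := (nrm_mono p0 (ltW p2) lfh).2; have := hd.
  by rewrite -/fC; lra.
rewrite n1; apply: le_trans (nrmD p1' kp rpp) _.
have h4 : C * nrm p (fun t => (h t)%:C) <= C * nrm p fC + C * d.
  by rewrite -mulrDr ler_pM2l.
have h5 : C * d + d = e by rewrite /d; field; rewrite gt_eqF.
by rewrite -h5; move: kC h4 n2; lra.
Qed.

(** Positive and negative parts of the real and imaginary parts are each dominated by |f|, whence
    the factor 4. *)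
Lemma analytic_bound_bounded : exists2 C : R, 0 < C &
  forall f M, cmeas f -> (forall t, cabs (f t) <= M) -> analytic_bound C f.
Proof.
have [C C0 bnd] := analytic_bound_nonneg; exists (4 * C); first by rewrite mulr_gt0.
move=> f M mf fM; have [mr mi] := mf.
have lf : lp p f by exact: lp_bnd fM.
have part (r : R -> R) : mfun r -> (forall t, `|r t| <= cabs (f t)) ->
    exists g, [/\ lp p g, is_analytic_part (fun t => (r t)%:C) g & nrm p g <= 2 * C * nrm p f].
  move=> mr' rf.
  have half (s : R -> R) : mfun s -> (forall t, 0 <= s t) -> (forall t, s t <= `|r t|) ->
      [/\ lp p (fun t => (s t)%:C) & exists g, [/\ lp p g, is_analytic_part (fun t => (s t)%:C) g & nrm p g <= C * nrm p f]].
    move=> ms s0 sr.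
    have sf t : cabs (s t)%:C <= cabs (f t) by rewrite cabs_real ger0_norm// (le_trans (sr t)).
    have ls : lp p (fun t => (s t)%:C).
      by apply: lp_le_lp sf lf => //; exact: cmeas_real.
    split => //; have [t|g [gp sg gn]] := bnd s M ms.
      by rewrite s0 (le_trans (sr t))// (le_trans (rf t)).
    exists g; split => //; apply: le_trans gn _; rewrite ler_pM2l//.
    exact: nrm_le.
  have [] := half (fun t => Num.max (r t) 0).
  - by apply: measurable_maxr => //; exact: measurable_cst.
  - by move=> t; rewrite le_max lexx orbT.
  - by move=> t; rewrite ge_max normr_ge0 ler_norm.
  move=> l1 [g1 [g1p rg1 n1]].
  have [] := half (fun t => Num.max (- r t) 0).
  - by apply: measurable_maxr => //; exact: measurable_funN.
  - by move=> t; rewrite le_max lexx orbT.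
  - by move=> t; rewrite ge_max normr_ge0 -normrN ler_norm.
  move=> l2 [g2 [g2p rg2 n2]].
  exists (fun t => -1 * g2 t + g1 t); split.
  - by apply: lpD => //; exact: lpZ.
  - rewrite (_ : (fun t => (r t)%:C) =
      (fun t => -1 * (Num.max (- r t) 0)%:C + (Num.max (r t) 0)%:C)); last first.
      apply/funext => t; rewrite mulN1r addrC -rmorphB /=; congr (_%:C).
      have [r0|r0] := leP 0 (r t).
        by rewrite [Num.max (- _) _]max_r ?subr0// oppr_le0.
      by rewrite [Num.max (- _) _]max_l ?sub0r ?opprK// oppr_ge0 ltW.
    by apply: analytic_part_lin => //; exact: lp_ci p1' _.
  - apply: le_trans (nrmD p1' (lpZ _ p0 g2p) g1p) _.
    by rewrite nrmZ// cabsN cabs1 mul1r; lra.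
have [g1 [g1p rg1 n1]] := part _ mr (fun t => le_Re_cabs (f t)).
have [g2 [g2p rg2 n2]] := part _ mi (fun t => le_Im_cabs (f t)).
have lr : lp p (fun t => (complex.Re (f t))%:C).
  by apply: (lp_le_lp p0 (cmeas_real mr) _ lf) => t; rewrite cabs_real le_Re_cabs.
have li : lp p (fun t => (complex.Im (f t))%:C).
  by apply: (lp_le_lp p0 (cmeas_real mi) _ lf) => t; rewrite cabs_real le_Im_cabs.
exists (fun t => (0 +i* 1) * g2 t + g1 t); split.
- by apply: lpD => //; exact: lpZ.
- rewrite (_ : f = (fun t => (0 +i* 1) * (complex.Im (f t))%:C + (complex.Re (f t))%:C)); last first.
    apply/funext => t; case: (f t) => x y; apply/eqP; rewrite eq_complex /=.
    by apply/andP; split; apply/eqP; ring.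
  by apply: analytic_part_lin => //; exact: lp_ci p1' _.
- apply: le_trans (nrmD p1' (lpZ _ p0 g2p) g1p) _.
  have ci1 : cabs (0 +i* 1) = 1 by rewrite cabsE /= expr0n add0r expr1n sqrtr1.
  by rewrite nrmZ// ci1 mul1r; lra.
Qed.

End SmallExponent.

End RieszProjection.

(** * The Riesz projection *)

Section Riesz.
Context {R : realType}.
Local Notation cabs := (@Normc.normc R).
Local Notation lp p := (@circle_Lp R p%:E).
Local Notation ip := (@inner_prod R).
Implicit Types (f g h : R -> R[i]) (p q : R).

(** Large values are replaced by 0 and not rescaled, so that [f] times the conjugate of its
    truncation is the squared modulus of the truncation; the duality argument relies on this. *)
Definition trunc (c : R) f : R -> R[i] := fun t => if cabs (f t) <= c then f t else 0.

Lemma cmeas_trunc c f : cmeas f -> cmeas (trunc c f).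
Proof.
move=> mf; have mb : measurable_fun [set: measurableTypeR R] (fun t : R => cabs (f t) <= c).
  by apply: measurable_fun_ler; [exact: mfun_cabs|exact: measurable_cst].
have -> : trunc c f = fun t => ((if cabs (f t) <= c then 1 else 0 : R)%:C) * f t.
  by apply/funext => t; rewrite /trunc; case: ifP; rewrite ?mul1r ?mul0r.
apply: cmeasM mf; apply: cmeas_real.
by apply: measurable_fun_ifT => //; exact: measurable_cst.
Qed.

Lemma cabs_trunc c f t : cabs (trunc c f t) <= cabs (f t).
Proof. by rewrite /trunc; case: ifP; rewrite ?cabs0// cabs_ge0. Qed.

Lemma cabs_trunc_le c f t : 0 <= c -> cabs (trunc c f t) <= c.
Proof. by rewrite /trunc; case: ifP => //; rewrite cabs0. Qed.

Lemma lp_trunc p c f : 0 < p -> lp p f -> lp p (trunc c f).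
Proof.
move=> p0 fp; apply: (lp_le_lp p0 _ _ fp); last exact: cabs_trunc.
by apply: cmeas_trunc; exact: lp_cmeas fp.
Qed.

Lemma trunc_near f t : \forall k \near \oo, trunc k%:R f t = f t.
Proof.
exists (Num.truncn (cabs (f t))).+1 => // k /= kN; rewrite /trunc ifT//.
apply: ltW; apply: lt_le_trans (_ : (Num.truncn (cabs (f t))).+1%:R <= _); last by rewrite ler_nat.
exact: truncnS_gt.
Qed.

Lemma trunc_cvg p f : 0 < p -> lp p f -> lp_cvg p (fun k => trunc k%:R f) f.
Proof.
move=> p0 fp; have /lpP[//|mf F] := fp.
have le k t : cabs (trunc k%:R f t - f t) <= cabs (f t).
  by rewrite /trunc; case: ifP; rewrite ?subrr ?cabs0 ?cabs_ge0// sub0r cabsN.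
have md k : cmeas (fun t => trunc k%:R f t - f t) by apply: cmeasB => //; exact: cmeas_trunc.
have lpd k : lp p (fun t => trunc k%:R f t - f t) by apply: (lp_le_lp p0 _ _ fp).
pose D k t := cabs (trunc k%:R f t - f t) `^ p.
have [] := @mean_cvg_dominated R D (fun=> 0) (fun t => cabs (f t) `^ p).
- by move=> k; apply: mfun_powR; exact: mfun_cabs.
- exact: measurable_cst.
- exact: F.
- apply: aeW => t; apply: cvg_near_cst.
  near=> k; rewrite /D (_ : trunc k%:R f t = f t) ?subrr ?cabs0 ?powR0 ?gt_eqF//.
  by near: k; exact: trunc_near.
- by move=> k t; rewrite ger0_norm ?powR_ge0// le_powR// cabs_ge0.
move=> _ h; rewrite /lp_cvg.
have pV0 : 0 < p^-1 by rewrite invr_gt0.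
have := cvg_powR pV0 _ h; rewrite powR0 ?gt_eqF// => h'.
under eq_fun => k.
  rewrite nrmE//.
  rewrite (_ : mean _ = mean (fun t => `|D k t - 0|)); last first.
    by congr mean; apply/funext => t; rewrite subr0 ger0_norm ?powR_ge0.
  over.
by apply: h' => k; apply: mean_ge0 => t; exact: normr_ge0.
Unshelve. all: by end_near.
Qed.

(** [analytic_bound] only provides some analytic part of F n - F m; by uniqueness it is G n - G m
    almost everywhere. *)
Lemma analytic_part_cauchy p C (F G : nat -> R -> R[i]) : 1 <= p -> 0 <= C ->
  (forall n, lp p (F n)) -> (forall n, lp p (G n)) ->
  (forall n, is_analytic_part (F n) (G n)) ->
  (forall n m, analytic_bound p C (fun t => F n t - F m t)) ->
  forall n m, nrm p (fun t => G n t - G m t) <= C * nrm p (fun t => F n t - F m t).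
Proof.
move=> p1 C0 Fp Gp FG bd n m; have p0 : 0 < p := lt_le_trans ltr01 p1.
have [g [gp Fg gC]] := bd n m; apply: le_trans gC; rewrite le_eqVlt; apply/orP; left; apply/eqP.
have e (f g' : R -> R[i]) : (fun t => f t - g' t) = (fun t => -1 * g' t + f t).
  by apply/funext => t; rewrite mulN1r addrC.
apply: nrm_ae => //; [exact: lpB|exact: lp_cmeas gp|].
apply: (analytic_part_unique _ _ _ Fg); [exact: lp_ci p1 (lpB p1 (Gp n) (Gp m))|exact: lp_ci p1 gp|].
by rewrite !e; apply: analytic_part_lin => //; exact: lp_ci p1 _.
Qed.

(** Differences of truncations are bounded, so the analytic parts of the truncations of [f] form a
    Cauchy sequence; its limit has the right coefficients because these are continuous on L^p. *)
Lemma analytic_bound_of_bounded p C : 1 <= p -> 0 <= C ->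
  (forall f M, cmeas f -> (forall t, cabs (f t) <= M) -> analytic_bound p C f) ->
  forall f, lp p f -> analytic_bound p C f.
Proof.
move=> p1 C0 bd f fp; have p0 : 0 < p := lt_le_trans ltr01 p1.
pose F (k : nat) := trunc k%:R f.
have mf := lp_cmeas fp.
have Fp k : lp p (F k) by exact: lp_trunc.
have Fk k t : cabs (F k t) <= k%:R by exact: cabs_trunc_le.
have FB k l : analytic_bound p C (fun t => F k t - F l t).
  apply: (bd _ (k%:R + l%:R)); first by apply: cmeasB; exact: cmeas_trunc.
  by move=> t; apply: le_trans (cabsB _ _) _; exact: lerD.
have /choice[G GP] : forall k, exists g, [/\ lp p g, is_analytic_part (F k) g &
    nrm p g <= C * nrm p (F k)].
  by move=> k; apply: (bd _ k%:R) => //; exact: cmeas_trunc.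
have Gp k : lp p (G k) by have [] := GP k.
have FG k : is_analytic_part (F k) (G k) by have [] := GP k.
have GF := analytic_part_cauchy p1 C0 Fp Gp FG FB.
have Ff := trunc_cvg p0 fp.
have cG : lp_cauchy p G.
  move=> e e0; have eC : 0 < e / (C + 1) / 2 by rewrite !divr_gt0// ltr_wpDl.
  have [N NP] := (lp_cvgP _ _ _).1 Ff _ eC.
  exists N => n m Nn Nm; apply: le_trans (GF n m) _.
  have h : nrm p (fun t => F n t - F m t) <= e / (C + 1).
    apply: le_trans (nrm_dist_triangle p1 (Fp n) fp (Fp m)) _.
    rewrite (nrm_distC _ f); apply: le_trans (lerD (NP n Nn) (NP m Nm)) _.
    by rewrite -splitr.
  apply: le_trans (ler_wpM2l C0 h) _; rewrite mulrCA ler_piMr ?(ltW e0)//.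
  by rewrite ler_pdivrMr ?ltr_wpDl// mul1r lerDl.
have [g gp Gg] := lp_complete p1 Gp cG.
exists g; split => //; first exact: analytic_part_lim p1 Fp fp Ff Gp gp Gg FG.
apply/ler_addgt0Pr => e e0.
have [N NP] := (lp_cvgP _ _ _).1 Gg _ e0.
apply: le_trans (nrm_le_dist p1 gp (Gp N)) _; apply: lerD.
  have [_ _ h] := GP N; apply: le_trans h _; apply: ler_wpM2l => //.
  by apply: nrm_le => // t; exact: cabs_trunc.
by rewrite nrm_distC; exact: NP.
Qed.

Lemma analytic_bound_small p : 1 < p -> p < 2 ->
  exists2 C : R, 0 < C & forall f, lp p f -> analytic_bound p C f.
Proof.
move=> p1 p2; have [C C0 bd] := @analytic_bound_bounded R p p1 p2.
by exists C => //; apply: analytic_bound_of_bounded => //; exact: ltW.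
Qed.

(* Duality: pairing f with the analytic part of the dual power of its own
   analytic part, truncated so as to be bounded. *)
Lemma analytic_bound_large p : 2 < p ->
  exists2 C : R, 0 < C & forall f, lp p f -> analytic_bound p C f.
Proof.
move=> p2; have p1 : 1 < p by lra.
have p0 : 0 < p by lra.
(* The conjugate exponent lies in ]1, 2[, where the bound is already available. *)
pose q := p / (p - 1).
have pB1 : 0 < p - 1 by lra.
have q0 : 0 < q by rewrite divr_gt0.
have q1 : 1 < q by rewrite ltr_pdivlMr//; lra.
have q2 : q < 2 by rewrite ltr_pdivrMr//; lra.
have pq : p^-1 + q^-1 = 1 by rewrite /q invf_div -[X in X + _]mul1r -mulrDl addrC subrK divff// gt_eqF.
have [C C0 bd] := analytic_bound_small q1 q2.
exists (2 * C); first by rewrite mulr_gt0.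
move=> f fp; have f2 : lp 2 f by apply: lp_mono (ltW p2) fp.
have [g [g2 fg _]] := analytic_part_exists2 f2.
have og := analytic_part_orthogonal f2 (lp_ci ge1_2 g2) fg.
have mg := lp_cmeas g2.
pose A := nrm p f; have A0 : 0 <= A by exact: nrm_ge0.
have key (k : nat) : nrm p (trunc k%:R g) <= 2 * C * A.
  pose G := trunc k%:R g.
  have mG : cmeas G by exact: cmeas_trunc.
  have Gk t : cabs (G t) <= k%:R by exact: cabs_trunc_le.
  have Gp : lp p G by exact: lp_bnd Gk.
  (* The dual power of [G]: [g] times the conjugate of [phi] is |G|^p, and the q-norm of [phi] is
     the (p-1)-th power of the p-norm of [G]. The truncation keeps it bounded, hence in both L^2 and
     L^q. *)
  pose phi t := (cabs (G t) `^ (p - 2))%:C * G t.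
  have mphi : cmeas phi.
    by apply: cmeasM => //; apply: cmeas_real; apply: mfun_powR; exact: mfun_cabs.
  have cphi t : cabs (phi t) = cabs (G t) `^ (p - 1).
    rewrite /phi cabsM cabs_real ger0_norm ?powR_ge0//.
    have [e|e] := eqVneq (cabs (G t)) 0.
      by rewrite e mulr0 powR0// gt_eqF.
    rewrite -[X in _ * X]powRr1 ?cabs_ge0// -powRD; last by rewrite e implybT.
    by congr (_ `^ _); ring.
  have phik t : cabs (phi t) <= k%:R `^ (p - 1) by rewrite cphi le_powR// cabs_ge0.
  have phi2 : lp 2 phi by exact: lp_bnd phik.
  have phiq : lp q phi by exact: lp_bnd phik.
  have [psi [psi2 phipsi _]] := analytic_part_exists2 phi2.
  have opsi := analytic_part_orthogonal phi2 (lp_ci ge1_2 psi2) phipsi.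
  have psiq : lp q psi by apply: lp_mono (ltW q2) psi2.
  have npsi : nrm q psi <= C * nrm q phi.
    have [psi' [psi'q phipsi' n']] := bd _ phiq; apply: le_trans n'.
    rewrite (nrm_ae q0 psiq (lp_cmeas psi'q))//.
    apply: (analytic_part_unique _ _ phipsi phipsi').
      exact: lp_ci ge1_2 psi2.
    exact: lp_ci (ltW q1) psi'q.
  (* f - g is orthogonal to [psi], which lies in H^2; next phi - psi is orthogonal to [g], which
     also does. Hence the pairing of [f] with [psi] is that of [g] with [phi]. *)
  have J1 : ip f psi = ip g psi.
    apply/eqP; rewrite -subr_eq0 -ipBl//; apply/eqP.
    by have [_] := og; apply; have [] := opsi.
  have J2 : ip g psi = ip g phi.
    rewrite (ipC psi2 g2) (ipC phi2 g2); congr (_^*).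
    apply/eqP; rewrite eq_sym -subr_eq0 -ipBl//; apply/eqP.
    by have [_] := opsi; apply; have [] := og.
  have J3 : ip g phi = (nrm p G `^ p)%:C.
    rewrite nrm_powR// /inner_prod circle_intE.
    have e t : g t * (phi t)^* = (cabs (G t) `^ p)%:C.
      rewrite /phi conjM conj_real mulrCA.
      have -> : g t * (G t)^* = (cabs (G t) ^+ 2)%:C.
        rewrite -mulJ /G /trunc; case: ifP => // _; by rewrite conj_real mulr0 mul0r.
      rewrite -rmorphM; congr (_%:C).
      have [e|e] := eqVneq (cabs (G t)) 0.
        by rewrite e expr0n mulr0 powR0// gt_eqF.
      rewrite -powR_mulrn ?cabs_ge0// -powRD; last by rewrite e implybT.
      by congr (_ `^ _); ring.
    under [X in mean X +i* _]eq_fun do rewrite e /=.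
    under [X in _ +i* mean X]eq_fun do rewrite e /=.
    by rewrite mean_cst.
  have J4 : nrm p G `^ p <= 2 * (A * (C * nrm q phi)).
    rewrite -[X in X <= _]ger0_norm ?powR_ge0// -cabs_real -J3 -J2 -J1.
    have [cc hh] := hoelder_circle p0 q0 pq fp (lpJ q0 psiq).
    apply: le_trans (cabs_circle_int cc) _; rewrite ler_pM2l//.
    apply: le_trans hh _; rewrite nrmJ; exact: ler_wpM2l.
  have J5 : nrm q phi = nrm p G `^ (p - 1).
    rewrite nrmE// [nrm p G]nrmE// -powRrM.
    have -> : (fun t => cabs (phi t) `^ q) = (fun t => cabs (G t) `^ p).
      apply/funext => t; rewrite cphi -powRrM; congr (_ `^ _).
      by rewrite /q mulrC divfK// gt_eqF.
    by rewrite /q invf_div mulrC.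
  have [e|e] := eqVneq (nrm p G) 0; first by rewrite e !mulr_ge0// ltW.
  have X0 : 0 < nrm p G `^ (p - 1) by rewrite powR_gt0// lt_neqAle eq_sym e nrm_ge0.
  rewrite -(ler_pM2r X0); move: J4; rewrite J5 => J4.
  apply: le_trans (_ : nrm p G `^ p <= _).
    rewrite -[X in X * _ <= _]powRr1 ?nrm_ge0// -powRD; last by rewrite e implybT.
    by rewrite addrC subrK.
  by apply: le_trans J4 _; rewrite le_eqVlt; apply/orP; left; apply/eqP; ring.
(* The bound does not depend on the truncation level; Fatou's lemma removes the truncation. *)
have [gp gn] : lp p g /\ nrm p g <= 2 * C * A.
  apply: (@nrm_fatou _ p (fun k => trunc k%:R g)) => //.
  - by rewrite !mulr_ge0// ltW.
  - move=> k; apply: (@lp_bnd _ _ _ k%:R) => //; first exact: cmeas_trunc.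
    by move=> t; exact: cabs_trunc_le.
  - apply: aeW => t; apply: cvg_near_cst; near=> k; congr cabs.
    by near: k; exact: trunc_near.
by exists g.
Unshelve. all: by end_near.
Qed.

Theorem analytic_bound_exists p : 1 < p ->
  exists2 C : R, 0 < C & forall f, lp p f -> analytic_bound p C f.
Proof.
move=> p1; have [p2|p2|->] := ltgtP p 2.
- exact: analytic_bound_small.
- exact: analytic_bound_large.
- by exists 1 => // f /analytic_part_exists2[g [? ? ?]]; exists g; rewrite mul1r.
Qed.

Lemma is_Riesz_projection_exists p : 1 < p -> exists T, @is_Riesz_projection R p%:E T.
Proof.
move=> p1; have p1' := ltW p1; have p0 : 0 < p := lt_trans ltr01 p1.
have [C C0 bd] := analytic_bound_exists p1.
have /choice[T TP] : forall f, exists g, lp p f ->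
    [/\ lp p g, is_analytic_part f g & nrm p g <= C * nrm p f].
  (* Outside L^p nothing is prescribed; [f] itself is taken as default value. *)
  move=> f; have [fp|nfp] := pselect (lp p f); last by exists f.
  by have [g gP] := bd f fp; exists g.
have Tp f : lp p f -> lp p (T f) by move=> /TP[].
have TA f : lp p f -> is_analytic_part f (T f) by move=> /TP[].
exists T; split.
- move=> f fp; split; first exact: Tp.
  by move=> n n0; rewrite (TA _ fp) leNgt n0.
- move=> a f g fp gp.
  have lfg : lp p (fun t => a * f t + g t) by apply: lpD => //; exact: lpZ.
  have lTfg : lp p (fun t => a * T f t + T g t).
    by apply: lpD => //; [apply: lpZ => //|]; exact: Tp.
  apply: (analytic_part_unique _ _ (TA _ lfg)).
  + exact: lp_ci p1' (Tp _ lfg).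
  + exact: lp_ci p1' lTfg.
  + apply: analytic_part_lin; [exact: lp_ci p1' fp|exact: lp_ci p1' gp| | | |].
    * exact: lp_ci p1' (Tp _ fp).
    * exact: lp_ci p1' (Tp _ gp).
    * exact: TA.
    * exact: TA.
- exists C => f fp; have [gp _ gn] := TP _ fp.
  by rewrite !circle_normE// -EFinM lee_fin.
- move=> f f2 fp; apply: analytic_part_orthogonal => //; last exact: TA.
  exact: lp_ci p1' (Tp _ fp).
Qed.

Lemma Riesz_projectionP p : 1 < p -> is_Riesz_projection p%:E (@Riesz_projection R p%:E).
Proof. by move=> /is_Riesz_projection_exists[T TP]; exact: (xgetPex _ (ex_intro _ T TP)). Qed.

Lemma Riesz_projection_nrm p : 1 < p -> exists2 C : R, 0 <= C & forall f, lp p f ->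
  lp p (Riesz_projection p%:E f) /\ nrm p (Riesz_projection p%:E f) <= C * nrm p f.
Proof.
move=> /Riesz_projectionP[ra _ [C CP] _]; exists `|C| => // f fp.
have [rp _] := ra f fp; split => //.
have := CP f fp; rewrite !circle_normE// -EFinM lee_fin => /le_trans; apply.
by apply: ler_wpM2r; [exact: nrm_ge0|exact: ler_norm].
Qed.

(** Linearity holds only almost everywhere, so the Lipschitz bound is recorded separately from the
    norm bound. *)
Lemma Riesz_projection_dist p : 1 < p -> exists2 C : R, 0 <= C & forall f g, lp p f -> lp p g ->
  nrm p (fun t => Riesz_projection p%:E f t - Riesz_projection p%:E g t) <=
    C * nrm p (fun t => f t - g t).
Proof.
move=> p1; have p0 : 0 < p := lt_trans ltr01 p1.
have [C C0 CP] := Riesz_projection_nrm p1; exists C => // f g fp gp.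
have fg := lpB (ltW p1) fp gp; have [lfg] := CP _ fg; apply: le_trans.
have [lf _] := CP _ fp; have [lg _] := CP _ gp.
rewrite le_eqVlt; apply/orP; left; apply/eqP.
apply: nrm_ae => //; first by apply: lpB => //; exact: ltW.
  exact: lp_cmeas lfg.
have := Riesz_lin (Riesz_projectionP p1) (-1) gp fp.
have e (h h' : R -> R[i]) : (fun t => -1 * h' t + h t) = (fun t => h t - h' t).
  by apply/funext => t; rewrite mulN1r addrC.
by rewrite !e; apply: aeS.
Qed.

(** The operator is prescribed only on functions that are also in L^2; continuity along truncations
    carries the description by coefficients to all of L^p. *)
Lemma Riesz_projection_analytic p f : 1 < p -> lp p f ->
  is_analytic_part f (Riesz_projection p%:E f).
Proof.
move=> p1 fp; have p0 : 0 < p := lt_trans ltr01 p1.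
have [C C0 CP] := Riesz_projection_nrm p1.
have [D D0 DP] := Riesz_projection_dist p1.
pose F (k : nat) := trunc k%:R f.
have Fp k : lp p (F k) by exact: lp_trunc.
have F2 k : lp 2 (F k).
  apply: (@lp_bnd _ _ _ k%:R) => //; first by apply: cmeas_trunc; exact: lp_cmeas fp.
  by move=> t; exact: cabs_trunc_le.
have Ff := trunc_cvg p0 fp.
apply: (@analytic_part_lim _ p F (fun k => Riesz_projection p%:E (F k))) => //.
- exact: ltW.
- by move=> k; have [] := CP _ (Fp k).
- by have [] := CP _ fp.
- apply/lp_cvgP => e e0; have eD : 0 < e / (D + 1) by rewrite divr_gt0// ltr_wpDl.
  have [N NP] := (lp_cvgP _ _ _).1 Ff _ eD.
  exists N => n Nn; apply: le_trans (DP _ _ (Fp n) fp) _.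
  apply: le_trans (ler_wpM2l D0 (NP n Nn)) _; rewrite mulrCA ler_piMr ?(ltW e0)//.
  by rewrite ler_pdivrMr ?ltr_wpDl// mul1r lerDl.
- move=> k; apply: orthogonal_projection_analytic => //.
  exact: (Riesz_ext (Riesz_projectionP p1)).
Qed.

End Riesz.

(** * Beurling's theorem *)

Section Beurling.
Context {R : realType}.
Local Notation mu := (@circle R).
Local Notation cabs := (@Normc.normc R).
Local Notation ci := csummable_on_circle.
Local Notation lp p := (@circle_Lp R p%:E).
Local Notation ip := (@inner_prod R).
Local Notation fc := (@fourier_coef R).
Local Notation H2 := (@Hardy R 2%:E).
Implicit Types (f g h u : R -> R[i]) (p q : R) (V : set (R -> R[i])).

Lemma circle_norm_cvg0 p (F : nat -> R -> R[i]) : (forall n, lp p (F n)) ->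
  nrm p (F n) @[n --> \oo] --> (0 : R) -> circle_norm p%:E (F n) @[n --> \oo] --> 0%E.
Proof.
move=> Fp F0; apply: cvg_EFin F0; apply: nearW => n.
by rewrite circle_normE.
Qed.

Lemma lp_ae_cabs p f g : 0 < p -> lp p f -> cmeas g ->
  {ae mu, forall t, cabs (f t) = cabs (g t)} -> lp p g /\ nrm p f = nrm p g.
Proof.
move=> p0 fp mg fg; have /lpP[//|mf F] := fp.
have mfp : measurable_fun [set: measurableTypeR R] (fun t : R => cabs (f t) `^ p).
  by apply: mfun_powR; exact: mfun_cabs.
have mgp : measurable_fun [set: measurableTypeR R] (fun t : R => cabs (g t) `^ p).
  by apply: mfun_powR; exact: mfun_cabs.
have e : {ae mu, forall t, cabs (f t) `^ p = cabs (g t) `^ p} by apply: (aeS _ fg) => t ->.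
have gp : lp p g by apply/lpP => //; split => //; exact: ig_ae F mgp e.
by split => //; rewrite (nrmE p0 fp) (nrmE p0 gp); apply: (congr1 (fun x => x `^ p^-1)); exact: mean_ae.
Qed.

(** What makes multiplication by an inner function isometric. Unlike [inner_fun] it is stable under
    inverses, which are needed for u^-1 f. *)
Definition unimodular u := cmeas u /\ {ae mu, forall t, cabs (u t) = 1}.

Lemma inner_unimodular u : inner_fun u -> unimodular u.
Proof. by case=> -[[m1 m2 _] _] u1. Qed.

Lemma unimodular_mul p u f : 0 < p -> unimodular u -> lp p f ->
  lp p (fun t => u t * f t) /\ nrm p (fun t => u t * f t) = nrm p f.
Proof.
move=> p0 [mu_ u1] fp.
have [] := @lp_ae_cabs p f (fun t => u t * f t) p0 fp; last by move=> ? ->.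
  by apply: cmeasM => //; exact: lp_cmeas fp.
by apply: (aeS _ u1) => t; rewrite cabsM => ->; rewrite mul1r.
Qed.

Lemma unimodular_inv u : unimodular u -> unimodular (fun t => (u t)^-1).
Proof.
move=> [mu_ u1]; split; first exact: cmeasV.
by apply: (aeS _ u1) => t; rewrite cabsV => ->; rewrite invr1.
Qed.

Lemma unimodular_divK u f : unimodular u ->
  circle_ae_eq f (fun t => u t * ((u t)^-1 * f t)).
Proof.
move=> [_ u1]; apply: (aeS _ u1) => t ut; rewrite mulVKf//.
by apply/eqP => u0; move: ut; rewrite u0 cabs0 => /esym/eqP; rewrite oner_eq0.
Qed.

Lemma ip_unimodular u f g : unimodular u -> cmeas f -> cmeas g ->
  ip (fun t => u t * f t) (fun t => u t * g t) = ip f g.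
Proof.
move=> [mu_ u1] mf mg; apply: circle_int_ae.
- by apply: cmeasM; [exact: cmeasM|apply: cmeasJ; exact: cmeasM].
- by apply: cmeasM => //; exact: cmeasJ.
- apply: (aeS _ u1) => t ut; rewrite conjM mulrACA mulJ ut expr1n.
  by rewrite (_ : 1%:C = 1)// mul1r.
Qed.

Lemma invariant_closed_subspace V : invariant_subspace V -> closed_subspace V.
Proof.
move=> iV; have V2 f : V f -> lp 2 f by move=> /(invariant_subH2 iV)[].
split => //; [exact: invariant_zero|exact: invariant_lin|].
move=> F f FV f2 Ff; apply: (invariant_closed iV FV f2).
have F2 n : lp 2 (fun t => F n t - f t) by apply: lp2B => //; exact: V2.
exact: circle_norm_cvg0.
Qed.

Lemma invariant_mulX V f (n : nat) : invariant_subspace V -> V f -> V (fun t => expi t ^+ n * f t).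
Proof.
move=> iV Vf; elim: n => [|n ih].
  by rewrite (_ : (fun t => _) = f)//; apply/funext => t; rewrite expr0 mul1r.
have := invariant_mulz iV ih; congr V.
by apply/funext => t; rewrite exprS mulrA.
Qed.

Lemma fc_mulX f (m n : int) : fc (fun t => expi t ^ m * f t) n = fc f (n - m).
Proof.
congr circle_int; apply/funext => t.
by rewrite mulrC mulrA expi_exprzD mulrC opprB addrC.
Qed.

(* All Fourier coefficients of |u|^2 - 1 vanish. *)
Lemma unimodular_of_orthogonal u : lp 2 u -> nrm 2 u = 1 ->
  (forall n : nat, (0 < n)%N -> ip (fun t => expi t ^+ n * u t) u = 0) ->
  {ae mu, forall t, cabs (u t) = 1}.
Proof.
move=> u2 n1 o.
pose h t := u t * (u t)^*.
have ch : ci h by exact: ip_ci.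
have h_neg (m : nat) : (0 < m)%N -> fc h (- m%:Z) = 0.
  move=> m0; rewrite -(o m m0); congr circle_int; apply/funext => t.
  by rewrite /h opprK mulrC mulrA.
have hJ : (fun t => (h t)^*) = h by apply/funext => t; rewrite /h conjM conjK mulrC.
have cc : ci (fun t => h t - 1).
  by apply: ciB => //; exact: lp_ci ge1_2 (lp_cst 1 gt0_2).
have h1 : circle_ae_eq (fun t => h t - 1) (fun=> 0).
  apply: fourier_coef_unique => // n; rewrite fcB//; last exact: lp_ci ge1_2 (lp_cst 1 gt0_2).
  have -> : fc (fun=> 1) n = (n == 0)%:R.
    by have := @fc_expiX R 0 n; under eq_fun do rewrite expr0z; rewrite eq_sym.
  have [->|n0] := eqVneq n 0.
    have -> : fc h 0 = ip u u.
      by congr circle_int; apply/funext => t; rewrite oppr0 expr0z mulr1.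
    by rewrite ip_self// n1 expr1n subrr.
  rewrite subr0; case: n n0 => [[|n]|n] // _; last by rewrite NegzE h_neg.
  by rewrite -hJ fcJ// h_neg// rmorph0.
apply: (aeS _ h1) => t /eqP; rewrite subr_eq0 /h mulJ => /eqP[] e.
by apply/eqP; rewrite -sqrp_eq1 ?cabs_ge0// e.
Qed.

Lemma inner_of_unimodular u : H2 u -> {ae mu, forall t, cabs (u t) = 1} -> inner_fun u.
Proof.
move=> [[m1 m2 _] u0] u1; split => //; split => //; split => //.
rewrite /circle_norm unlock; case: ifP => // _.
apply: (@le_lt_trans _ _ 1%E); last exact: ltry.
by apply/ess_sup_inf.ess_supP; apply: (aeS _ u1) => t /= ->; rewrite normr1.
Qed.

(** If all coefficients of all elements vanished, [V] would be the zero subspace by uniqueness; the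
    least index exists since negative coefficients vanish in H^2. *)
Lemma invariant_first_coef V : invariant_subspace V -> V <> zero_subspace ->
  exists (k : nat) g, [/\ V g, fc g k != 0 & forall f j, V f -> j < k%:Z -> fc f j = 0].
Proof.
move=> iV V0; have cV := invariant_closed_subspace iV.
have ex : exists k : nat, `[< exists2 g, V g & fc g k != 0 >].
  apply: contrapT => h; apply: V0; apply/seteqP; split => f; last first.
    move=> [f2 f0]; apply: csub_ae cV (csub0 cV) (lp_cmeas f2) _.
    by apply: (aeS _ f0) => t.
  move=> Vf; have [f2 fn] := invariant_subH2 iV Vf; split => //.
  apply: fourier_coef_unique; first exact: lp_ci ge1_2 f2.
  case=> [n|n]; last exact: fn.
  by apply: contrapT => /eqP fn0; apply: h; exists n; apply/asboolP; exists f.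
case: (ex_minnP ex) => k /asboolP[g Vg gk] km; exists k, g; split => // f j Vf jk.
case: j jk => [j|j] jk; last by have [_ ->] := invariant_subH2 iV Vf.
apply: contrapT => /eqP fj; have : (k <= j)%N by apply: km; apply/asboolP; exists f.
by rewrite leqNgt -ltz_nat jk.
Qed.

(** * The wandering vector of an invariant subspace *)

Section WanderingVector.
Variables (V : set (R -> R[i])) (k : nat).
Hypotheses (iV : invariant_subspace V)
  (below : forall f j, V f -> j < k%:Z -> fc f j = 0).

(** The kernel in [V] of a continuous functional, so that its closedness is immediate. *)
Definition coef_vanishing : set (R -> R[i]) := [set f | V f /\ fc f k = 0].

Lemma coef_vanishing_closed : closed_subspace coef_vanishing.
Proof.
have cV := invariant_closed_subspace iV; have V2 := csub_L2 cV; split.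
- by move=> f [/V2].
- split; first exact: csub0.
  by have := fcZ 0 k (lp_ci ge1_2 (V2 _ (csub0 cV))); under eq_fun do rewrite mul0r; rewrite mul0r.
- move=> a f g [Vf f0] [Vg g0]; split; first exact: csub_lin.
  have cf := lp_ci ge1_2 (V2 _ Vf); have cg := lp_ci ge1_2 (V2 _ Vg).
  by rewrite fcD ?fcZ ?f0 ?g0 ?mulr0 ?addr0//; exact: ciZ.
- move=> F f FW f2 Ff; have Vf : V f by apply: csub_closed cV _ _ _ f2 Ff => n; have [] := FW n.
  split => //; apply: (fc_lim ge1_2 _ f2 Ff) => n; have [Fn F0] := FW n => //.
  exact: V2.
Qed.

(** The coefficient of index [k] of z^n f is that of index k - n of [f], below the first possible
    one. *)
Lemma coef_vanishing_mulX f n : (0 < n)%N -> V f -> coef_vanishing (fun t => expi t ^+ n * f t).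
Proof.
move=> n0 Vf; split; first exact: invariant_mulX.
by rewrite (fc_mulX f n%:Z) below// ltrBlDr ltrDl.
Qed.

(** [g] minus its projection on [coef_vanishing], normalized; it keeps the nonzero coefficient of
    index [k] of [g] and so is not 0. *)
Lemma wandering_vector g : V g -> fc g k != 0 ->
  exists u, [/\ V u, nrm 2 u = 1 & forall h, coef_vanishing h -> ip u h = 0].
Proof.
have cV := invariant_closed_subspace iV; have V2 := csub_L2 cV.
move=> Vg gk; have [w [[Vw w0] ow]] := orthogonal_projection coef_vanishing_closed (V2 _ Vg).
pose u0 t := g t - w t; have Vu0 : V u0 by exact: csubB.
have u02 := V2 _ Vu0.
have u0k : fc u0 k = fc g k by rewrite fcB ?w0 ?subr0//; exact: lp_ci ge1_2 (V2 _ _).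
have n0 : nrm 2 u0 != 0.
  apply: contra_neq gk => n0; rewrite -u0k.
  have ae0 := nrm_eq0_ae gt0_2 u02 n0.
  rewrite (fc_ae _ (lp_ci ge1_2 u02) (lp_cmeas (lp_cst 0 gt0_2)) ae0).
  by have := fcZ 0 k (lp_ci ge1_2 u02); under eq_fun do rewrite mul0r; rewrite mul0r.
exists (fun t => ((nrm 2 u0)^-1)%:C * u0 t); split; first exact: csubZ.
  by rewrite nrmZ// cabs_real ger0_norm ?invr_ge0 ?nrm_ge0// mulVf.
move=> h Wh; rewrite ipZl ?ow ?mulr0//; apply: V2; by case: Wh.
Qed.

End WanderingVector.

Theorem Beurling V : invariant_subspace V -> V <> zero_subspace ->
  exists u, inner_fun u /\ V = mul_H2 u.
Proof.
move=> iV V0; have cV := invariant_closed_subspace iV; have V2 := csub_L2 cV.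
have [k [g [Vg gk below]]] := invariant_first_coef iV V0.
have [u [Vu u1 uW]] := wandering_vector iV Vg gk.
have u2 := V2 _ Vu.
have u_ae : {ae mu, forall t, cabs (u t) = 1}.
  apply: unimodular_of_orthogonal => // n n0.
  have W := coef_vanishing_mulX iV below n0 Vu.
  by rewrite (ipC u2) ?uW ?rmorph0//; apply: V2; case: W.
have uu : unimodular u by split => //; exact: lp_cmeas u2.
have uV := unimodular_inv uu.
have iu := inner_of_unimodular (invariant_subH2 iV Vu) u_ae.
(* The coefficient of index -m of u^-1 f, for m > 0, is the product of [f] with u z^-m, that is, of
   z^m f with [u]; it vanishes since z^m f lies in [coef_vanishing]. *)
have sub f : V f -> H2 (fun t => (u t)^-1 * f t).
  move=> Vf; have f2 := V2 _ Vf; have [h2 _] := unimodular_mul gt0_2 uV f2.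
  split => // -[//|m] _; rewrite NegzE fc_ip.
  rewrite -(ip_unimodular uu (lp_cmeas h2)); last exact: cmeas_expiX.
  have W := coef_vanishing_mulX iV below (ltn0Sn m) Vf.
  have W2 : lp 2 (fun t => expi t ^+ m.+1 * f t) by apply: V2; case: W.
  transitivity (ip f (fun t => u t * expi t ^ (- m.+1%:Z))).
    symmetry; apply: ip_ae => //.
    - by have [] := unimodular_mul gt0_2 uu (lp_expiX (- m.+1%:Z) gt0_2).
    - by apply: cmeasM; [exact: lp_cmeas u2|exact: lp_cmeas h2].
    - by apply: cmeasM; [exact: lp_cmeas u2|exact: cmeas_expiX].
    - exact: unimodular_divK.
    - exact: aeW.
  transitivity (ip (fun t => expi t ^+ m.+1 * f t) u).
    by congr circle_int; apply/funext => t; rewrite conjM expi_conj opprK mulrA mulrC mulrA.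
  by rewrite (ipC u2)// uW ?rmorph0.
exists u; split => //; apply/seteqP; split => f.
  move=> Vf; split; first exact: V2.
  by exists (fun t => (u t)^-1 * f t); [exact: sub|exact: unimodular_divK].
move=> [f2 [h [h2 h0] fuh]].
have [uh2 _] := unimodular_mul gt0_2 uu h2.
(* By the first inclusion w = u h', so that u h - w = u (h - h') is orthogonal
   to all u z^n, and h - h' has no Fourier coefficient left. *)
have [w [Vw ow]] := orthogonal_projection cV uh2.
have w2 := V2 _ Vw; have [h'2 h'0] := sub _ Vw.
pose kk t := h t - (u t)^-1 * w t.
have kk2 : lp 2 kk by exact: lp2B.
have ukk : circle_ae_eq (fun t => u t * h t - w t) (fun t => u t * kk t).
  by apply: (aeS _ (unimodular_divK w uu)) => t e; rewrite /kk mulrBr -e.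
have kk0 : circle_ae_eq kk (fun=> 0).
  apply: fourier_coef_unique; first exact: lp_ci ge1_2 kk2.
  case=> n; last by rewrite fcB ?h0 ?h'0 ?subr0//; exact: lp_ci ge1_2 _.
  rewrite fc_ip -(ip_unimodular uu (lp_cmeas kk2)); last exact: cmeas_expiX.
  have Vz := invariant_mulX n iV Vu.
  rewrite -(ow _ Vz); symmetry; apply: ip_ae => //.
  - exact: lp2B.
  - exact: V2.
  - by apply: cmeasM; [exact: lp_cmeas u2|exact: lp_cmeas kk2].
  - by apply: cmeasM; [exact: lp_cmeas u2|exact: cmeas_expiX].
  - by apply: aeW => t; rewrite mulrC.
apply: csub_ae cV Vw (lp_cmeas f2) _.
have e1 : circle_ae_eq (fun t => u t * h t) w.
  apply: (aeS2 _ ukk kk0) => t e1 e2; apply/eqP; rewrite -subr_eq0 e1 e2 mulr0 //.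
by apply: (aeS2 _ fuh e1) => t -> ->.
Qed.

(** Multiplication by [u] is unitary on L^2 and carries H^2 onto u H^2, so it conjugates one
    orthogonal projection into the other. *)
Lemma inner_operator_orthogonal p u f : 1 < p -> inner_fun u -> lp 2 f -> lp p f ->
  is_orthogonal_projection (mul_H2 u) f (inner_operator p%:E u f).
Proof.
move=> p1 /inner_unimodular uu f2 fp; have p0 : 0 < p := lt_trans ltr01 p1.
have uV := unimodular_inv uu.
have [h2 _] := unimodular_mul gt0_2 uV f2; have [hp _] := unimodular_mul p0 uV fp.
rewrite /inner_operator; set h := (fun t => (u t)^-1 * f t) in h2 hp *.
have [[r2 r0] o] := Riesz_ext (Riesz_projectionP p1) h2 hp.
set r := Riesz_projection p%:E h in r2 r0 o *.
have [ur2 _] := unimodular_mul gt0_2 uu r2.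
split.
  split => //; exists r => //; exact: aeW.
move=> w [w2 [h' Hh' wuh']]; have [h'2 _] := Hh'.
have hr2 := lp2B h2 r2.
rewrite -(o _ Hh') -(ip_unimodular uu (lp_cmeas hr2) (lp_cmeas h'2)).
apply: ip_ae => //; first exact: lp2B.
- by apply: cmeasM; [case: uu|exact: lp_cmeas hr2].
- by apply: cmeasM; [case: uu|exact: lp_cmeas h'2].
- by apply: (aeS _ (unimodular_divK f uu)) => t e; rewrite mulrBr -e.
Qed.

Lemma inner_operator_bound p : 1 < p -> exists2 C : R, 0 <= C & forall u, inner_fun u ->
  (forall f, lp p f -> lp p (inner_operator p%:E u f) /\
     nrm p (inner_operator p%:E u f) <= C * nrm p f) /\
  (forall f g, lp p f -> lp p g ->
     nrm p (fun t => inner_operator p%:E u f t - inner_operator p%:E u g t) <=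
     C * nrm p (fun t => f t - g t)).
Proof.
move=> p1; have p0 : 0 < p := lt_trans ltr01 p1.
have [D D0 DP] := Riesz_projection_nrm p1.
have [C C0 CP] := Riesz_projection_dist p1.
(* One constant, independent of [u], for both the norm and the Lipschitz estimate. *)
exists (D + C) => [|u /inner_unimodular uu]; first exact: addr_ge0.
have uV := unimodular_inv uu.
have R_lp f : lp p f -> lp p (Riesz_projection p%:E (fun s => (u s)^-1 * f s)).
  by move=> fp; have [hp _] := unimodular_mul p0 uV fp; have [] := DP _ hp.
split=> [f fp|f g fp gp].
  have [lf ->] := unimodular_mul p0 uu (R_lp _ fp); split => //.
  have [hp hn] := unimodular_mul p0 uV fp; have [_] := DP _ hp.
  by rewrite hn => /le_trans; apply; apply: ler_wpM2r; [exact: nrm_ge0|rewrite lerDl].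
rewrite /inner_operator.
have [fp' _] := unimodular_mul p0 uV fp; have [gp' _] := unimodular_mul p0 uV gp.
have := CP _ _ fp' gp'; move=> h; apply: le_trans (_ : C * nrm p (fun t => f t - g t) <= _); last first.
  by apply: ler_wpM2r; [exact: nrm_ge0|rewrite lerDr].
move: h.
have e (v a b : R -> R[i]) : (fun t => v t * a t - v t * b t) = (fun t => v t * (a t - b t)).
  by apply/funext => t; rewrite mulrBr.
rewrite !e.
have [_ ->] := unimodular_mul p0 uu (lpB (ltW p1) (R_lp _ fp) (R_lp _ gp)).
by have [_ ->] := unimodular_mul p0 uV (lpB (ltW p1) fp gp).
Qed.

End Beurling.

(** * Decreasing families of projections *)

Section Convergence.
Context {R : realType}.
Local Notation cabs := (@Normc.normc R).
Local Notation lp p := (@circle_Lp R p%:E).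
Local Notation ip := (@inner_prod R).
Local Notation H2 := (@Hardy R 2%:E).
Implicit Types (f g h u : R -> R[i]) (p q : R) (V : set (R -> R[i])).

Lemma subspace_innerP V : invariant_subspace V -> V <> zero_subspace ->
  inner_fun (subspace_inner V) /\ V = mul_H2 (subspace_inner V).
Proof. by move=> iV V0; exact: (xgetPex _ (Beurling iV V0)). Qed.

(** Together with uniqueness of orthogonal projections, this shows that the operators for two
    exponents agree almost everywhere on functions common to their domains and L^2. *)
Lemma subspace_projection_orthogonal p V f : 1 < p -> invariant_subspace V ->
  lp 2 f -> lp p f -> is_orthogonal_projection V f (subspace_projection p%:E V f).
Proof.
move=> p1 iV f2 fp; rewrite /subspace_projection; case: asboolP => V0; last first.
  have [iu Vu] := subspace_innerP iV V0; rewrite {1}Vu.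
  exact: inner_operator_orthogonal.
split => [|h]; first exact: (invariant_zero iV).
rewrite V0 => -[h2 h0]; have f02 : lp 2 (fun t => f t - 0) by apply: lp2B => //; exact: lp_cst gt0_2.
transitivity (ip (fun t => f t - 0) (fun=> 0)).
  by apply: ip_ae => //; [exact: lp_cmeas f02|exact: aeW].
by rewrite /inner_prod; under eq_fun do rewrite rmorph0 mulr0; rewrite circle_int_cst.
Qed.

Lemma subspace_projection_bound p : 1 < p -> exists2 C : R, 0 <= C &
  forall V, invariant_subspace V ->
  (forall f, lp p f -> lp p (subspace_projection p%:E V f) /\
     nrm p (subspace_projection p%:E V f) <= C * nrm p f) /\
  (forall f g, lp p f -> lp p g ->
     nrm p (fun t => subspace_projection p%:E V f t - subspace_projection p%:E V g t) <=
     C * nrm p (fun t => f t - g t)).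
Proof.
move=> p1; have p0 : 0 < p := lt_trans ltr01 p1.
have [C C0 CP] := inner_operator_bound p1; exists C => // V iV.
rewrite /subspace_projection; case: asboolP => V0; last first.
  by apply: CP; have [] := subspace_innerP iV V0.
split=> [f fp|f g fp gp].
  by split; [exact: lp_cst|rewrite nrm_cst// cabs0 mulr_ge0// nrm_ge0].
by under eq_fun do rewrite subrr; rewrite nrm_cst// cabs0 mulr_ge0// nrm_ge0.
Qed.

Lemma closed_subspace_bigcap (V : nat -> set (R -> R[i])) :
  (forall n, closed_subspace (V n)) -> closed_subspace (\bigcap_n V n).
Proof.
move=> cV; split.
- by move=> f /(_ 0%N I) /(csub_L2 (cV _)).
- by move=> n _; exact: csub0.
- by move=> a f g Vf Vg n _; apply: csub_lin => //; [exact: Vf|exact: Vg].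
- by move=> F f FV f2 Ff n _; apply: csub_closed (cV n) _ _ _ f2 Ff => k; exact: FV.
Qed.

Lemma invariant_subspace_bigcap (V : nat -> set (R -> R[i])) :
  (forall n, invariant_subspace (V n)) -> invariant_subspace (\bigcap_n V n).
Proof.
move=> iV; split.
- by move=> f /(_ 0%N I) /(invariant_subH2 (iV _)).
- by move=> n _; exact: invariant_zero.
- by move=> a f g Vf Vg n _; apply: invariant_lin => //; [exact: Vf|exact: Vg].
- by move=> F f FV f2 Ff n _; apply: (invariant_closed (iV n) _ f2 Ff) => k; exact: FV.
- by move=> f Vf n _; apply: invariant_mulz => //; exact: Vf.
Qed.

(** * L^2 convergence of orthogonal projections on decreasing subspaces *)

Section DecreasingProjections.
Variables (V : nat -> set (R -> R[i])) (f : R -> R[i]) (g : nat -> R -> R[i]).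
Hypotheses (cV : forall n, closed_subspace (V n)) (decV : forall n, V n.+1 `<=` V n)
  (f2 : lp 2 f) (Vg : forall n, is_orthogonal_projection (V n) f (g n)).

Lemma decreasing_subset n m : (n <= m)%N -> V m `<=` V n.
Proof.
elim: m => [|m ih]; first by rewrite leqn0 => /eqP ->.
rewrite leq_eqVlt => /orP[/eqP -> //|]; rewrite ltnS => /ih nm.
by apply: subset_trans nm; exact: decV.
Qed.

Let g2 n : lp 2 (g n). Proof. by apply: csub_L2 (cV n) _ _; have [] := Vg n. Qed.

(** As V m is contained in V n, g m is also the orthogonal projection of g n on V m. *)
Lemma decreasing_pythagoras n m : (n <= m)%N ->
  nrm 2 (g n) ^+ 2 = nrm 2 (fun t => g n t - g m t) ^+ 2 + nrm 2 (g m) ^+ 2.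
Proof.
move=> nm; have [Vgn on] := Vg n; have [Vgm om] := Vg m.
apply: orthogonal_projection_nrm (cV m) (g2 n) _; split => // h Vh.
have h2 := csub_L2 (cV m) Vh.
rewrite (_ : (fun t => g n t - g m t) = (fun t => (f t - g m t) - (f t - g n t))); last first.
  by apply/funext => t; ring.
rewrite ipBl ?om ?on ?subrr//; try exact: lp2B.
exact: decreasing_subset nm _ Vh.
Qed.

Lemma decreasing_cauchy : lp_cauchy 2 g.
Proof.
pose a n := nrm 2 (g n) ^+ 2.
have a_dec : nonincreasing_seq a.
  by move=> n m nm; rewrite /a (decreasing_pythagoras nm) lerDr sqr_ge0.
have a_cvg : cvgn a.
  by apply: nonincreasing_is_cvgn => //; exists 0 => _ [n _ <-]; exact: sqr_ge0.
move=> e e0; have e20 : 0 < e ^+ 2 by rewrite exprn_gt0.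
have /cvgrPdist_le/(_ _ e20)[N _ NP] := a_cvg.
exists N.
have key n m : (N <= n)%N -> (n <= m)%N -> nrm 2 (fun t => g n t - g m t) <= e.
  move=> Nn nm; rewrite -(ler_pXn2r (ltn0Sn 1)) ?nnegrE ?nrm_ge0// ?(ltW e0)//.
  have := decreasing_pythagoras nm; rewrite -/(a n) -/(a m) => h.
  have h1 : a n - lim (a @ \oo) <= e ^+ 2.
    by apply: le_trans (NP n Nn); rewrite distrC ler_norm.
  have h2 : lim (a @ \oo) <= a m by exact: nonincreasing_cvgn_ge.
  by move: h h1 h2; move: (lim _) (a n) (a m) (_ ^+ 2) (_ ^+ 2) => x y z v w; lra.
move=> n m Nn Nm; have [nm|/ltnW mn] := leqP n m; first exact: key.
by rewrite nrm_distC; exact: key.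
Qed.

(** The limit provided by completeness lies in each V n, which contains a tail of the sequence, and
    inherits orthogonality to the intersection; by uniqueness it is [ginfty] almost everywhere. *)
Lemma decreasing_projections_cvg ginfty :
  is_orthogonal_projection (\bigcap_n V n) f ginfty -> lp_cvg 2 g ginfty.
Proof.
move=> Vginfty; have [l l2 gl] := lp_complete ge1_2 g2 decreasing_cauchy.
have cI := closed_subspace_bigcap cV.
have Vl : is_orthogonal_projection (\bigcap_n V n) f l.
  split.
    move=> n _; apply: (csub_closed (cV n) (F := fun k => g (k + n)%N)) => // [k|].
      by have [Vgk _] := Vg (k + n)%N; apply: decreasing_subset Vgk; exact: leq_addl.
    apply/lp_cvgP => e e0; have [N NP] := (lp_cvgP _ _ _).1 gl _ e0.
    by exists N => k Nk; apply: NP; exact: leq_trans Nk (leq_addr _ _).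
  move=> h Vh; apply: cabs_eps0 => e e0.
  have h2 : lp 2 h by exact: csub_L2 cI _ Vh.
  have eh : 0 < e / 2 / (nrm 2 h + 1) by rewrite !divr_gt0// ltr_wpDl// nrm_ge0.
  have [N NP] := (lp_cvgP _ _ _).1 gl _ eh.
  rewrite (_ : (fun t => f t - l t) = (fun t => (f t - g N t) + (g N t - l t))); last first.
    by apply/funext => t; ring.
  have [_ o] := Vg N; rewrite ipDl ?o ?add0r//; try exact: lp2B; last exact: Vh.
  apply: le_trans (cabs_ip (lp2B (g2 N) l2) h2) _.
  have := NP N (leqnn _); have := nrm_ge0 2 h; move: (nrm 2 h) (nrm 2 _) eh => x y eh x0 yx.
  rewrite mulrC -ler_pdivlMr//; apply: le_trans (ler_wpM2r x0 yx) _.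
  rewrite mulrAC ler_pdivrMr ?ltr_wpDl//.
  by rewrite ler_wpM2l ?lerDl// divr_ge0// ltW.
have ae := orthogonal_projection_unique cI f2 Vl Vginfty.
have ginf2 : lp 2 ginfty by apply: csub_L2 cI _ _; case: Vginfty.
rewrite /lp_cvg; under eq_fun => n.
  rewrite -(_ : nrm 2 (fun t => g n t - l t) = nrm 2 (fun t => g n t - ginfty t)).
    over.
  apply: nrm_ae => //; [exact: lp2B|exact: lp_cmeas (lp2B (g2 n) ginf2)|].
  by apply: (aeS _ ae) => t ->.
exact: gl.
Qed.

End DecreasingProjections.

(** Cauchy-Schwarz for the factorization |f|^p = |f| |f|^(p-1); the exponent 2 (p - 1) is that of
    the second factor squared. *)
Lemma nrm_interpolation p f : 1 < p -> lp 2 f -> lp (2 * (p - 1)) f -> lp p f ->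
  nrm p f `^ p <= nrm 2 f * nrm (2 * (p - 1)) f `^ (p - 1).
Proof.
move=> p1 f2 fr fp; have p0 : 0 < p := lt_trans ltr01 p1.
have pB1 : 0 < p - 1 by rewrite subr_gt0.
have r0 : 0 < 2 * (p - 1) by rewrite mulr_gt0.
have mf := lp_cmeas fp; have /lpP[//|_ Fr] := fr.
pose h t := (cabs (f t) `^ (p - 1))%:C.
have hE t : cabs (h t) = cabs (f t) `^ (p - 1) by rewrite cabs_real ger0_norm ?powR_ge0.
have mh : cmeas h by apply: cmeas_real; apply: mfun_powR; exact: mfun_cabs.
have e2 : (fun t => cabs (h t) `^ 2) = (fun t => cabs (f t) `^ (2 * (p - 1))).
  by apply/funext => t; rewrite hE -powRrM mulrC.
have h2 : lp 2 h by apply/lpP; rewrite ?gt0_2//; split => //; rewrite e2.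
have [_] := lp2_mul f2 h2.
rewrite nrm_powR// (nrmE gt0_2 h2) e2 (nrmE r0 fr) -powRrM.
rewrite (_ : (2 * (p - 1))^-1 * (p - 1) = 2^-1); last by field; rewrite gt_eqF.
apply: le_trans; rewrite le_eqVlt; apply/orP; left; apply/eqP.
congr mean; apply/funext => t; rewrite cabsM hE.
have [e|e] := eqVneq (cabs (f t)) 0; first by rewrite e mul0r powR0// gt_eqF.
rewrite -[X in _ = X * _]powRr1 ?cabs_ge0// -powRD; last by rewrite e implybT.
by rewrite addrC subrK.
Qed.

Lemma lp_cvg_interpolation p (F : nat -> R -> R[i]) f (K : R) : 1 < p ->
  (forall n, lp 2 (fun t => F n t - f t)) -> (forall n, lp (2 * (p - 1)) (fun t => F n t - f t)) ->
  (forall n, lp p (fun t => F n t - f t)) ->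
  (forall n, nrm (2 * (p - 1)) (fun t => F n t - f t) <= K) -> lp_cvg 2 F f -> lp_cvg p F f.
Proof.
move=> p1 D2 Dr Dp DK F2; have p0 : 0 < p := lt_trans ltr01 p1.
have pB1 : 0 < p - 1 by rewrite subr_gt0.
have pV0 : 0 < p^-1 by rewrite invr_gt0.
pose a n := nrm 2 (fun t => F n t - f t) * K `^ (p - 1).
have a0 n : 0 <= a n by rewrite mulr_ge0 ?powR_ge0 ?nrm_ge0.
have a_cvg : a @ \oo --> (0 : R).
  by rewrite -(mul0r (K `^ (p - 1))); apply: cvgMr_tmp; exact: F2.
have := cvg_powR pV0 a0 a_cvg; rewrite powR0 ?gt_eqF// => h.
apply: (squeeze_cvgr _ (cvg_cst 0) h); apply: nearW => n; rewrite nrm_ge0/=.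
rewrite -[X in X <= _]powRr1 ?nrm_ge0// -(mulfV (lt0r_neq0 p0)) powRrM.
apply: le_powR => //; first exact: powR_ge0.
apply: le_trans (nrm_interpolation p1 (D2 n) (Dr n) (Dp n)) _.
apply: ler_wpM2l; first exact: nrm_ge0.
by apply: le_powR => //; exact: nrm_ge0.
Qed.

Lemma bounded_dense p f e : 0 < p -> lp p f -> 0 < e -> exists g M,
  [/\ cmeas g, forall t, cabs (g t) <= M & nrm p (fun t => f t - g t) <= e].
Proof.
move=> p0 fp e0; have [N NP] := (lp_cvgP _ _ _).1 (trunc_cvg p0 fp) _ e0.
exists (trunc N%:R f), N%:R; split.
- by apply: cmeas_trunc; exact: lp_cmeas fp.
- by move=> t; exact: cabs_trunc_le.
- by rewrite nrm_distC; exact: NP.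
Qed.

(** The inner function picked for H^2 need not be identified: on bounded functions both operators
    are orthogonal projections on H^2, by density they agree on [f], and the Riesz projection fixes
    [f] because the Fourier coefficients agree. *)
Lemma subspace_projection_H2 p f : 1 < p -> invariant_subspace H2 -> Hardy p%:E f ->
  circle_ae_eq (subspace_projection p%:E H2 f) f.
Proof.
move=> p1 iH [fp f0]; have p0 : 0 < p := lt_trans ltr01 p1; have p1' := ltW p1.
have [C C0 /(_ _ iH)[CP1 CP2]] := subspace_projection_bound p1.
have [D D0 DP2] := Riesz_projection_dist p1; have [D' _ DP1] := Riesz_projection_nrm p1.
set S := subspace_projection p%:E H2 in CP1 CP2 *.
pose T := @Riesz_projection R p%:E.
have Sp h : lp p h -> lp p (S h) by case/CP1.
have Tp h : lp p h -> lp p (T h) by case/DP1.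
have STf : nrm p (fun t => S f t - T f t) = 0.
  apply/eqP; rewrite eq_le nrm_ge0 andbT; apply/ler_addgt0Pr => e e0; rewrite add0r.
  have eC : 0 < e / (C + D + 1) by rewrite divr_gt0// ltr_wpDl// addr_ge0.
  have [g [M [mg gM fg]]] := bounded_dense p0 fp eC.
  have gp : lp p g by exact: lp_bnd gM.
  have g2 : lp 2 g by exact: lp_bnd gt0_2 mg gM.
  have STg : circle_ae_eq (S g) (T g).
    apply: (orthogonal_projection_unique Hardy2_closed g2).
      exact: subspace_projection_orthogonal.
    exact: (Riesz_ext (Riesz_projectionP p1)).
  apply: le_trans (nrm_dist_triangle p1' (Sp _ fp) (Tp _ gp) (Tp _ fp)) _.
  have -> : nrm p (fun t => S f t - T g t) = nrm p (fun t => S f t - S g t).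
    apply: nrm_ae => //; [exact: lpB p1' (Sp _ fp) (Tp _ gp)| |].
      by apply: lp_cmeas; exact: lpB p1' (Sp _ fp) (Sp _ gp).
    by apply: (aeS _ STg) => t ->.
  have h1 := CP2 _ _ fp gp; have h2 := DP2 _ _ fp gp.
  rewrite (nrm_distC p (T g)).
  apply: le_trans (lerD h1 h2) _; rewrite -mulrDl.
  apply: le_trans (ler_wpM2l (addr_ge0 C0 D0) fg) _; rewrite mulrCA ler_piMr ?(ltW e0)//.
  by rewrite ler_pdivrMr ?ltr_wpDl ?addr_ge0// mul1r lerDl.
have ae1 := nrm_eq0_ae p0 (lpB p1' (Sp _ fp) (Tp _ fp)) STf.
have ae2 : circle_ae_eq (T f) f.
  apply: (@analytic_part_unique _ f).
  - exact: lp_ci p1' (Tp _ fp).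
  - exact: lp_ci p1' fp.
  - exact: Riesz_projection_analytic.
  - by move=> n; case: leP => // /f0.
by apply: (aeS2 _ ae1 ae2) => t /eqP; rewrite subr_eq0 => /eqP -> ->.
Qed.

(** * L^p convergence of the projections on decreasing invariant subspaces *)

Section DecreasingInvariant.
Variables (V : nat -> set (R -> R[i])) (p : R).
Hypotheses (iV : forall n, invariant_subspace (V n)) (decV : forall n, V n.+1 `<=` V n)
  (p1 : 1 < p).
Local Notation P n := (subspace_projection p%:E (V n)).
Local Notation Pinfty := (subspace_projection p%:E (\bigcap_n V n)).
Let p0 : 0 < p. Proof. exact: lt_trans p1. Qed.
Let p1' : 1 <= p. Proof. exact: ltW. Qed.
Let iI : invariant_subspace (\bigcap_n V n). Proof. exact: invariant_subspace_bigcap. Qed.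

Lemma subspace_projection_cvg_bounded f (M : R) : cmeas f -> (forall t, cabs (f t) <= M) ->
  lp_cvg p (fun n => P n f) (Pinfty f).
Proof.
move=> mf fM; have f_lp q : 0 < q -> lp q f by move=> q0; exact: lp_bnd fM.
have fp := f_lp _ p0; have f2 := f_lp _ gt0_2.
have o n : is_orthogonal_projection (V n) f (P n f) by exact: subspace_projection_orthogonal.
have oI : is_orthogonal_projection (\bigcap_n V n) f (Pinfty f).
  exact: subspace_projection_orthogonal.
have cV n := invariant_closed_subspace (iV n); have cI := invariant_closed_subspace iI.
have cvg2 := decreasing_projections_cvg cV decV f2 o oI.
have D2 n : lp 2 (fun t => P n f t - Pinfty f t).
  by apply: lp2B; [apply: csub_L2 (cV n) _ _; case: (o n)|apply: csub_L2 cI _ _; case: oI].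
have [p2|p2] := leP p 2.
  apply: (squeeze_cvgr _ (cvg_cst 0) cvg2); apply: nearW => n; rewrite nrm_ge0/=.
  by have [] := nrm_mono p0 p2 (D2 n).
pose r := 2 * (p - 1).
have r1 : 1 < r by rewrite /r; lra.
have r0 : 0 < r := lt_trans ltr01 r1.
have pr : p <= r by rewrite /r; lra.
have fr := f_lp _ r0.
have [C C0 CP] := subspace_projection_bound r1.
(* The operator for exponent [p] is bounded on [f] in L^r because it agrees there almost everywhere
   with the operator for exponent [r]. *)
have bd W : invariant_subspace W -> lp r (subspace_projection p%:E W f) /\
    nrm r (subspace_projection p%:E W f) <= C * nrm r f.
  move=> iW; have cW := invariant_closed_subspace iW.
  have o1 := subspace_projection_orthogonal p1 iW f2 fp.
  have o2 := subspace_projection_orthogonal r1 iW f2 fr.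
  have ae := orthogonal_projection_unique cW f2 o2 o1.
  have [/(_ _ fr)[h1 h2] _] := CP _ iW.
  have m1 : cmeas (subspace_projection p%:E W f).
    by apply: (@lp_cmeas _ 2); apply: csub_L2 cW _ _; case: o1.
  by split; [exact: lp_ae ae|rewrite -(nrm_ae r0 h1 m1 ae)].
have [Ir In] := bd _ iI.
apply: (@lp_cvg_interpolation _ _ _ (C * nrm r f + C * nrm r f)) => // n.
- by have [nr _] := bd _ (iV n); exact: lpB (ltW r1) nr Ir.
- have [nr _] := bd _ (iV n); apply: lp_mono p0 pr _; exact: lpB (ltW r1) nr Ir.
- have [nr nn] := bd _ (iV n); apply: le_trans (nrmB (ltW r1) nr Ir) _; exact: lerD.
Qed.

(** A three-epsilon argument around a bounded [g], with one Lipschitz constant for all the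
    projections involved. *)
Lemma subspace_projection_cvg f : lp p f -> lp_cvg p (fun n => P n f) (Pinfty f).
Proof.
move=> fp; apply/lp_cvgP => e e0.
have [C C0 CP] := subspace_projection_bound p1.
have eC : 0 < e / 3 / (C + 1) by rewrite !divr_gt0// ltr_wpDl.
have [g [M [mg gM fg]]] := bounded_dense p0 fp eC.
have gp : lp p g by exact: lp_bnd gM.
have e3 : 0 < e / 3 by rewrite divr_gt0.
have [N NP] := (lp_cvgP _ _ _).1 (subspace_projection_cvg_bounded mg gM) _ e3.
exists N => n Nn.
have lpP W h : invariant_subspace W -> lp p h -> lp p (subspace_projection p%:E W h).
  by move=> /CP[h1 _] /h1[].
have small W : invariant_subspace W ->
    nrm p (fun t => subspace_projection p%:E W f t - subspace_projection p%:E W g t) <= e / 3.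
  move=> /CP[_ h]; apply: le_trans (h _ _ fp gp) _.
  apply: le_trans (ler_wpM2l C0 fg) _; rewrite mulrCA ler_piMr ?(ltW e3)//.
  by rewrite ler_pdivrMr ?ltr_wpDl// mul1r lerDl.
have Pf := lpP _ _ (iV n) fp; have Pg := lpP _ _ (iV n) gp.
have If := lpP _ _ iI fp; have Ig := lpP _ _ iI gp.
apply: le_trans (nrm_dist_triangle p1' Pf Pg If) _.
have h1 := small _ (iV n); have := small _ iI; rewrite nrm_distC => h2.
have h3 := nrm_dist_triangle p1' Pg Ig If; have h4 := NP n Nn.
move: h1 h2 h3 h4; move: (nrm p _) (nrm p _) (nrm p _) (nrm p _) => a b c d; lra.
Qed.

End DecreasingInvariant.

End Convergence.

Unset Implicit Arguments.
Set Strict Implicit.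
Local Close Scope complex_scope.

Theorem corollary2 (R : realType) (V : nat -> set (R -> R[i]))
  (V_invariant : forall n, invariant_subspace (V n))
  (V_0 : V 0%N = Hardy 2%:E)
  (V_decreasing : forall n, V n.+1 `<=` V n)
  (p : R) (p_gt1 : 1 < p) (f : R -> R[i]) (f_Hp : Hardy p%:E f) :
  let P (n : nat) := subspace_projection p%:E (V n) in
  let Pinfty := subspace_projection p%:E (\bigcap_n V n) in
  let Q (n : nat) (g : R -> R[i]) := fun t : R => P n g t - P n.+1 g t in
  circle_norm p%:E (fun t => \sum_(0 <= n < N) Q n f t - (f t - Pinfty f t))
    @[N --> \oo] --> 0%E.
Proof.
move=> P Pinfty Q; have p1' := ltW p_gt1; have p0 : 0 < p := lt_trans ltr01 p_gt1.
have fp : circle_Lp p%:E f by case: f_Hp.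
have iI := invariant_subspace_bigcap V_invariant.
have [C C0 CP] := subspace_projection_bound p_gt1.
have Pp n : circle_Lp p%:E (P n f) by have [/(_ _ fp)[]] := CP _ (V_invariant n).
have Ip : circle_Lp p%:E (Pinfty f) by have [/(_ _ fp)[]] := CP _ iI.
have P0f : circle_ae_eq (P 0%N f) f.
  (* The invariance of H^2 is read off from that of V 0. *)
  by have := V_invariant 0%N; rewrite /P V_0 => iH; exact: subspace_projection_H2.
have telescope N t : \sum_(0 <= n < N) Q n f t = P 0%N f t - P N f t.
  elim: N => [|N ih]; first by rewrite big_geq// subrr.
  by rewrite big_nat_recr//= ih /Q; ring.
have Sp N : circle_Lp p%:E (fun t => P 0%N f t - P N f t - (f t - Pinfty f t)).
  by apply: lpB => //; apply: lpB.
under eq_fun => N do under eq_fun => t do rewrite telescope.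
apply: circle_norm_cvg0 => //.
have := subspace_projection_cvg V_invariant V_decreasing p_gt1 fp; rewrite /lp_cvg.
rewrite (_ : (fun n => nrm p (fun t => subspace_projection p%:E (V n) f t -
    subspace_projection p%:E (\bigcap_n V n) f t)) =
  (fun N => nrm p (fun t => P 0%N f t - P N f t - (f t - Pinfty f t))))//.
(* With P_0 f replaced by [f], the error of the partial sum is the opposite of P_N f - P_oo f almost
   everywhere. *)
apply/funext => N; rewrite -nrmN; symmetry; apply: nrm_ae => //.
  exact: lp_cmeas (lpN p0 (lpB p1' (Pp N) Ip)).
by apply: (aeS _ P0f) => t ->; rewrite /P /Pinfty; ring.
Qed.
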